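(* Let $V\in\mathrm{Lip}([0,1])$ with $V'\le 0$ on $[0,1]$, let $\varepsilon>0$, and let the nonlocal kernel be $\gamma(z)=\mathds{1}_{(-\infty,0]}(z)\,e^{z}$. Let $\rho_0,\widetilde\rho_0\in\mathrm{L}^\infty(\mathbb{R})$ satisfy $0\le\rho_0\le1$, $0\le\widetilde\rho_0\le 1$, $\mathrm{TV}(\rho_0)<+\infty$, $\mathrm{TV}(\widetilde\rho_0)<+\infty$ and $\rho_0-\widetilde\rho_0\in\mathrm{L}^1(\mathbb{R})$. Let $\rho_\varepsilon$ and $\widetilde\rho_\varepsilon$ be the solutions of the nonlocal conservation law $$\partial_t\rho_\varepsilon(t,x)+\partial_x\big(V(W_\varepsilon[\rho_\varepsilon](t,x))\,\rho_\varepsilon(t,x)\big)=0,\qquad (t,x)\in\mathbb{R}_+\times\mathbb{R},$$ with initial data $\rho_0$ and $\widetilde\rho_0$, respectively, where $$W_\varepsilon[\rho](t,x)=\frac1\varepsilon\int_x^\infty\exp\Big(\frac{x-y}{\varepsilon}\Big)\rho(t,y)\,dy ,$$ and set $W_\varepsilon=W_\varepsilon[\rho_\varepsilon]$, $\widetilde W_\varepsilon=W_\varepsilon[\widetilde\rho_\varepsilon]$. Then, for every $t>0$, $$\|W_\varepsilon(t,\cdot)-\widetilde W_\varepsilon(t,\cdot)\|_{\mathrm{L}^1(\mathbb{R})}\le\|W_\varepsilon(0,\cdot)-\widetilde W_\varepsilon(0,\cdot)\|_{\mathrm{L}^1(\mathbb{R})}.$$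
   Context: $\mathrm{TV}$ is the total variation over $\mathbb{R}$, and $\mathds{1}_A$ is the indicator function of $A$. Solutions of the nonlocal conservation law are weak (distributional) solutions, which are known to exist and to be unique without any entropy condition; they take values in $[0,1]$, so that $V(W_\varepsilon[\rho_\varepsilon])$ is well defined. At $t=0$, $W_\varepsilon(0,x)=\frac1\varepsilon\int_x^\infty\exp\big(\frac{x-y}\varepsilon\big)\rho_0(y)\,dy$, and similarly for $\widetilde W_\varepsilon(0,\cdot)$ with $\widetilde\rho_0$. *)

(* Defs.v *)
From HB Require Import structures.
From mathcomp Require Import all_boot all_order all_algebra.
From mathcomp Require Import all_classical all_reals all_analysis.
Set Implicit Arguments.
Unset Strict Implicit.
Unset Printing Implicit Defensive.
Import Order.TTheory GRing.Theory Num.Theory.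
Import numFieldNormedType.Exports.
Local Open Scope classical_set_scope.
Local Open Scope ring_scope.

Notation leb R := (@lebesgue_measure R).

(* Elements of L^oo(R) and L^oo(R_+ x R) are represented by Borel functions,
   and every condition on their values is imposed almost everywhere. *)

Definition C1c (R : realType) (f : R -> R) : Prop :=
  [/\ forall x, derivable f x 1,
      continuous (derive1 f) &
      compact (closure [set x | f x != 0])].

(* Total variation over the real line of an element of L^oo(R), i.e. the
   variation of its distributional derivative; it does not depend on the
   representative u, contrary to realfun.total_variation. *)
Definition TV (R : realType) (u : R -> R) : \bar R :=
  ereal_sup [set (\int[leb R]_x (u x * derive1 f x))%:E
            | f in [set f : R -> R | C1c f /\ forall x, `|f x| <= 1]].

Definition dt (R : realType) (phi : R -> R -> R) (t x : R) : R :=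
  derive1 (fun s => phi s x) t.

Definition dx (R : realType) (phi : R -> R -> R) (t x : R) : R :=
  derive1 (phi t) x.

(* Test functions of (t, x) in the whole plane; their support may meet the
   line t = 0, which is how the initial datum enters the weak formulation. *)
Definition C1c2 (R : realType) (phi : R -> R -> R) : Prop :=
  [/\ forall t x, derivable (fun s => phi s x) t 1 /\ derivable (phi t) x 1,
      continuous (fun p : R * R => dt phi p.1 p.2),
      continuous (fun p : R * R => dx phi p.1 p.2) &
      compact (closure [set p : R * R | phi p.1 p.2 != 0])].

Definition exp_kernel (R : realType) (z : R) : R :=
  \1_(`]-oo, 0]) z * expR z.

(* W_eps[u], for a function u of the space variable only. *)
Definition Weps (R : realType) (eps : R) (u : R -> R) (x : R) : R :=
  eps^-1 * \int[leb R]_(y in `[x, +oo[) (expR ((x - y) / eps) * u y).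

Lemma Weps_kernelE (R : realType) (eps : R) (u : R -> R) (x : R) : 0 < eps ->
  Weps eps u x = eps^-1 * \int[leb R]_y (exp_kernel ((x - y) / eps) * u y).
Proof.
move=> eps0; rewrite /Weps Rintegral_mkcond; congr (_ * _).
apply: eq_Rintegral => y _; rewrite patchE /exp_kernel indicE.
have -> : (((x - y) / eps) \in [set` `]-oo, 0]]) = (y \in [set` `[x, +oo[]).
  apply/idP/idP; rewrite !inE /= !in_itv/= andbT pmulr_lle0 ?invr_gt0//;
    by rewrite subr_le0.
by case: ifP => _; rewrite ?mul1r ?mul0r.
Qed.

(* rho is a weak solution with values in [0, 1] of
     d_t rho + d_x (V(W_eps[rho]) rho) = 0   on R_+ x R,   rho(0, .) = rho0.
   The weak-* continuity in time selects, in the class of rho modulo null sets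
   of R_+ x R, the representative for which rho(t, .) is meaningful for every
   t >= 0; every bounded distributional solution has one.
   The values of rho t for t < 0 are irrelevant. *)
Record weak_solution (R : realType) (V : R -> R) (eps : R) (rho0 : R -> R)
    (rho : R -> R -> R) : Prop := WeakSolution {
  ws_measurable :
    measurable_fun [set p : R * R | 0 <= p.1] (fun p : R * R => rho p.1 p.2) ;
  ws_range : forall t : R, 0 <= t -> \forall x \ae leb R, 0 <= rho t x <= 1 ;
  ws_continuous : forall psi : R -> R, psi \in Lfun (leb R) 1%E ->
    {within `[0, +oo[, continuous (fun t : R => \int[leb R]_x (rho t x * psi x))} ;
  ws_weak : forall phi : R -> R -> R, C1c2 phi ->
    \int[(leb R \x leb R)%E]_(p in [set p : R * R | 0 <= p.1])
       (rho p.1 p.2 * dt phi p.1 p.2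
        + V (Weps eps (rho p.1) p.2) * rho p.1 p.2 * dx phi p.1 p.2)
    + \int[leb R]_x (rho0 x * phi 0 x) = 0
}.

(* Main.v *)
Require Import Defs.
From HB Require Import structures.
From mathcomp Require Import all_boot all_order all_algebra.
From mathcomp Require Import all_classical all_reals all_analysis.
From mathcomp Require Import measurable_realfun ring lra.
Import Order.TTheory GRing.Theory Num.Theory.
Import numFieldNormedType.Exports.
Set Implicit Arguments.
Unset Strict Implicit.
Unset Printing Implicit Defensive.
Local Open Scope classical_set_scope.
Local Open Scope ring_scope.

(* Since [W = Weps eps rho] solves [rho = W - eps * W_x], testing the equation with the
   adjoint average [psi] of [phi] gives [d/dt (int W phi) = int V(W) rho psi_x] with
   [psi_x = (phi - psi) / eps].  For two solutions take
   [phi = sgn (W1 - W2) * exp (- l |x|)], with [sgn] smoothed at scale [d]; then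
   [d/dt (int |W1 - W2| exp (- l |x|))] is, up to the smoothing,
     [int (H(W1) - H(W2)) (phi - psi) / eps - int phi (G(W1) - G(W2))_x]
   where [G' = V] and [H(w) = V(w) w - G(w)].  As [V' <= 0], [H] is nonincreasing, hence
   [(H(W1) - H(W2)) phi = - |H(W1) - H(W2)| exp (- l |x|)]; as [|psi|] is at most
   [(1 + O(l)) exp (- l |x|)], the first integral is at most [O(l) int |W1 - W2| exp (- l |x|)].
   The second one is of the same order after an integration by parts.  Gronwall's lemma, then
   [d -> 0] and [l -> 0], yield the contraction. *)

(** A priori [W1 - W2] is only bounded, so its integral and the flux at infinity have no meaning
    without the weight; integrability at time [t] is an outcome, read off by monotone convergence in
    the extended reals. As [r] is merely measurable, [Weps eps r] is merely Lipschitz in space. The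
    chain rule for the flux is therefore proved for increments, with an error quadratic in the step,
    and the quotients are moved onto [psi = Wadj eps phi], which is C^1 as soon as [phi] is
    continuous. The same gain of regularity makes [psi] an admissible test function although [phi]
    is built from the solutions. The relation [psi_x = (phi - psi) / eps] is what makes the sign of
    [H] useful: the local term [phi] dissipates exactly what the nonlocal term [psi] can produce, up
    to the excess [O(l)] of the averaged weight over the weight. The order of the limits is forced:
    the space step vanishes at fixed [d], because its error is of order step over [d]; then [d] at
    fixed [l], because its error is [d] times the integral of the weight, of order [d / l]; and [l]
    last. *)

Notation intg f := ((leb _).-integrable setT (EFin \o f)).

(** * Integrals on the line *)

Section real_integrals.
Context {R : realType}.
Implicit Types f g : R -> R.

Lemma intg_measurable f : intg f -> measurable_fun setT f.
Proof. by move=> /measurable_int/measurable_EFinP. Qed.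

Lemma intg_le f g : measurable_fun setT f -> intg g ->
  (forall x, `|f x| <= g x) -> intg f.
Proof.
move=> mf ig fg; apply: le_integrable ig => //; first exact/measurable_EFinP.
by move=> x _ /=; rewrite lee_fin (le_trans (fg x))// ler_norm.
Qed.

Lemma intgD f g : intg f -> intg g -> intg (fun x => f x + g x).
Proof. by move=> fi gi; have := integrableD measurableT fi gi; exact. Qed.

Lemma intgB f g : intg f -> intg g -> intg (fun x => f x - g x).
Proof. by move=> fi gi; have := integrableB measurableT fi gi; exact. Qed.

Lemma intgZ (c : R) f : intg f -> intg (fun x => c * f x).
Proof. by move=> fi; have := integrableZl measurableT c fi; exact. Qed.

Lemma intgM f g (C : R) : intg f -> measurable_fun setT g ->
  (forall x, `|g x| <= C) -> intg (fun x => g x * f x).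
Proof.
move=> fi mg gC; have mf := intg_measurable fi.
apply: (@intg_le _ (fun x => C * `|f x|)).
- exact: measurable_funM.
- apply: intgZ; exact: integrable_norm fi.
- by move=> x; rewrite normrM ler_wpM2r.
Qed.

Lemma le_Rint f g : intg f -> intg g -> (forall x, f x <= g x) ->
  \int[leb R]_x f x <= \int[leb R]_x g x.
Proof. by move=> fi gi fg; apply: le_Rintegral. Qed.

Lemma le_abs_Rint f g : measurable_fun setT f -> intg g ->
  (forall x, `|f x| <= g x) ->
  `|\int[leb R]_x f x| <= \int[leb R]_x g x.
Proof.
move=> mf gi fg; have fi := intg_le mf gi fg.
apply: (le_trans (le_normr_Rintegral measurableT fi)).
by apply: le_Rint => //; exact: integrable_norm fi.
Qed.

Lemma Rint_dct_ae (f_ : nat -> R -> R) f g :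
  (forall n, measurable_fun setT (f_ n)) -> measurable_fun setT f ->
  {ae leb R, forall x, f_ n x @[n --> \oo] --> f x} -> intg g ->
  (forall n x, `|f_ n x| <= g x) ->
  \int[leb R]_x f_ n x @[n --> \oo] --> \int[leb R]_x f x.
Proof.
move=> mf_ mf ff gi fg.
have [] := @dominated_convergence _ _ _ (leb R) setT measurableT
  (fun n => EFin \o f_ n) (EFin \o f) (EFin \o g) => //.
- by move=> n; apply/measurable_EFinP; exact: mf_.
- by apply/measurable_EFinP; exact: mf.
- move: ff; apply: filterS; first exact: (ae_filter_ringOfSetsType (leb R)).
  by move=> x fx _; apply/fine_cvgP; split; [exact: nearW|exact: fx].
- by apply: aeW => x n _ /=; rewrite lee_fin.
move=> fi _ h; apply: fine_cvg.
by rewrite /Rintegral fineK//; exact: integrable_fin_num.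
Qed.

Lemma Rint_dct (f_ : nat -> R -> R) f g :
  (forall n, measurable_fun setT (f_ n)) -> measurable_fun setT f ->
  (forall x, f_ n x @[n --> \oo] --> f x) -> intg g ->
  (forall n x, `|f_ n x| <= g x) ->
  \int[leb R]_x f_ n x @[n --> \oo] --> \int[leb R]_x f x.
Proof. by move=> ? ? ff; apply: Rint_dct_ae => //; exact: aeW. Qed.

Section measure_preserving.
Variable phi : measurableTypeR R -> measurableTypeR R.
Hypothesis mphi : measurable_fun setT phi.
Let mphi_mixin := isMeasurableFun.Build _ _ _ _ _ mphi.
Let mphi_pack : {mfun _ >-> _} := HB.pack phi mphi_mixin.
Hypothesis phiP : forall a b : R, a < b ->
  leb R (phi @^-1` `]a, b]) = (b - a)%:E.

(** Half-open intervals determine Lebesgue measure, so it suffices to compare the image measure on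
    them. Translations and the reflection are the two instances. *)
Let phi_preserving (A : set (measurableTypeR R)) : measurable A ->
  pushforward (leb R) phi A = leb R A.
Proof.
move=> mA; apply/esym/(@lebesgue_measure_unique _
  (pushforward (leb R) mphi_pack)) => //= _ [[u v]] _ <-.
rewrite lebesgue_measure_itv/= lte_fin /pushforward.
case: ifPn => uv; first by rewrite phiP// EFinB.
by rewrite set_itv_ge ?bnd_simp// preimage_set0 measure0.
Qed.

Lemma intg_preserving f : intg f -> intg (f \o phi).
Proof.
move=> fi; have mf := intg_measurable fi.
apply/integrableP; split.
  by apply/measurable_EFinP; exact: measurableT_comp mphi.
move/integrableP : fi => [_]; congr (_ < _)%E.
rewrite -[RHS](@ge0_integral_pushforward _ _ _ _ _ _ mphi (leb R) setT
  (fun x => `|(EFin \o f) x|%E))//; last first.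
  by apply/measurableT_comp => //; apply/measurable_EFinP.
by apply: eq_measure_integral => A mA _; rewrite [RHS]phi_preserving.
Qed.

Lemma Rint_preserving f : intg f ->
  \int[leb R]_x f (phi x) = \int[leb R]_x f x.
Proof.
move=> fi; have mf := intg_measurable fi.
rewrite /Rintegral; congr fine.
rewrite -[LHS](@integral_pushforward _ _ _ _ _ _ mphi (leb R) setT
  (EFin \o f))//.
- by apply: eq_measure_integral => A mA _; rewrite [LHS]phi_preserving.
- by apply/measurable_EFinP.
- exact: intg_preserving.
Qed.

End measure_preserving.

Let shift_preserving (c a b : R) : a < b ->
  leb R ((fun x => x + c) @^-1` `]a, b]) = (b - a)%:E.
Proof.
move=> ab; have -> : (fun x => x + c) @^-1` `]a, b] = `]a - c, b - c]%classic.
  by apply/seteqP; split=> x /=; rewrite !in_itv/= ltrBlDr lerBrDr.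
rewrite lebesgue_measure_itv/= lte_fin ltrD2r ab.
by rewrite -EFinB; congr EFin; ring.
Qed.

Let opp_preserving (a b : R) : a < b ->
  leb R (-%R @^-1` `]a, b]) = (b - a)%:E.
Proof.
move=> ab; rewrite opp_preimage_itvbndbnd/= lebesgue_measure_itv/=.
by rewrite lte_fin ltrN2 ab -EFinD opprK addrC.
Qed.

Lemma intg_shift f (c : R) : intg f -> intg (fun x => f (x + c)).
Proof.
by apply: intg_preserving; [exact: measurable_funD|exact: shift_preserving].
Qed.

Lemma Rint_shift f (c : R) : intg f ->
  \int[leb R]_x f (x + c) = \int[leb R]_x f x.
Proof.
apply: (@Rint_preserving (fun x => x + c)); first exact: measurable_funD.
exact: shift_preserving.
Qed.

Lemma intg_opp f : intg f -> intg (fun x => f (- x)).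
Proof.
by apply: (@intg_preserving -%R); [exact: oppr_measurable|exact: opp_preserving].
Qed.

Lemma Rint_opp f : intg f -> \int[leb R]_x f (- x) = \int[leb R]_x f x.
Proof.
by apply: (@Rint_preserving -%R); [exact: oppr_measurable|exact: opp_preserving].
Qed.

End real_integrals.

(** * The exponential kernel and the exponential weight *)

Section kernel.
Context {R : realType}.
Implicit Types (eps l x y z : R) (f g u : R -> R).

(** The bound [g] gives the finiteness of the iterated integral of the modulus. The integrability of
    every single section, not only of almost all, lets the extended-real iterated integrals be read
    as real ones. *)
Lemma Rint_fubini (F : R -> R -> R) g :
  measurable_fun setT (fun p : R * R => F p.1 p.2) ->
  (forall x, intg (F x)) -> (forall y, intg (fun x => F x y)) ->
  intg g -> (forall x, \int[leb R]_y `|F x y| <= g x) ->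
  [/\ intg (fun x => \int[leb R]_y F x y),
      (leb R \x leb R)%E.-integrable setT (fun p : R * R => (F p.1 p.2)%:E),
      \int[(leb R \x leb R)%E]_p F p.1 p.2 = \int[leb R]_x \int[leb R]_y F x y &
      \int[leb R]_x \int[leb R]_y F x y = \int[leb R]_y \int[leb R]_x F x y].
Proof.
move=> mF F1 F2 gi Fg.
have mEF : measurable_fun setT (fun p : R * R => (F p.1 p.2)%:E).
  exact/measurable_EFinP.
have iF : (leb R \x leb R)%E.-integrable setT (fun p : R * R => (F p.1 p.2)%:E).
  apply/integrable12ltyP => //=.
  move/integrableP : gi => [mg]; apply: le_lt_trans.
  have mm : measurable_fun setT (fun x : R => \int[leb R]_y (`|(F x y)%:E|))%E.
    apply: (@measurable_fun_fubini_tonelli_F _ _ _ _ _ (leb R)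
      (fun p : R * R => `|(F p.1 p.2)%:E|%E)) => //.
    exact: measurableT_comp.
  apply: ge0_le_integral => //=.
  - by move=> x _; exact: integral_ge0.
  - by apply/measurable_EFinP; apply: measurableT_comp => //; apply/measurable_EFinP; exact: mg.
  move=> x _; apply: (@le_trans _ _ (g x)%:E); last by rewrite lee_fin ler_norm.
  have := Fg x; rewrite -lee_fin; congr (_ <= _)%E.
  rewrite /Rintegral fineK//; apply: integrable_fin_num => //.
  exact: (integrable_norm (F1 x)).
have E1 x : (\int[leb R]_y (F x y)%:E)%E = (\int[leb R]_y F x y)%:E.
  by rewrite fineK//; apply: integrable_fin_num => //; exact: F1.
have E2 y : (\int[leb R]_x (F x y)%:E)%E = (\int[leb R]_x F x y)%:E.
  by rewrite fineK//; apply: integrable_fin_num => //; exact: F2.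
split => //.
- have := integrable_fubini_F iF; congr (integrable _ _ _).
  by apply/funext => x; exact: E1.
- rewrite {1}/Rintegral -integral12_prod_meas1//.
  by congr fine; apply: eq_integral => x _; exact: E1.
- rewrite /Rintegral; congr fine.
  transitivity (\int[leb R]_x \int[leb R]_y (F x y)%:E)%E.
    by apply: eq_integral => x _; rewrite E1.
  rewrite (Fubini iF)/=.
  by apply: eq_integral => x _; rewrite E2.
Qed.

(** The density of the exponential law of rate [eps^-1]; [K eps (y - x)] is the weight given to
    [u y] in [Weps eps u x]. *)
Definition K eps z : R := if 0 <= z then eps^-1 * expR (- z / eps) else 0.

Lemma K_ge0 eps z : 0 < eps -> 0 <= K eps z.
Proof.
by move=> e0; rewrite /K; case: ifP => // _; rewrite mulr_ge0 ?expR_ge0 ?invr_ge0 ?ltW.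
Qed.

Lemma K_le eps z : 0 < eps -> K eps z <= eps^-1.
Proof.
move=> e0; rewrite /K; case: ifP => // z0; last by rewrite invr_ge0 ltW.
rewrite -[leRHS]mulr1 ler_wpM2l ?invr_ge0 ?(ltW e0)//.
by rewrite -expR0 ler_expR mulNr oppr_le0 divr_ge0// ltW.
Qed.

Lemma K_pdf eps : K eps = exponential_pdf eps^-1.
Proof.
apply/funext => z; rewrite /K /exponential_pdf patchE.
case: ifPn => z0; first by rewrite mem_set /= ?in_itv/= ?z0// mulNr (mulrC z) mulNr.
by rewrite memNset//= in_itv/= andbT; exact/negP.
Qed.

Lemma measurable_K eps : measurable_fun setT (K eps).
Proof. rewrite K_pdf; exact: measurable_exponential_pdf. Qed.

Lemma integral_K eps : 0 < eps -> (\int[leb R]_z (K eps z)%:E = 1)%E.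
Proof. by move=> e0; rewrite K_pdf integral_exponential_pdf ?invr_gt0. Qed.

Lemma intg_K eps : 0 < eps -> intg (K eps).
Proof.
move=> e0; apply/integrableP; split.
  by apply/measurable_EFinP; exact: measurable_K.
under eq_integral do rewrite /= ger0_norm ?K_ge0//.
by rewrite integral_K// ltry.
Qed.

Lemma Rint_K eps : 0 < eps -> \int[leb R]_z K eps z = 1.
Proof. by move=> e0; rewrite /Rintegral integral_K. Qed.

Lemma measurable_Kl eps x : measurable_fun setT (fun y => K eps (y - x)).
Proof.
apply: measurableT_comp; first exact: measurable_K.
exact: measurable_funB.
Qed.

Lemma measurable_Kr eps y : measurable_fun setT (fun x => K eps (y - x)).
Proof.
apply: measurableT_comp; first exact: measurable_K.
exact: measurable_funB.
Qed.

Lemma intg_Kl eps x : 0 < eps -> intg (fun y => K eps (y - x)).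
Proof. by move=> e0; exact: (intg_shift (- x) (intg_K e0)). Qed.

Lemma intg_Kr eps y : 0 < eps -> intg (fun x => K eps (y - x)).
Proof.
move=> e0; have := intg_opp (intg_shift y (intg_K e0)).
by congr (integrable _ _ (_ \o _)); apply/funext => x; rewrite addrC.
Qed.

Lemma Rint_Kl eps x : 0 < eps -> \int[leb R]_y K eps (y - x) = 1.
Proof. by move=> e0; rewrite (Rint_shift _ (intg_K e0)) Rint_K. Qed.

Lemma Rint_Kr eps y : 0 < eps -> \int[leb R]_x K eps (y - x) = 1.
Proof.
move=> e0; have := Rint_opp (intg_shift y (intg_K e0)).
rewrite (Rint_shift _ (intg_K e0)) Rint_K// => <-.
by apply: eq_Rintegral => x _; rewrite addrC.
Qed.

Lemma WepsE eps u x C : 0 < eps -> measurable_fun setT u ->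
  (forall x, `|u x| <= C) ->
  Weps eps u x = \int[leb R]_y (K eps (y - x) * u y).
Proof.
move=> e0 mu uC; rewrite /Weps Rintegral_mkcond.
set f := _ \_ _.
have E : (fun y => K eps (y - x) * u y) = (fun y => eps^-1 * f y).
  apply/funext => y; rewrite /f patchE /K subr_ge0.
  have -> : (y \in `[x, +oo[%classic) = (x <= y).
    by apply/idP/idP; rewrite inE/= in_itv/= andbT.
  by case: ifP => _; rewrite ?mul0r ?mulr0// opprB mulrA.
have fi : intg f.
  have := intgZ eps (intgM (intg_Kl x e0) mu uC).
  congr (integrable _ _ (_ \o _)); apply/funext => y.
  rewrite (_ : u y * _ = eps^-1 * f y); last by rewrite mulrC; move/funeqP: E.
  by rewrite mulrA mulfV ?mul1r// gt_eqF.
by rewrite E RintegralZl.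
Qed.

End kernel.

(** * Exponentially decaying functions and the adjoint average *)

Section weighted_integrals.
Context {R : realType}.
Implicit Types (eps l x y z C : R) (f g u phi : R -> R).

Lemma eq_intg f g : f =1 g -> intg f -> intg g.
Proof. by move=> /funext ->. Qed.

Definition weight l x := expR (- (l * `|x|)).

Lemma weight_gt0 l x : 0 < weight l x. Proof. exact: expR_gt0. Qed.

Lemma weight_ge0 l x : 0 <= weight l x. Proof. exact: expR_ge0. Qed.

Lemma weight_le1 l x : 0 <= l -> weight l x <= 1.
Proof. by move=> l0; rewrite -expR0 ler_expR oppr_le0 mulr_ge0. Qed.

(** This slow variation is what makes the weight compatible with translations, with averaging at
    scale [eps] and with difference quotients. *)
Lemma weight_shift l x y : 0 <= l -> weight l x <= expR (l * `|x - y|) * weight l y.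
Proof.
move=> l0; rewrite -expRD ler_expR -mulrBr -mulrN ler_wpM2l//.
by have := ler_normD (y - x) x; rewrite subrK distrC => ?; lra.
Qed.

Lemma continuous_weight l : continuous (weight l).
Proof.
move=> x; apply: continuous_comp; last exact: continuous_expR.
apply: (@continuousN _ R^o); apply: continuousM; first exact: cst_continuous.
exact: norm_continuous.
Qed.

Lemma measurable_weight l : measurable_fun setT (weight l).
Proof. by apply: continuous_measurable_fun; exact: continuous_weight. Qed.

Lemma intg_weight l : 0 < l -> intg (weight l).
Proof.
move=> l0; have l'0 : 0 < l^-1 by rewrite invr_gt0.
(* Two mirrored exponential densities of scale [l^-1]; both are positive at [0], hence a domination
   rather than an equality. *)
apply: (@intg_le _ _ (fun x => l^-1 * (K l^-1 x + K l^-1 (- x)))).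
- exact: measurable_weight.
- by apply: intgZ; apply: intgD; [exact: intg_K|exact: (intg_opp (intg_K l'0))].
move=> x; rewrite ger0_norm ?weight_ge0// mulrDr /K invrK oppr_ge0 opprK.
rewrite /weight; have [x0|x0] := leP 0 x; rewrite ?(ltW x0) ?(ger0_norm x0) ?(ltr0_norm x0).
- rewrite mulrA mulVf ?gt_eqF// mul1r mulNr (mulrC x) lerDl.
  case: ifP => // _; rewrite ?mulr0// !mulr_ge0 ?expR_ge0 ?(ltW l0) ?(ltW l'0)//.
- by rewrite mulr0 add0r mulrA mulVf ?gt_eqF// mul1r mulrN opprK mulrC.
Qed.

(** The class of test functions: integrable for [0 < l], stable under translations and bounded
    factors, and under [Wadj eps] for continuous functions when [l * eps <= 2^-1]. *)
Definition dom l f :=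
  measurable_fun setT f /\ exists C, forall x, `|f x| <= C * weight l x.

Lemma dom_intg l f : 0 < l -> dom l f -> intg f.
Proof.
by move=> l0 [mf [C fC]]; apply: intg_le fC => //; apply: intgZ; exact: intg_weight.
Qed.

Lemma dom_bounded l f : 0 <= l -> dom l f -> exists C, forall x, `|f x| <= C.
Proof.
move=> l0 [mf [C fC]]; exists `|C| => x; apply: (le_trans (fC x)).
rewrite -[leRHS]mulr1 (le_trans (ler_wpM2r (weight_ge0 _ _) (ler_norm _)))//.
by rewrite ler_wpM2l// weight_le1.
Qed.

Lemma eq_dom l f g : f =1 g -> dom l f -> dom l g.
Proof. by move=> /funext ->. Qed.

Lemma dom_weight l : dom l (weight l).
Proof.
split; first exact: measurable_weight.
by exists 1 => x; rewrite mul1r ger0_norm ?weight_ge0.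
Qed.

Lemma domD l f g : dom l f -> dom l g -> dom l (fun x => f x + g x).
Proof.
move=> [mf [C fC]] [mg [D gD]]; split; first exact: measurable_funD.
exists (C + D) => x; rewrite mulrDl (le_trans (ler_normD _ _))//.
exact: lerD.
Qed.

Lemma domM l f g D : dom l f -> measurable_fun setT g -> (forall x, `|g x| <= D) ->
  dom l (fun x => g x * f x).
Proof.
move=> [mf [C fC]] mg gD; split; first exact: measurable_funM.
exists (D * C) => x; rewrite normrM -mulrA ler_pM//.
Qed.

Lemma domMr l f g D : dom l f -> measurable_fun setT g -> (forall x, `|g x| <= D) ->
  dom l (fun x => f x * g x).
Proof.
move=> df mg gD; apply: eq_dom (domM df mg gD) => x; exact: mulrC.
Qed.

Lemma domZ l f (c : R) : dom l f -> dom l (fun x => c * f x).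
Proof. by move=> df; apply: (domM (D := `|c|) df). Qed.

Lemma domB l f g : dom l f -> dom l g -> dom l (fun x => f x - g x).
Proof.
move=> df dg; apply: eq_dom (domD df (domZ (-1) dg)) => x; by rewrite mulN1r.
Qed.

Lemma dom_shift l f (a : R) : 0 <= l -> dom l f -> dom l (fun x => f (x + a)).
Proof.
move=> l0 [mf [C fC]]; split.
  by apply: measurableT_comp => //; exact: measurable_funD.
exists (`|C| * expR (l * `|a|)) => x; apply: (le_trans (fC _)).
rewrite -mulrA; apply: (le_trans (ler_wpM2r (weight_ge0 _ _) (ler_norm _))).
rewrite ler_wpM2l//; apply: (le_trans (weight_shift _ x l0)).
by rewrite addrAC subrr add0r.
Qed.

(* The adjoint of [Weps eps], see [Weps_adjoint]. *)
Definition Wadj eps phi y := \int[leb R]_x (K eps (y - x) * phi x).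

(** The weight grows by at most [expR (l * (y - x))] from [y] to [x], which turns the kernel of
    scale [eps] into one of scale [e' = (eps^-1 - l)^-1]. Its total mass
    [e' / eps = (1 - l * eps)^-1] is at most [1 + 2 * (l * eps)] when [l * eps <= 2^-1]. *)
Lemma Wadj_weight eps l y : 0 < eps -> 0 <= l -> l * eps <= 2^-1 ->
  Wadj eps (weight l) y <= (1 + 2 * (l * eps)) * weight l y.
Proof.
move=> e0 l0 le; pose e' := (eps^-1 - l)^-1.
have e'V : 0 < eps^-1 - l.
  rewrite subr_gt0 -(ltr_pM2r e0) mulVf ?gt_eqF//.
  by lra.
have e'0 : 0 < e' by rewrite invr_gt0.
have Kbd x : K eps (y - x) * weight l x <= (eps^-1 * e' * weight l y) * K e' (y - x).
  rewrite {1}/K /K; case: ifPn => yx; last by rewrite mul0r mulr0.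
  apply: (@le_trans _ _ (eps^-1 * expR (- (y - x) / eps) * (expR (l * `|x - y|) * weight l y))).
    by rewrite ler_wpM2l ?weight_shift// mulr_ge0 ?expR_ge0 ?invr_ge0 ?ltW.
  rewrite distrC (ger0_norm yx).
  rewrite [leRHS](_ : _ = eps^-1 * (e' * e'^-1) * weight l y * expR (- (y - x) / e')); last by ring.
  rewrite mulfV ?gt_eqF// mulr1 !mulrA [leLHS](_ : _ =
     eps^-1 * weight l y * (expR (- (y - x) / eps) * expR (l * (y - x)))); last by ring.
  rewrite -expRD /e' invrK le_eqVlt; apply/orP; left; apply/eqP.
  by congr (_ * expR _); ring.
have -> : (1 + 2 * (l * eps)) * weight l y = \int[leb R]_x ((1 + 2 * (l * eps)) * weight l y * K e' (y - x)).
  by rewrite RintegralZl ?intg_Kr// Rint_Kr// mulr1.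
have iK := intg_Kr y e'0.
rewrite /Wadj; apply: le_Rint.
- apply: intg_le (intgZ ((eps^-1 * e' * weight l y)) iK) _.
  + by apply: measurable_funM; [exact: measurable_Kr|exact: measurable_weight].
  + by move=> x; rewrite ger0_norm ?mulr_ge0 ?K_ge0 ?weight_ge0.
- exact: intgZ.
move=> x; apply: (le_trans (Kbd x)).
rewrite ler_wpM2r ?K_ge0// ler_wpM2r ?weight_ge0//.
rewrite /e' -invfM mulrBr mulfV ?gt_eqF//.
have x0 : 0 <= l * eps by rewrite mulr_ge0// ltW.
have x1 : 0 < 1 - eps * l by rewrite mulrC; lra.
rewrite -(ler_pM2r x1) mulVf ?gt_eqF// (mulrC eps).
by move: x0 le; set k := l * eps => k0 le; nra.
Qed.

Lemma Wadj_le eps l phi C y : 0 < eps -> 0 < l -> l * eps <= 2^-1 ->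
  measurable_fun setT phi -> (forall x, `|phi x| <= C * weight l x) ->
  `|Wadj eps phi y| <= C * (1 + 2 * (l * eps)) * weight l y.
Proof.
move=> e0 l0 le mphi phiC.
have C0 : 0 <= C.
  have := le_trans (normr_ge0 _) (phiC 0).
  by rewrite pmulr_lge0 ?weight_gt0.
have iKth : intg (fun x => K eps (y - x) * weight l x).
  apply: (intgM (C := eps^-1) (intg_weight l0)); first exact: measurable_Kr.
  by move=> x; rewrite ger0_norm ?K_ge0 ?K_le.
apply: (@le_trans _ _ (\int[leb R]_x (C * (K eps (y - x) * weight l x)))).
  apply: le_abs_Rint.
  - by apply: measurable_funM => //; exact: measurable_Kr.
  - exact: intgZ.
  move=> x; rewrite normrM (ger0_norm (K_ge0 _ e0)) mulrCA.
  by rewrite ler_wpM2l ?K_ge0.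
by rewrite RintegralZl// -mulrA ler_wpM2l// Wadj_weight// ltW.
Qed.

(** The exponential kernel factorizes: [y] remains only in a prefactor [expR (- y / eps)] and in the
    upper bound of an integral over []-oo, y]], so the product rule and the fundamental theorem of
    calculus apply. *)
Lemma is_derive_Wadj eps l phi y : 0 < eps -> 0 < l ->
  continuous phi -> dom l phi ->
  is_derive y 1 (Wadj eps phi) ((phi y - Wadj eps phi y) / eps).
Proof.
move=> e0 l0 cphi dphi; have [mphi _] := dphi.
pose g x := expR (x / eps) * phi x.
have cg : continuous g.
  move=> x; apply: cvgM; last exact: cphi.
  apply: (@continuous_comp _ _ _ (fun x => x / eps) expR); last exact: continuous_expR.
  by apply: cvgM; [exact: cvg_id|exact: cvg_cst].
have mg : measurable_fun setT g by apply: continuous_measurable_fun.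
have ig b : (leb R).-integrable `]-oo, b] (EFin \o g).
  apply/integrable_mkcond => //; rewrite restrict_EFin.
  apply: (@intg_le _ _ (fun x => expR (b / eps) * `|phi x|)).
  - apply/measurable_restrict => //; exact: measurable_funS mg.
  - by apply: intgZ; exact: (integrable_norm (dom_intg l0 dphi)).
  - move=> x; rewrite patchE; case: ifPn => [|_].
      rewrite inE/= in_itv/= => xu; rewrite normrM ler_wpM2r//.
      by rewrite ger0_norm ?expR_ge0// ler_expR ler_pM2r ?invr_gt0.
    by rewrite normr0 mulr_ge0 ?expR_ge0.
have KbE z : Wadj eps phi z = eps^-1 * expR (- z / eps) * \int[leb R]_(x in `]-oo, z]) g x.
  rewrite -RintegralZl// Rintegral_mkcond; apply: eq_Rintegral => x _.
  rewrite patchE /K subr_ge0.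
  have -> : (x \in `]-oo, z]%classic) = (x <= z).
    by apply/idP/idP; rewrite inE/= in_itv.
  case: ifP => xz; last by rewrite mul0r.
  rewrite /g !mulrA; congr (_ * _); rewrite -!mulrA -expRD; congr (_ * expR _).
  by ring.
have yy1 : y < y + 1 by rewrite ltrDl.
have := @continuous_FTC1 _ g -oo%O y (y + 1) yy1 (ig _).
move=> /= ftc; have {ftc} [||dG G'] := ftc; [by rewrite ltNyr|exact: cg|].
set G := fun x => _ in dG G'.
have -> : Wadj eps phi = (fun z => eps^-1 * expR (- z / eps)) * G.
  by apply/funext => z; rewrite KbE.
have isG : is_derive y 1 G (g y) by apply: DeriveDef dG _; rewrite -derive1E.
have isE : is_derive y 1 (fun z => eps^-1 * expR (- z / eps))
    (- eps^-1 * (eps^-1 * expR (- y / eps))).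
  have h : is_derive y 1 (fun z => - z / eps) (- eps^-1).
    have -> : (fun z => - z / eps) = (fun z => (- eps^-1) *: z).
      by apply/funext => z; rewrite /GRing.scale/=; ring.
    by apply: is_derive_eq; rewrite /GRing.scale/= mulr1.
  have dE : is_derive y 1 (fun z => expR (- z / eps)) (expR (- y / eps) * - eps^-1).
    exact: (@is_derive1_comp _ expR (fun z => - z / eps)).
  have -> : (fun z => eps^-1 * expR (- z / eps)) = eps^-1 \*: (fun z => expR (- z / eps)).
    by [].
  by apply: is_derive_eq; rewrite /GRing.scale/=; ring.
apply: is_derive_eq; rewrite !fctE /GRing.scale/= /g.
rewrite (_ : expR (y / eps) = (expR (- y / eps))^-1); last by rewrite -expRN mulNr opprK.
by field; rewrite gt_eqF ?gt_eqF ?expR_gt0.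
Qed.

End weighted_integrals.

(** * Averages of densities and the adjoint identity *)

Section adjoint.
Context {R : realType}.
Implicit Types (eps l x y z C : R) (f g u phi r Psi : R -> R).

Lemma is_derive_continuous f df : (forall x, is_derive x (1 : R) f (df x)) ->
  continuous f.
Proof.
move=> fd x; apply: differentiable_continuous; apply/derivable1_diffP.
exact: ex_derive.
Qed.

Lemma is_derive_quadratic (f : R -> R) t d C :
  (\forall h \near (0 : R), `|f (h + t) - f t - h * d| <= C * h ^+ 2) ->
  is_derive t 1 f d.
Proof.
move=> key.
suff cv : h^-1 *: ((f \o shift t) (h *: 1) - f t) @[h --> (0 : R)^'] --> d.
  by apply: DeriveDef; [apply/cvg_ex; eexists; exact: cv|exact: cvg_lim cv].
apply/cvgrPdist_le => e e0; near=> h.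
have h0 : h != 0 by near: h; exact: nbhs_dnbhs_neq.
rewrite /GRing.scale/= mulr1.
rewrite (_ : _ - _ = - (h^-1 * (f (h + t) - f t - h * d))); last by field.
rewrite normrN normrM normfV ler_pdivrMl ?normr_gt0//.
apply: (@le_trans _ _ (C * h ^+ 2)); first by near: h; exact: nbhs_dnbhs.
apply: (@le_trans _ _ (`|C| * (`|h| * `|h|))).
  by rewrite -normrM -expr2 (ger0_norm (sqr_ge0 _)) ler_wpM2r ?sqr_ge0 ?ler_norm.
rewrite mulrCA ler_wpM2l//.
apply: (@le_trans _ _ (`|C| * (e / (`|C| + 1)))).
  rewrite ler_wpM2l//; near: h; apply: dnbhs0_le.
  by rewrite divr_gt0// ltr_wpDl.
by rewrite mulrA ler_pdivrMr ?ltr_wpDl// mulrDr mulr1 mulrC lerDl ltW.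
Unshelve. all: by end_near. Qed.

Lemma mean_value f df (a b : R) : a <= b -> (forall x, is_derive x (1 : R) f (df x)) ->
  exists2 c, a <= c <= b & f b - f a = df c * (b - a).
Proof.
move=> ab fd.
have cf : {within `[a, b], continuous f}.
  by apply: continuous_subspaceT; exact: is_derive_continuous fd.
by have [c cab E] := MVT_segment ab (fun x _ => fd x) cf; exists c.
Qed.

Lemma is_derive_seq f x (d : R) (h : nat -> R) : is_derive x 1 f d ->
  h n @[n --> \oo] --> 0 -> (forall n, h n != 0) ->
  (f (x + h n) - f x) / h n @[n --> \oo] --> d.
Proof.
move=> [df <-] h0 hn0.
have -> : (fun n => (f (x + h n) - f x) / h n) =
    (fun k => k^-1 *: ((f \o shift x) (k *: 1) - f x)) \o h.
  apply/funext => n /=; rewrite /GRing.scale/= mulr1 mulrC.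
  by rewrite [h n + x]addrC.
apply: (@cvg_comp _ _ _ _ _ _ (0 : R)^'); last exact: df.
move=> A; rewrite /dnbhs /within/= => A0.
have := h0 _ A0; rewrite /nbhs/=; apply: filterS => n /=; apply; exact: hn0.
Qed.

Lemma dom_Wadj eps l phi : 0 < eps -> 0 < l -> l * eps <= 2^-1 ->
  continuous phi -> dom l phi -> dom l (Wadj eps phi).
Proof.
move=> e0 l0 le cphi dphi; have [mphi [C phiC]] := dphi.
split.
  apply: continuous_measurable_fun.
  apply: (@is_derive_continuous _ (fun x => (phi x - Wadj eps phi x) / eps)) => x.
  exact: is_derive_Wadj l0 cphi dphi.
by exists (C * (1 + 2 * (l * eps))) => x; exact: Wadj_le.
Qed.

Lemma difference_quotient_integral l g B Psi D (h : nat -> R) :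
  0 < l -> measurable_fun setT g -> (forall x, `|g x| <= B) ->
  (forall x, is_derive x 1 Psi (D x)) -> dom l D ->
  h n @[n --> \oo] --> 0 -> (forall n, h n != 0) -> (forall n, `|h n| <= 1) ->
  \int[leb R]_x (g x * ((Psi (x + h n) - Psi x) / h n)) @[n --> \oo] -->
  \int[leb R]_x (g x * D x).
Proof.
move=> l0 mg gB dPsi [mD [C DC]] h0 hn0 hn1.
have C0 : 0 <= C.
  by have := le_trans (normr_ge0 _) (DC 0); rewrite pmulr_lge0 ?weight_gt0.
have mPsi : measurable_fun setT Psi.
  by apply: continuous_measurable_fun; exact: is_derive_continuous dPsi.
apply: (@Rint_dct _ _ _ (fun x => B * (C * expR l) * weight l x)).
- move=> n; apply: measurable_funM => //; apply: measurable_funM => //.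
  apply: measurable_funB => //; apply: measurableT_comp => //.
  exact: measurable_funD.
- exact: measurable_funM.
- by move=> x; apply: cvgM; [exact: cvg_cst|exact: is_derive_seq].
- by apply: intgZ; exact: intg_weight.
move=> n x; rewrite normrM -mulrA ler_pM//.
(* The mean value theorem evaluates [D] at a point within distance [1] of [x]; moving the weight
   back to [x] costs the factor [expR l]. *)
have key c : `|c - x| <= 1 -> `|D c| <= C * expR l * weight l x.
  move=> cx; apply: (le_trans (DC c)); rewrite -mulrA ler_wpM2l//.
  apply: (le_trans (weight_shift c x (ltW l0))); rewrite ler_wpM2r ?weight_ge0//.
  by rewrite ler_expR -[leRHS]mulr1 ler_wpM2l// ltW.
rewrite normrM normfV ler_pdivrMr ?normr_gt0//.
have [hp|hp] := leP 0 (h n).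
- have [|c /andP[c1 c2] ->] := @mean_value Psi D x (x + h n) _ dPsi.
    by rewrite lerDl.
  rewrite addrAC subrr add0r normrM ler_wpM2r// key// ler_norml.
  by have := hn1 n; rewrite (ger0_norm hp) => ?; apply/andP; split; lra.
- have [|c /andP[c1 c2] E] := @mean_value Psi D (x + h n) x _ dPsi.
    by rewrite gerDl ltW.
  rewrite distrC E normrM opprD addNKr normrN ler_wpM2r// key// ler_norml.
  by have := hn1 n; rewrite (ltr0_norm hp) => ?; apply/andP; split; lra.
Qed.

Definition density r := measurable_fun setT r /\ forall x, 0 <= r x <= 1.

Lemma density_norm r x : density r -> `|r x| <= 1.
Proof. by move=> [_ /(_ x)/andP[r0 r1]]; rewrite ger0_norm. Qed.

Lemma WepsK eps r x : 0 < eps -> density r ->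
  Weps eps r x = \int[leb R]_y (K eps (y - x) * r y).
Proof.
by move=> e0 dr; apply: (@WepsE _ _ _ _ 1) => //; [case: dr|move=> z; exact: density_norm].
Qed.

Lemma intg_Kdensity eps r x : 0 < eps -> density r ->
  intg (fun y => K eps (y - x) * r y).
Proof.
move=> e0 dr; apply: (@intg_le _ _ (fun y => K eps (y - x))).
- by apply: measurable_funM; [exact: measurable_Kl|case: dr].
- exact: intg_Kl.
- move=> y; rewrite normrM (ger0_norm (K_ge0 _ e0)).
  by rewrite -[leRHS]mulr1 ler_wpM2l ?K_ge0 ?density_norm.
Qed.

Lemma density_compl r : density r -> density (fun x => 1 - r x).
Proof.
move=> [mr r01]; split; first exact: measurable_funB.
by move=> x; have /andP[] := r01 x; move=> ? ?; apply/andP; split; lra.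
Qed.

(** The kernel has mass one. Through this symmetry the upper bound on [Weps] and the two-sided
    Lipschitz bound follow from one-sided statements. *)
Lemma Weps_compl eps r x : 0 < eps -> density r ->
  Weps eps (fun x => 1 - r x) x = 1 - Weps eps r x.
Proof.
move=> e0 dr; rewrite !WepsK//; last exact: density_compl.
rewrite -[in RHS](Rint_Kl x e0) -RintegralB//; last 2 first.
- exact: intg_Kl.
- exact: intg_Kdensity.
by apply: eq_Rintegral => y _; rewrite mulrBr mulr1.
Qed.

Lemma Weps_ge0 eps r x : 0 < eps -> density r -> 0 <= Weps eps r x.
Proof.
move=> e0 dr; rewrite WepsK//; apply: Rintegral_ge0 => y _.
by rewrite mulr_ge0 ?K_ge0//; case: dr => _ /(_ y)/andP[].
Qed.

Lemma Weps_le1 eps r x : 0 < eps -> density r -> Weps eps r x <= 1.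
Proof.
move=> e0 dr; rewrite -subr_ge0 -Weps_compl//.
by apply: Weps_ge0 => //; exact: density_compl.
Qed.

(** Translating the exponential kernel by [h] multiplies it by [expR (h / eps)] on its new support,
    whence [expR (- (h / eps)) * W (x + h) <= W x]; then [1 - expR (- k) <= k] and [W <= 1]
    conclude. *)
Lemma Weps_incr eps r x h : 0 < eps -> density r -> 0 <= h ->
  Weps eps r (x + h) - Weps eps r x <= h / eps.
Proof.
move=> e0 dr h0.
have le : expR (- (h / eps)) * Weps eps r (x + h) <= Weps eps r x.
  rewrite !WepsK// -RintegralZl ?intg_Kdensity//.
  apply: le_Rint; [by apply: intgZ; exact: intg_Kdensity|exact: intg_Kdensity|].
  move=> y; have [_ /(_ y)/andP[r0 _]] := dr.
  rewrite mulrA ler_wpM2r// opprD addrA; set z := y - x.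
  rewrite {1}/K; case: ifPn => zh; last by rewrite mulr0 K_ge0.
  have z0 : 0 <= z by lra.
  rewrite /K z0 mulrCA -expRD.
  rewrite (_ : - (h / eps) + - (z - h) / eps = - z / eps)//; last by ring.
have W1 := Weps_le1 (x + h) e0 dr; have W0 := Weps_ge0 (x + h) e0 dr.
have := @expR_ge1Dx R (- (h / eps)).
have : 0 <= h / eps by rewrite divr_ge0// ltW.
by move: le W1 W0; set W := Weps eps r (x + h); set E := expR _; set k := h / eps; nra.
Qed.

Lemma Weps_lip eps r x y : 0 < eps -> density r ->
  `|Weps eps r x - Weps eps r y| <= `|x - y| / eps.
Proof.
move=> e0 dr; wlog xy : x y / y <= x => [hwlog|].
  have [|/ltW] := leP y x; first exact: hwlog.
  by move/hwlog; rewrite distrC (distrC y).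
have xy0 : 0 <= x - y by rewrite subr_ge0.
have := Weps_incr y e0 dr xy0; have := Weps_incr y e0 (density_compl dr) xy0.
rewrite !Weps_compl// subrKC (ger0_norm xy0) => ? ?.
by rewrite ler_norml; apply/andP; split; lra.
Qed.

Lemma continuous_Weps eps r : 0 < eps -> density r -> continuous (Weps eps r).
Proof.
move=> e0 dr x; apply/cvgrPdist_le => e ep.
near=> y; apply: (le_trans (Weps_lip _ _ e0 dr)).
rewrite ler_pdivrMr//; near: y.
by apply: cvgr_dist_le; [exact: cvg_id|exact: mulr_gt0].
Unshelve. all: by end_near. Qed.

Lemma Weps_adjoint eps l r phi : 0 < eps -> 0 < l -> l * eps <= 2^-1 ->
  density r -> dom l phi ->
  \int[leb R]_x (Weps eps r x * phi x) = \int[leb R]_y (r y * Wadj eps phi y).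
Proof.
move=> e0 l0 le dr dphi; have [mphi [C phiC]] := dphi; have [mr r01] := dr.
have [B phiB] := dom_bounded (ltW l0) dphi.
pose F x y := K eps (y - x) * r y * phi x.
have [|||||_ _ _ E] := @Rint_fubini R F (fun x => C * weight l x).
- apply: measurable_funM; last first.
    by apply: (@measurableT_comp _ _ _ _ _ _ phi).
  apply: measurable_funM; last first.
    by apply: (@measurableT_comp _ _ _ _ _ _ r).
  apply: measurableT_comp; first exact: measurable_K.
  exact: measurable_funB.
- move=> x; have := intgZ (phi x) (intg_Kdensity x e0 dr).
  by apply: eq_intg => y; rewrite mulrC.
- move=> y; apply: (intgM (C := eps^-1) (dom_intg l0 dphi)).
    by apply: measurable_funM => //; exact: measurable_Kr.
  move=> x; rewrite normrM (ger0_norm (K_ge0 _ e0)) -[leRHS]mulr1.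
  by rewrite ler_pM ?K_ge0 ?K_le ?density_norm.
- by apply: intgZ; exact: intg_weight.
- move=> x; apply: (le_trans _ (phiC x)).
  rewrite -[leRHS]mulr1 -(Rint_Kl x e0) -RintegralZl ?intg_Kl//.
  apply: le_Rint.
  + apply: integrable_norm => //; have := intgZ (phi x) (intg_Kdensity x e0 dr).
    by apply: eq_intg => y; rewrite mulrC.
  + by apply: intgZ; exact: intg_Kl.
  move=> y; rewrite !normrM (ger0_norm (K_ge0 _ e0)) mulrC ler_wpM2l//.
  by rewrite -[leRHS]mulr1 ler_wpM2l ?K_ge0 ?density_norm.
transitivity (\int[leb R]_x \int[leb R]_y F x y).
  apply: eq_Rintegral => x _; rewrite WepsK// -RintegralZr//.
  exact: intg_Kdensity.
rewrite E; apply: eq_Rintegral => y _; rewrite /Wadj -RintegralZl//.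
  by apply: eq_Rintegral => x _; rewrite /F mulrAC mulrA (mulrC (r y)) mulrAC.
apply: (intgM (C := eps^-1) (dom_intg l0 dphi)); first exact: measurable_Kr.
by move=> x; rewrite ger0_norm ?K_ge0 ?K_le.
Qed.

End adjoint.

(** * Entropy dissipation *)

Section entropy.
Context {R : realFieldType}.
Implicit Types d u a b w : R.

Definition clamp d u : R := Num.max (- d) (Num.min d u).

Variant clamp_spec d u : R -> Prop :=
| ClampLow of u <= - d : clamp_spec d u (- d)
| ClampMid of - d <= u & u <= d : clamp_spec d u u
| ClampHigh of d <= u : clamp_spec d u d.

Lemma clampP d u : 0 <= d -> clamp_spec d u (clamp d u).
Proof.
move=> d0; rewrite /clamp; have [du|du] := leP d u.
  by rewrite max_r; [exact: ClampHigh|lra].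
have [ud|ud] := leP (- d) u; first exact: ClampMid (ltW du).
exact: ClampLow (ltW ud).
Qed.

Lemma clamp_norm_le d u : 0 <= d -> `|clamp d u| <= d.
Proof. by move=> d0; rewrite ler_norml; case: clampP => //= *; apply/andP; split; lra. Qed.

Lemma clamp_lip d a b : 0 <= d -> `|clamp d b - clamp d a| <= `|b - a|.
Proof.
move=> d0; have := ler_norm (b - a); have := ler_norm (- (b - a)).
rewrite normrN ler_norml => h1 h2.
by case: (clampP a d0) => *; case: (clampP b d0) => *; apply/andP; split; lra.
Qed.

(** The middle term is [d] times the Taylor remainder of [huber] defined below: its sign is
    convexity, its size comes from the slope of [clamp] being at most one. *)
Lemma clamp_mid d a b : 0 <= d ->
  0 <= (clamp d b - clamp d a) * (b - (clamp d a + clamp d b) / 2) <= (b - a) ^+ 2.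
Proof.
move=> d0; have := sqr_ge0 (b - a); rewrite expr2 => sq.
by case: (clampP a d0) => *; case: (clampP b d0) => *;
  apply/andP; split; nra.
Qed.

(** If [clamp] differs at [a] and [b], the segment between them meets [[- d, d]], so [b] is at
    distance at most [|b - a|] from it. *)
Lemma clamp_jump d a b : 0 <= d ->
  `|clamp d b - clamp d a| * `|b| <= `|clamp d b - clamp d a| * (d + `|b - a|).
Proof.
move=> d0; have [->|vab] := eqVneq (clamp d b - clamp d a) 0.
  by rewrite normr0 !mul0r.
rewrite ler_wpM2l// ler_norml; have := ler_norm (b - a).
have := ler_norm (- (b - a)); rewrite normrN => h1 h2.
by case: (clampP a d0) vab => [?|? ?|?]; case: (clampP b d0) => [?|? ?|?];
  rewrite ?subrr ?eqxx// => _; apply/andP; split; lra.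
Qed.

(* A convex C^1 approximation of the absolute value, with derivative [clamp d u / d]. *)
Definition huber d u : R := (clamp d u * u - clamp d u ^+ 2 / 2) / d.

Lemma huber_bounds d u : 0 < d -> `|u| - d <= huber d u <= `|u|.
Proof.
move=> d0; rewrite /huber ler_pdivrMr// ler_pdivlMr//.
have [u0|u0] := leP 0 u; rewrite ?(ger0_norm u0) ?(ltr0_norm u0);
  by case: (clampP u (ltW d0)) => *; apply/andP; split; nra.
Qed.

Lemma huber_ge0 d u : 0 < d -> 0 <= huber d u.
Proof.
move=> d0; rewrite /huber divr_ge0 ?(ltW d0)//.
by case: (clampP u (ltW d0)) => *; nra.
Qed.

Lemma huber_taylor d a b : 0 < d ->
  0 <= huber d b - huber d a - clamp d a / d * (b - a) <= (b - a) ^+ 2 / d.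
Proof.
move=> d0.
have -> : huber d b - huber d a - clamp d a / d * (b - a) =
   (clamp d b - clamp d a) * (b - (clamp d a + clamp d b) / 2) / d.
  by rewrite /huber; field; rewrite gt_eqF.
have /andP[h1 h2] := clamp_mid a b (ltW d0).
by rewrite divr_ge0 ?(ltW d0)//= ler_pM2r ?invr_gt0.
Qed.

(** The smoothed sign differs from the true one only where [|u| < d], and there both factors are at
    most [d]. *)
Lemma clamp_defect d u : 0 <= d -> `|u| * (d - `|clamp d u|) <= d ^+ 2.
Proof.
move=> d0; have [u0|u0] := leP 0 u; rewrite ?(ger0_norm u0) ?(ltr0_norm u0);
  case: (clampP u d0) => *; rewrite ?normrN ?(ger0_norm d0) ?(ger0_norm u0) ?(ltr0_norm u0);
  nra.
Qed.

Variables (V G : R -> R) (M L : R).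
Hypothesis V_bounded : forall w, `|V w| <= M.
Hypothesis V_lip : forall a b, `|V a - V b| <= L * `|a - b|.
Hypothesis V_decr : forall a b, a <= b -> V b <= V a.
(** The mean value form of [G' = V]: this section stays algebraic and speaks of increments only, as
    is needed for Lipschitz profiles. *)
Hypothesis G_mean : forall a b, a <= b ->
  exists2 c, a <= c <= b & G b - G a = V c * (b - a).

Let L_ge0 : 0 <= L.
Proof. by have := le_trans (normr_ge0 _) (V_lip 1 0); rewrite subr0 normr1 mulr1. Qed.

Let M_ge0 : 0 <= M. Proof. exact: le_trans (normr_ge0 _) (V_bounded 0). Qed.

Lemma G_mean2 a b : exists c, [/\ `|c - a| <= `|b - a|, `|c - b| <= `|b - a| &
  G b - G a = V c * (b - a)].
Proof.
have [ab|/ltW ab] := leP a b; have [c /andP[h1 h2] E] := G_mean ab; exists c.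
- by rewrite !ler_norml ger0_norm ?subr_ge0//; split => //; apply/andP; split; lra.
- rewrite !ler_norml ler0_norm ?subr_le0//; split; [apply/andP; split; lra..|].
  by rewrite -[LHS]opprB E; ring.
Qed.

Lemma G_taylor a b : `|G b - G a - V a * (b - a)| <= L * (b - a) ^+ 2.
Proof.
have [c [h1 h2 ->]] := G_mean2 a b.
rewrite -mulrBl normrM -[X in L * X]ger0_norm ?sqr_ge0// normrX expr2 mulrA.
rewrite ler_wpM2r//.
by apply: (le_trans (V_lip _ _)); rewrite ler_wpM2l.
Qed.

Lemma G_lip a b : `|G b - G a| <= M * `|b - a|.
Proof. by have [c [_ _ ->]] := G_mean2 a b; rewrite normrM ler_wpM2r. Qed.

(* If [G' = V] and [r = W - eps * W'], then [V W * r = hmean W + G W - eps * (G W)']. *)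
Definition hmean w := V w * w - G w.

(** Formally [hmean' w = V' w * w], but [V] is only Lipschitz. With [c] the mean value point, the
    increment is [(V b - V a) * a + (V b - V c) * (b - a)]: two nonpositive terms, each at least
    [- L * (b - a)] because [a] and [b - a] lie in [[0, 1]]. *)
Lemma hmean_mono a b : 0 <= a -> a <= b -> b <= 1 ->
  - (2 * L) * (b - a) <= hmean b - hmean a <= 0.
Proof.
move=> a0 ab b1; have [c /andP[ac cb] E] := G_mean ab.
have -> : hmean b - hmean a = (V b - V a) * a + (V b - V c) * (b - a).
  rewrite /hmean (_ : V b * b - G b - (V a * a - G a) = V b * b - V a * a - (G b - G a)).
    by rewrite E; ring.
  by ring.
have h1 := V_decr ab; have h2 := V_decr cb.
have := V_lip b a; have := V_lip b c.
rewrite !ler_norml (ger0_norm (_ : 0 <= b - a)) ?subr_ge0//.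
rewrite (ger0_norm (_ : 0 <= b - c)) ?subr_ge0// => /andP[h3 _] /andP[h4 _].
have L0 := L_ge0.
have h5 : - (L * (b - a)) <= V b - V c by apply: le_trans h3; rewrite lerN2 ler_wpM2l//; lra.
set x := V b - V a in h4 *; set y := V b - V c in h3 h5 *.
have x0 : x <= 0 by rewrite subr_le0.
have y0 : y <= 0 by rewrite subr_le0.
have p1 : - (L * (b - a)) <= x * a by nra.
have p2 : - (L * (b - a)) <= y * (b - a).
  have : 0 <= b - a <= 1 by apply/andP; split; lra.
  by move=> /andP[q1 q2]; nra.
by apply/andP; split; nra.
Qed.

Lemma hmean_sign d a b : 0 < d -> 0 <= a <= 1 -> 0 <= b <= 1 ->
  clamp d (b - a) / d * (hmean b - hmean a) =
  - (`|clamp d (b - a)| / d * `|hmean b - hmean a|) /\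
  `|hmean b - hmean a| <= 2 * L * `|b - a|.
Proof.
move=> d0 /andP[a0 a1] /andP[b0 b1].
have [ab|/ltW ab] := leP a b.
- have /andP[h1 h2] := hmean_mono a0 ab b1.
  rewrite (ler0_norm h2) (ger0_norm (_ : 0 <= b - a)) ?subr_ge0//; split; last by lra.
  rewrite ger0_norm; first by rewrite mulrN opprK.
  by case: (clampP (b - a) (ltW d0)) => *; lra.
- have /andP[h1 h2] := hmean_mono b0 ab a1.
  have h3 : 0 <= hmean b - hmean a by lra.
  rewrite (ger0_norm h3) (ler0_norm (_ : b - a <= 0)) ?subr_le0//; split; last by lra.
  rewrite ler0_norm; first by rewrite !mulNr opprK.
  by case: (clampP (b - a) (ltW d0)) => *; lra.
Qed.

(* The entropy flux of [huber d (w - w')], up to an error of order [d]. *)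
Definition flux d w w' := clamp d (w - w') / d * (G w - G w') -
  clamp d (w - w') ^+ 2 / (2 * d) * V w'.

Lemma flux_le d w w' : 0 < d -> `|flux d w w'| <= M * (huber d (w - w') + 2 * d).
Proof.
move=> d0; have d0' := ltW d0.
have c1 := clamp_norm_le (w - w') d0'.
have s1 : `|clamp d (w - w') / d| <= 1.
  by rewrite normrM normfV (ger0_norm d0') ler_pdivrMr// mul1r.
have /andP[h1 h2] := huber_bounds (w - w') d0.
apply: (le_trans (ler_normB _ _)).
apply: (@le_trans _ _ (M * `|w - w'| + d / 2 * M)); last first.
  by have := M_ge0; nra.
apply: lerD.
  by rewrite -[leRHS]mul1r normrM ler_pM// G_lip.
rewrite normrM; apply: ler_pM => //.
rewrite ger0_norm; last by rewrite divr_ge0 ?sqr_ge0// mulr_ge0.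
rewrite ler_pdivrMr ?mulr_gt0// (_ : d / 2 * (2 * d) = d ^+ 2); last by field.
by rewrite -[leLHS]ger0_norm ?sqr_ge0// normrX lerXn2r ?nnegrE.
Qed.

(* The chain rule [(flux w w')' = clamp d (w - w') / d * (V w * w_x - V w' * w'_x) + O(d)]
   for increments, as [Weps] is only Lipschitz in space; [k] bounds the increments. *)
Lemma flux_dissipation d k a a' b b' : 0 < d -> d <= 1 ->
  `|b - a| <= k -> `|b' - a'| <= k ->
  flux d b b' - flux d a a' - (5 * L * d * k + (40 * L + 4 * M) * (k ^+ 2 * (1 + k)) / d)
  <= clamp d (a - a') / d * (V a * (b - a) - V a' * (b' - a')).
Proof.
move=> d0 d1 bak bak'; have d0' := ltW d0.
have k0 : 0 <= k := le_trans (normr_ge0 _) bak.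
have L0 := L_ge0; have M0 := M_ge0.
pose ua := a - a'; pose ub := b - b'.
pose va := clamp d ua; pose vb := clamp d ub.
have uab : `|ub - ua| <= 2 * k.
  rewrite (_ : ub - ua = (b - a) - (b' - a')); last by rewrite /ua /ub; ring.
  by apply: (le_trans (ler_normB _ _)); lra.
have e1 := G_taylor a b; have e2 := G_taylor a' b'.
have [c [hc _ Ec]] := G_mean2 b' b.
rewrite -/ub in hc.
have ca : `|V c - V a'| <= L * (`|ub| + k).
  apply: (le_trans (V_lip _ _)); rewrite ler_wpM2l//.
  rewrite (_ : c - a' = (c - b') + (b' - a')); last by ring.
  by apply: (le_trans (ler_normD _ _)); exact: lerD.
pose E1 := G b - G a - V a * (b - a).
pose E2 := G b' - G a' - V a' * (b' - a').
(* A discrete chain rule. The jump [vb - va] meets [G b - G b' = V c * ub] and, from the quadratic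
   term of [flux], [- (va + vb) / 2 * V a']. These nearly cancel: what is left is the quantity of
   [clamp_mid] and a term in [V c - V a']. The other errors are the Taylor remainders of [G] and the
   variation of [V] in the quadratic term. *)
have -> : flux d b b' - flux d a a' =
  va / d * (V a * (b - a) - V a' * (b' - a')) +
  (va / d * (E1 - E2) + (vb - va) * (ub - (va + vb) / 2) / d * V a' +
   (vb - va) * ub / d * (V c - V a') - vb ^+ 2 / (2 * d) * (V b' - V a')).
  have EG : G b = G b' + V c * ub by rewrite /ub -Ec; ring.
  have Ea : G a = G b' + V c * ub - V a * (b - a) - E1 by rewrite /E1 EG; ring.
  rewrite /flux -/ua -/ub -/va -/vb EG Ea /E2; field.
  by rewrite gt_eqF.
set X := va / d * (_ - _).
suff : `|va / d * (E1 - E2) + (vb - va) * (ub - (va + vb) / 2) / d * V a' +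
   (vb - va) * ub / d * (V c - V a') - vb ^+ 2 / (2 * d) * (V b' - V a')| <=
   5 * L * d * k + (40 * L + 4 * M) * (k ^+ 2 * (1 + k)) / d.
  by rewrite ler_norml => /andP[_]; lra.
have sq x : `|x| <= k -> x ^+ 2 <= k ^+ 2.
  by move=> xk; rewrite -[leLHS]ger0_norm ?sqr_ge0// normrX lerXn2r ?nnegrE.
have d1' : 0 <= 1 - d by rewrite subr_ge0.
have T1 : `|va / d * (E1 - E2)| <= 2 * L * k ^+ 2.
  rewrite normrM -[leRHS]mul1r ler_pM//.
    by rewrite normrM normfV (ger0_norm d0') ler_pdivrMr// mul1r clamp_norm_le.
  apply: (le_trans (ler_normB _ _)).
  have : `|E1| <= L * k ^+ 2 by apply: (le_trans e1); rewrite ler_wpM2l// sq.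
  have : `|E2| <= L * k ^+ 2 by apply: (le_trans e2); rewrite ler_wpM2l// sq.
  by lra.
have uab2 : (ub - ua) ^+ 2 <= 4 * k ^+ 2.
  rewrite -[leLHS]ger0_norm ?sqr_ge0// normrX.
  by rewrite (_ : 4 * k ^+ 2 = (2 * k) ^+ 2) ?lerXn2r ?nnegrE ?mulr_ge0//; ring.
have T2 : `|(vb - va) * (ub - (va + vb) / 2) / d * V a'| <= 4 * k ^+ 2 * M / d.
  have /andP[h1 h2] := clamp_mid ua ub d0'.
  rewrite !normrM normfV (ger0_norm d0') mulrAC ler_pM2r ?invr_gt0//.
  by rewrite -normrM ler_pM// ger0_norm//; exact: le_trans uab2.
have vab : `|vb - va| <= 2 * k by apply: le_trans uab; exact: clamp_lip.
have jump := clamp_jump ua ub d0'; rewrite -/va -/vb in jump.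
(* A jump of [clamp] forces [|ub| <= d + 2 * k]. This is used for the factor [ub] and once more
   inside [V c - V a'], which makes the term [O(d * k)] up to terms of higher order in [k]. *)
have T3 : `|(vb - va) * ub / d * (V c - V a')| <= 2 * k * L * (d + 2 * k) * (d + 3 * k) / d.
  rewrite !normrM normfV (ger0_norm d0') mulrAC ler_pM2r ?invr_gt0//.
  apply: (@le_trans _ _ (`|vb - va| * `|ub| * (L * (`|ub| + k)))).
    by rewrite ler_wpM2l// mulr_ge0.
  have j2 : `|vb - va| * `|ub| <= `|vb - va| * (d + 2 * k).
    by apply: (le_trans jump); rewrite ler_wpM2l// lerD2l.
  have j3 : `|vb - va| * `|ub| * `|ub| <= `|vb - va| * (d + 2 * k) * (d + 2 * k).
    apply: (@le_trans _ _ (`|vb - va| * (d + 2 * k) * `|ub|)).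
      by rewrite ler_wpM2r.
    by rewrite mulrAC ler_wpM2r//; lra.
  apply: (@le_trans _ _ (L * (`|vb - va| * (d + 2 * k) * (d + 3 * k)))).
    rewrite mulrCA ler_wpM2l//.
    have := ler_wpM2r k0 j2; move: j3.
    rewrite !mulrDr => j3 j4; lra.
  rewrite (_ : 2 * k * L * _ * _ = L * (2 * k * (d + 2 * k) * (d + 3 * k))); last by ring.
  rewrite ler_wpM2l// ler_wpM2r ?ler_wpM2r//; lra.
have T4 : `|vb ^+ 2 / (2 * d) * (V b' - V a')| <= d / 2 * (L * k).
  rewrite normrM ler_pM//; last first.
    by apply: (le_trans (V_lip _ _)); rewrite ler_wpM2l.
  rewrite ger0_norm; last by rewrite divr_ge0 ?sqr_ge0// mulr_ge0.
  rewrite ler_pdivrMr ?mulr_gt0// (_ : d / 2 * (2 * d) = d ^+ 2); last by field.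
  rewrite -[leLHS]ger0_norm ?sqr_ge0// normrX lerXn2r ?nnegrE//.
  exact: clamp_norm_le.
apply: (@le_trans _ _ (2 * L * k ^+ 2 + 4 * k ^+ 2 * M / d +
  2 * k * L * (d + 2 * k) * (d + 3 * k) / d + d / 2 * (L * k))).
  apply: (le_trans (ler_normB _ _)); apply: lerD => //.
  apply: (le_trans (ler_normD _ _)); apply: lerD => //.
  by apply: (le_trans (ler_normD _ _)); apply: lerD.
(* The slack as a sum of nonnegative terms. Only the part linear in [k] survives the division by the
   step; the constants [40 * L] and [4 * M] multiply a vanishing error and are not sharp. *)
rewrite -subr_ge0 (_ : _ - _ = (5 / 2 * (L * k * d ^+ 2) +
  12 * (L * k ^+ 2 * (1 - d)) + 28 * (L * k ^+ 2) + 28 * (L * k ^+ 2 * k) +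
  4 * (M * k ^+ 2 * k)) / d); last by field; rewrite gt_eqF.
rewrite divr_ge0//.
have m1 : 0 <= L * k * d ^+ 2 by rewrite !mulr_ge0 ?exprn_ge0.
have m2 : 0 <= L * k ^+ 2 by rewrite mulr_ge0 ?exprn_ge0.
have m3 : 0 <= M * k ^+ 2 * k by rewrite !mulr_ge0 ?exprn_ge0.
have m4 : 0 <= L * k ^+ 2 * (1 - d) by rewrite mulr_ge0.
have m5 : 0 <= L * k ^+ 2 * k by rewrite mulr_ge0.
lra.
Qed.

(** Pointwise, [t] is the weight, [p] the adjoint average and [q] is [l * eps]. The [1] in
    [1 + 2 * q] is compensated by the dissipative term up to [clamp_defect]; only the excess [2 * q]
    is paid in terms of [|a - a'|]. *)
Lemma hmean_dissipation d q t p a a' : 0 < d -> 0 <= q -> 0 <= t ->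
  0 <= a <= 1 -> 0 <= a' <= 1 -> `|p| <= (1 + 2 * q) * t ->
  (clamp d (a - a') / d * t - p) * (hmean a - hmean a') <=
  (2 * L * d + 4 * L * q * (huber d (a - a') + d)) * t.
Proof.
move=> d0 q0 t0 ha ha' hp; have d0' := ltW d0; have L0 := L_ge0.
have [hs hl] := hmean_sign d0 ha' ha.
set u := a - a' in hs hl *; set H := hmean a - hmean a' in hs hl *.
have hs' : clamp d u / d * t * H = - (`|clamp d u| / d * `|H|) * t.
  by rewrite -hs; ring.
have hpH : - (p * H) <= (1 + 2 * q) * t * `|H|.
  by apply: (le_trans (ler_norm _)); rewrite normrN normrM ler_wpM2r.
have defect : (1 - `|clamp d u| / d) * `|H| <= 2 * L * d.
  have k0 : 0 <= 1 - `|clamp d u| / d.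
    by rewrite subr_ge0 ler_pdivrMr// mul1r clamp_norm_le.
  apply: (le_trans (ler_wpM2l k0 hl)).
  rewrite [leLHS](_ : _ = 2 * L * (`|u| * (d - `|clamp d u|) / d)); last first.
    by field; rewrite gt_eqF.
  by rewrite ler_wpM2l ?mulr_ge0// ler_pdivrMr// -expr2 clamp_defect.
have /andP[hu _] := huber_bounds u d0.
rewrite mulrBl hs'.
apply: (@le_trans _ _ (((1 - `|clamp d u| / d) * `|H| + 2 * q * `|H|) * t)).
  by move: hpH; lra.
rewrite ler_wpM2r// lerD//.
apply: (le_trans (ler_wpM2l (_ : 0 <= 2 * q) hl)); first by rewrite mulr_ge0.
rewrite [leLHS](_ : _ = 4 * L * q * `|u|); last by ring.
by rewrite ler_wpM2l ?mulr_ge0// -lerBlDr.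
Qed.

(** Quotients of step [h] tested against [phi - psi]: [flux_dissipation] with [k = h / eps] serves
    the first part, the Taylor bound on [G] the second. Of the error only [5 * L * d / eps] survives
    as [h] tends to [0]. *)
Lemma flux_quotient d h eps t p a a' b b' : 0 < d -> d <= 1 -> 0 < h -> 0 < eps ->
  0 <= t -> `|b - a| <= h / eps -> `|b' - a'| <= h / eps -> `|p| <= 2 * t ->
  h^-1 * (t * (flux d b b' - flux d a a')) -
  h^-1 * (p * (G b - G b' - (G a - G a'))) -
  (5 * L * d / eps + (40 * L + 4 * M) * (h / eps ^+ 2 * (1 + h / eps)) / d +
   4 * L * (h / eps ^+ 2)) * t <=
  (clamp d (a - a') / d * t - p) * (V a * ((b - a) / h) - V a' * ((b' - a') / h)).
Proof.
move=> d0 d1 h0 e0 t0 ba ba' pt; have L0 := L_ge0.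
have k0 : 0 <= h / eps by rewrite divr_ge0 ?ltW.
have fl := flux_dissipation d0 d1 ba ba'.
have ga := G_taylor a b; have ga' := G_taylor a' b'.
have sq x : `|x| <= h / eps -> x ^+ 2 <= (h / eps) ^+ 2.
  by move=> xk; rewrite -[leLHS]ger0_norm ?sqr_ge0// normrX lerXn2r ?nnegrE.
have {}ga := le_trans ga (ler_wpM2l L0 (sq _ ba)).
have {}ga' := le_trans ga' (ler_wpM2l L0 (sq _ ba')).
set X := V a * (b - a) - V a' * (b' - a') in fl.
have pG : - (p * (G b - G b' - (G a - G a') - X)) <= 2 * t * (2 * L * (h / eps) ^+ 2).
  apply: (le_trans (ler_norm _)); rewrite normrN normrM ler_pM//.
  rewrite (_ : _ - X = (G b - G a - V a * (b - a)) - (G b' - G a' - V a' * (b' - a'))); last first.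
    by rewrite /X; ring.
  by apply: (le_trans (ler_normB _ _)); lra.
have {}fl := ler_wpM2l t0 fl.
set c := 5 * L * d * (h / eps) + _ in fl.
set e := 2 * t * _ in pG.
rewrite [X in _ - X](_ : _ = h^-1 * (t * c + e)); last first.
  by rewrite /c /e; field; rewrite !gt_eqF.
rewrite [leRHS](_ : _ = h^-1 * ((clamp d (a - a') / d * t - p) * X)); last first.
  by rewrite /X; field; rewrite !gt_eqF.
rewrite -!mulrBr ler_wpM2l ?invr_ge0 ?(ltW h0)//.
clearbody X c e; lra.
Qed.

End entropy.

(** * The identity [r = W - eps * W'] in weak form *)

Section spatial.
Context {R : realType}.
Implicit Types (eps l x y z C d : R) (f g u phi r Psi Phi : R -> R).

Lemma lipschitz_continuous f C : (forall a b, `|f a - f b| <= C * `|a - b|) ->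
  continuous f.
Proof.
move=> fC x; have C0 : 0 <= C.
  by have := le_trans (normr_ge0 _) (fC 1 0); rewrite subr0 normr1 mulr1.
apply/cvgrPdist_le => e e0; near=> y; apply: (le_trans (fC x y)).
apply: (@le_trans _ _ (C * (e / (C + 1)))).
  rewrite ler_wpM2l//; near: y; apply: cvgr_dist_le; first exact: cvg_id.
  by rewrite divr_gt0// ltr_wpDl.
by rewrite mulrA ler_pdivrMr ?ltr_wpDl// mulrDr mulr1 mulrC lerDl ltW.
Unshelve. all: by end_near. Qed.

Lemma continuous_clamp d : 0 <= d -> continuous (clamp d).
Proof.
move=> d0; apply: (@lipschitz_continuous _ 1) => a b.
by rewrite mul1r; exact: clamp_lip.
Qed.

Lemma measurable_clamp d f : 0 <= d -> measurable_fun setT f ->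
  measurable_fun setT (fun x => clamp d (f x)).
Proof.
move=> d0 mf; apply: measurableT_comp => //.
by apply: continuous_measurable_fun; exact: continuous_clamp.
Qed.

Lemma measurable_huber d f : 0 <= d -> measurable_fun setT f ->
  measurable_fun setT (fun x => huber d (f x)).
Proof.
move=> d0 mf; have mc := measurable_clamp d0 mf.
apply: measurable_funM => //; apply: measurable_funB; first exact: measurable_funM.
by apply: measurable_funM => //; exact: measurable_funX.
Qed.

Lemma Rint_by_parts l f g B c : 0 < l -> dom l f -> measurable_fun setT g ->
  (forall x, `|g x| <= B) ->
  \int[leb R]_x (f x * (g (x + c) - g x)) =
  \int[leb R]_x (g x * (f (x - c) - f x)).
Proof.
move=> l0 df mg gB.
have dfg : dom l (fun x => f (x - c) * g x).
  by apply: (domMr (D := B)) => //; apply: dom_shift => //; exact: ltW.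
have dfg0 : dom l (fun x => f x * g x) by exact: (domMr (D := B)).
transitivity (\int[leb R]_x (f (x - c) * g x) - \int[leb R]_x (f x * g x)).
  rewrite -(Rint_shift c (dom_intg l0 dfg)) -RintegralB//.
  - by apply: eq_Rintegral => x _; rewrite addrK mulrBr.
  - exact: (intg_shift c (dom_intg l0 dfg)).
  - exact: dom_intg dfg0.
rewrite -RintegralB//; [|exact: dom_intg dfg|exact: dom_intg dfg0].
by apply: eq_Rintegral => x _; rewrite mulrBr mulrC [f x * _]mulrC.
Qed.

Lemma Wadj_shift eps l phi c y : 0 < eps -> 0 < l -> dom l phi ->
  Wadj eps (fun x => phi (x + c)) y = Wadj eps phi (y + c).
Proof.
move=> e0 l0 dphi; have [mphi _] := dphi; rewrite /Wadj.
rewrite -(@Rint_shift _ (fun x => K eps (y + c - x) * phi x) c).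
  by apply: eq_Rintegral => x _; rewrite opprD addrACA subrr addr0.
apply: (intgM (C := eps^-1) (dom_intg l0 dphi)); first exact: measurable_Kr.
by move=> x; rewrite ger0_norm ?K_ge0 ?K_le.
Qed.

(** [Weps eps r] need not be differentiable. The translation is moved onto [Phi], then through the
    adjoint onto the differentiable [Wadj eps Phi]; this reverses the step, hence [- harmonic n] in
    the proof. *)
Lemma Weps_quotient eps l r Phi : 0 < eps -> 0 < l -> l * eps <= 2^-1 ->
  density r -> continuous Phi -> dom l Phi ->
  \int[leb R]_x (Phi x * ((Weps eps r (x + harmonic n) - Weps eps r x) / harmonic n))
    @[n --> \oo] -->
  eps^-1 * (\int[leb R]_x (Phi x * Weps eps r x) - \int[leb R]_x (Phi x * r x)).
Proof.
move=> e0 l0 le dr cPhi dPhi; have [mr _] := dr.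
have mW : measurable_fun setT (Weps eps r).
  by apply: continuous_measurable_fun; exact: continuous_Weps.
have W1 x : `|Weps eps r x| <= 1 by rewrite ger0_norm ?Weps_ge0 ?Weps_le1.
have dK := dom_Wadj e0 l0 le cPhi dPhi.
have r1 x : `|r x| <= 1 by exact: density_norm.
have iPr : intg (fun x => r x * Phi x) by exact: (intgM (dom_intg l0 dPhi) mr r1).
have irK : intg (fun x => r x * Wadj eps Phi x) by exact: (intgM (dom_intg l0 dK) mr r1).
have -> : eps^-1 * (\int[leb R]_x (Phi x * Weps eps r x) - \int[leb R]_x (Phi x * r x)) =
    - \int[leb R]_x (r x * ((Phi x - Wadj eps Phi x) / eps)).
  under [X in X - _]eq_Rintegral do rewrite mulrC.
  rewrite (Weps_adjoint e0 l0 le dr dPhi).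
  under [X in _ - X]eq_Rintegral do rewrite mulrC.
  rewrite -opprB mulrN -RintegralB// -RintegralZl//; last exact: intgB.
  by congr (- _); apply: eq_Rintegral => x _; rewrite -mulrBr mulrC mulrA.
have -> : (fun n => \int[leb R]_x (Phi x *
      ((Weps eps r (x + harmonic n) - Weps eps r x) / harmonic n))) =
    (fun n => - \int[leb R]_x (r x *
      ((Wadj eps Phi (x + - harmonic n) - Wadj eps Phi x) / - harmonic n))).
  apply/funext => n; set h := harmonic n : R.
  have dPh : dom l (fun x => Phi (x - h)) by apply: dom_shift => //; exact: ltW.
  have dKh : dom l (fun x => Wadj eps Phi (x - h)) by apply: dom_shift => //; exact: ltW.
  transitivity (\int[leb R]_x (Phi x * (Weps eps r (x + h) - Weps eps r x)) * h^-1).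
    rewrite -RintegralZr//; first by apply: eq_Rintegral => x _; rewrite mulrA.
    apply: dom_intg l0 _; apply: (domMr (D := 1 + 1)) => //.
      apply: measurable_funB => //; apply: measurableT_comp => //.
      exact: measurable_funD.
    by move=> x; rewrite (le_trans (ler_normB _ _))// lerD.
  rewrite (Rint_by_parts h l0 dPhi mW W1).
  transitivity (- (\int[leb R]_x (r x * (Wadj eps Phi (x - h) - Wadj eps Phi x)) * - h^-1)).
    rewrite mulrN opprK; congr (_ * _).
    under eq_Rintegral do rewrite mulrBr.
    rewrite RintegralB//; last 2 first.
    - exact: (intgM (dom_intg l0 dPh) mW W1).
    - exact: (intgM (dom_intg l0 dPhi) mW W1).
    rewrite (Weps_adjoint e0 l0 le dr dPh) (Weps_adjoint e0 l0 le dr dPhi).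
    rewrite -RintegralB//; last first.
      apply: (eq_intg (f := fun x => r x * Wadj eps Phi (x - h))).
        by move=> x; rewrite -(Wadj_shift (- h) _ e0 l0 dPhi).
      exact: (intgM (dom_intg l0 dKh) mr r1).
    apply: eq_Rintegral => x _; rewrite mulrBr; congr (_ - _).
    by rewrite (Wadj_shift (- h) _ e0 l0 dPhi).
  congr (- _); rewrite -RintegralZr//.
    by apply: eq_Rintegral => x _; rewrite mulrA invrN.
  by apply: (intgM _ mr r1); apply: dom_intg l0 _; exact: domB.
apply: cvgN; apply: (@difference_quotient_integral _ l r 1 (Wadj eps Phi)
  (fun x => (Phi x - Wadj eps Phi x) / eps)) => //.
- by move=> x; exact: is_derive_Wadj l0 cPhi dPhi.
- apply: eq_dom (domZ eps^-1 (domB dPhi dK)) => x; exact: mulrC.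
- by rewrite -oppr0; apply: cvgN; exact: cvg_harmonic.
- by move=> n; rewrite oppr_eq0 /harmonic invr_eq0 pnatr_eq0.
- move=> n; rewrite normrN /harmonic ger0_norm ?invr_ge0// invf_le1 ?ltr0n//.
  by rewrite ler1n.
Qed.

End spatial.

(** * Entropy production at a fixed time *)

Section production.
Context {R : realType}.
Implicit Types (eps l x y z C d : R) (f g u phi r Psi Phi : R -> R).
Variables (V G : R -> R) (M L : R).
Hypothesis V_bounded : forall w, `|V w| <= M.
Hypothesis V_lip : forall a b, `|V a - V b| <= L * `|a - b|.
Hypothesis V_decr : forall a b, a <= b -> V b <= V a.
Hypothesis G_mean : forall a b, a <= b ->
  exists2 c, a <= c <= b & G b - G a = V c * (b - a).

Let L_ge0 : 0 <= L.
Proof. by have := le_trans (normr_ge0 _) (V_lip 1 0); rewrite subr0 normr1 mulr1. Qed.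

Let M_ge0 : 0 <= M. Proof. exact: le_trans (normr_ge0 _) (V_bounded 0). Qed.

Lemma harmonic_bounds n : 0 < harmonic n :> R /\ harmonic n <= 1 :> R.
Proof.
by rewrite /harmonic invr_gt0 ltr0n; split => //; rewrite invf_le1 ?ltr0n// ler1n.
Qed.

Lemma expR_le1Dx2 x : 0 <= x <= 2^-1 -> expR x <= 1 + 2 * x.
Proof.
move=> /andP[x0 x1]; have := expR_ge1Dx (- x); rewrite expRN => h.
have E0 := expR_gt0 x; have : (1 - x) * expR x <= 1.
  by rewrite -ler_pdivlMr// div1r.
by move: E0; set E := expR x => E0 hE; nra.
Qed.

Lemma weight_quotient l x h : 0 <= l -> l <= 2^-1 -> 0 < h -> h <= 1 ->
  `|weight l (x - h) - weight l x| <= 2 * l * h * weight l x.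
Proof.
move=> l0 l1 h0 h1.
have a1 : weight l (x - h) <= expR (l * h) * weight l x.
  by have := weight_shift (x - h) x l0; rewrite addrAC subrr add0r normrN gtr0_norm.
have a2 : weight l x <= expR (l * h) * weight l (x - h).
  by have := weight_shift x (x - h) l0; rewrite opprB addrCA subrr addr0 gtr0_norm.
have lh : 0 <= l * h <= 2^-1 by apply/andP; split; nra.
have e2 := expR_le1Dx2 lh.
have t0 := weight_gt0 l x; have e1 : 1 <= expR (l * h).
  by rewrite -expR0 ler_expR; case/andP: lh.
have s0 := weight_gt0 l (x - h).
move: a1 a2 e1 e2 t0 s0; set E := expR _; set t := weight l x; set s := weight l (x - h).
move=> a1 a2 e1 e2 t0 s0.
have b1 : E * t <= (1 + 2 * (l * h)) * t by rewrite ler_pM2r.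
rewrite ler_norml; apply/andP; split; last lra.
have : (1 - 2 * (l * h)) * t <= s.
  have [lh1 lh2] := andP lh.
  apply: (@le_trans _ _ ((1 - 2 * (l * h)) * (E * s))).
    by rewrite ler_wpM2l//; lra.
  by rewrite [_ * (E * s)]mulrA ler_piMl ?(ltW s0)//; nra.
by lra.
Qed.

(** Each [r] is replaced by [W - eps * W'] at the level of quotients. This splits the production
    into [X1 - X2], free of derivatives, and the limit of [- eps * An n]. Since
    [eps * psi' = phi - psi], the latter has a local part, handled by the flux, and a part in [psi],
    integrated by parts into [X3]. *)
Lemma entropy_production eps l d r1 r2 :
  0 < eps -> 0 < l -> l * eps <= 2^-1 -> l <= 2^-1 -> 0 < d -> d <= 1 ->
  density r1 -> density r2 ->
  let W1 := Weps eps r1 in let W2 := Weps eps r2 in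
  let phi x := clamp d (W1 x - W2 x) / d * weight l x in
  is_true (\int[leb R]_x ((V (W1 x) * r1 x - V (W2 x) * r2 x) *
                 ((phi x - Wadj eps phi x) / eps)) <=
  (2 * M + 4 * L) * l * \int[leb R]_x (huber d (W1 x - W2 x) * weight l x) +
  (4 * M + 4 * L + 7 * L / eps) * d * \int[leb R]_x weight l x).
Proof.
move=> e0 l0 le l1 d0 d1 dr1 dr2 W1 W2 phi.
have d0' := ltW d0; have l0' := ltW l0.
have [mr1 _] := dr1; have [mr2 _] := dr2.
have cW1 : continuous W1 by exact: continuous_Weps.
have cW2 : continuous W2 by exact: continuous_Weps.
have mW1 := continuous_measurable_fun cW1; have mW2 := continuous_measurable_fun cW2.
have W1b x : 0 <= W1 x <= 1 by rewrite Weps_ge0 ?Weps_le1.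
have W2b x : 0 <= W2 x <= 1 by rewrite Weps_ge0 ?Weps_le1.
pose u x := W1 x - W2 x.
have mu : measurable_fun setT u by exact: measurable_funB.
have u1 x : `|u x| <= 1.
  have /andP[? ?] := W1b x; have /andP[? ?] := W2b x.
  by rewrite ler_norml /u; apply/andP; split; lra.
have cV : continuous V by exact: lipschitz_continuous V_lip.
have cG : continuous G.
  by apply: (@lipschitz_continuous _ _ M) => a b; exact: (G_lip V_bounded G_mean).
pose s x := clamp d (u x) / d.
have s1 x : `|s x| <= 1.
  by rewrite normrM normfV (ger0_norm d0') ler_pdivrMr// mul1r clamp_norm_le.
have ms : measurable_fun setT s.
  by apply: measurable_funM => //; exact: measurable_clamp.
have cphi : continuous phi.
  move=> x; apply: cvgM; last exact: continuous_weight.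
  apply: cvgM; last exact: cvg_cst.
  apply: (@continuous_comp _ _ _ u (clamp d)); last exact: continuous_clamp.
  by apply: cvgB; [exact: cW1|exact: cW2].
have dphi : dom l phi by apply: (domM (D := 1)) => //; exact: dom_weight.
have phith x : `|phi x| <= 1 * weight l x.
  by rewrite normrM (ger0_norm (weight_ge0 _ _)) ler_wpM2r ?weight_ge0// s1.
pose psi := Wadj eps phi.
have psith x : `|psi x| <= (1 + 2 * (l * eps)) * weight l x.
  have [mphi _] := dphi.
  by have := Wadj_le x e0 l0 le mphi phith; rewrite mul1r.
have dpsi : dom l psi by exact: dom_Wadj.
pose psi' x := (phi x - psi x) / eps.
have cpsi : continuous psi.
  by apply: (@is_derive_continuous _ _ psi') => x; exact: is_derive_Wadj l0 cphi dphi.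
have cpsi' : continuous psi'.
  move=> x; apply: cvgM; last exact: cvg_cst.
  by apply: cvgB; [exact: cphi|exact: cpsi].
have dpsi' : dom l psi'.
  apply: eq_dom (domZ eps^-1 (domB dphi dpsi)) => x; exact: mulrC.
have mV f : measurable_fun setT f -> measurable_fun setT (fun x => V (f x)).
  by move=> mf; apply: measurableT_comp mf; exact: continuous_measurable_fun.
have mG f : measurable_fun setT f -> measurable_fun setT (fun x => G (f x)).
  by move=> mf; apply: measurableT_comp mf; exact: continuous_measurable_fun.
have mV1 := mV _ mW1; have mV2 := mV _ mW2.
have mG1 := mG _ mW1; have mG2 := mG _ mW2.
pose DG x := G (W1 x) - G (W2 x).
have mDG : measurable_fun setT DG by exact: measurable_funB.
have DGb x : `|DG x| <= M.
  apply: (le_trans (G_lip V_bounded G_mean _ _)).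
  by rewrite -[leRHS]mulr1 ler_wpM2l// u1.
pose F x := flux V G d (W1 x) (W2 x).
have mF : measurable_fun setT F.
  apply: measurable_funB.
    by apply: measurable_funM.
  apply: measurable_funM => //; apply: measurable_funM => //.
  by apply: measurable_funX; exact: measurable_clamp.
have mH : measurable_fun setT (fun x => huber d (u x)) by exact: measurable_huber.
have huber1 x : `|huber d (u x)| <= 1.
  have /andP[_ h] := huber_bounds (u x) d0.
  by rewrite ger0_norm ?huber_ge0//; exact: le_trans h (u1 x).
have Fb x : `|F x| <= M * (huber d (u x) + 2 * d).
  exact: (flux_le V_bounded G_mean).
have Fb3 x : `|F x| <= M * 3.
  apply: (le_trans (Fb x)); rewrite ler_wpM2l//.
  by have := le_trans (ler_norm _) (huber1 x); lra.
have mshift f c : measurable_fun setT f -> measurable_fun setT (fun x => f (x + c)).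
  by move=> mf; apply: measurableT_comp => //; exact: measurable_funD.
have dP1 : dom l (fun x => psi' x * V (W1 x)) by exact: (domMr (D := M)).
have dP2 : dom l (fun x => psi' x * V (W2 x)) by exact: (domMr (D := M)).
have cP1 : continuous (fun x => psi' x * V (W1 x)).
  by move=> x; apply: cvgM; [exact: cpsi'|apply: continuous_comp; [exact: cW1|exact: cV]].
have cP2 : continuous (fun x => psi' x * V (W2 x)).
  by move=> x; apply: cvgM; [exact: cpsi'|apply: continuous_comp; [exact: cW2|exact: cV]].
pose h n : R := harmonic n.
pose D1 n x := (W1 (x + h n) - W1 x) / h n.
pose D2 n x := (W2 (x + h n) - W2 x) / h n.
pose X1 := \int[leb R]_x (psi' x * V (W1 x) * W1 x).
pose X2 := \int[leb R]_x (psi' x * V (W2 x) * W2 x).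
pose P1 := \int[leb R]_x (psi' x * V (W1 x) * r1 x).
pose P2 := \int[leb R]_x (psi' x * V (W2 x) * r2 x).
have lim1 : \int[leb R]_x (psi' x * V (W1 x) * D1 n x) @[n --> \oo] -->
    eps^-1 * (X1 - P1) := Weps_quotient e0 l0 le dr1 cP1 dP1.
have lim2 : \int[leb R]_x (psi' x * V (W2 x) * D2 n x) @[n --> \oo] -->
    eps^-1 * (X2 - P2) := Weps_quotient e0 l0 le dr2 cP2 dP2.
have h_lim : h n @[n --> \oo] --> (0 : R) by exact: cvg_harmonic.
have h_pos n : 0 < h n by case: (harmonic_bounds n).
have h_le1 n : h n <= 1 by case: (harmonic_bounds n).
pose X3 := \int[leb R]_x (DG x * psi' x).
pose Bn n := \int[leb R]_x (DG x * ((psi (x + - h n) - psi x) / - h n)).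
have lim3 : Bn n @[n --> \oo] --> X3.
  apply: (@difference_quotient_integral _ l DG M psi psi' (fun n => - h n)) => //.
  - by move=> x; exact: is_derive_Wadj l0 cphi dphi.
  - by rewrite -oppr0; exact: cvgN.
  - by move=> n; rewrite oppr_eq0 gt_eqF.
  - by move=> n; rewrite normrN ger0_norm ?h_le1// ltW.
pose Th := \int[leb R]_x weight l x.
pose FT := \int[leb R]_x (`|F x| * weight l x).
pose err n := 5 * L * d / eps + (40 * L + 4 * M) * (h n / eps ^+ 2 * (1 + h n / eps)) / d
   + 4 * L * (h n / eps ^+ 2).
have lim_err : err n @[n --> \oo] --> 5 * L * d / eps +
   (40 * L + 4 * M) * (0 / eps ^+ 2 * (1 + 0 / eps)) / d + 4 * L * (0 / eps ^+ 2).
  apply: cvgD; last by apply: cvgM; [exact: cvg_cst|apply: cvgM => //; exact: cvg_cst].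
  apply: cvgD; first exact: cvg_cst.
  apply: cvgM; last exact: cvg_cst.
  apply: cvgM; first exact: cvg_cst.
  apply: cvgM; first by apply: cvgM => //; exact: cvg_cst.
  by apply: cvgD; [exact: cvg_cst|apply: cvgM => //; exact: cvg_cst].
rewrite !mul0r !mulr0 mul0r !addr0 in lim_err.
pose An n := \int[leb R]_x (psi' x * V (W1 x) * D1 n x) -
  \int[leb R]_x (psi' x * V (W2 x) * D2 n x).
have limR : eps * An n @[n --> \oo] --> eps * (eps^-1 * (X1 - P1) - eps^-1 * (X2 - P2)).
  by apply: cvgM; [exact: cvg_cst|exact: cvgB].
have limL : Bn n - 2 * l * FT - err n * Th @[n --> \oo] -->
    X3 - 2 * l * FT - 5 * L * d / eps * Th.
  apply: cvgB; last by apply: cvgM => //; exact: cvg_cst.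
  by apply: cvgB => //; exact: cvg_cst.
(* In the limit [key] yields [P1 - P2 <= X1 - X2 - X3 + 2 * l * FT + 5 * L * d / eps * Th], where
   [X1 - X2 - X3] is the integral of [psi' * H], to be bounded by [hmean_dissipation]. *)
suff key n : Bn n - 2 * l * FT - err n * Th <= eps * An n.
  have main : X3 - 2 * l * FT - 5 * L * d / eps * Th <=
      eps * (eps^-1 * (X1 - P1) - eps^-1 * (X2 - P2)).
    by apply: (ler_cvg_to limL limR); exact: nearW.
  rewrite mulrBr !mulVKf ?gt_eqF// in main.
  pose Hub := \int[leb R]_x (huber d (u x) * weight l x).
  have dHub : dom l (fun x => huber d (u x) * weight l x) by apply: (domM (D := 1)) => //; exact: dom_weight.
  have lin (a b : R) : \int[leb R]_x (a * (huber d (u x) * weight l x) + b * weight l x) =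
      a * Hub + b * Th.
    rewrite RintegralD//; last 2 first.
    - by apply: intgZ; exact: dom_intg dHub.
    - by apply: intgZ; exact: intg_weight.
    by rewrite !RintegralZl//; [exact: intg_weight|exact: dom_intg dHub].
  have ilin (a b : R) : intg (fun x => a * (huber d (u x) * weight l x) + b * weight l x).
    by apply: intgD; apply: intgZ; [exact: dom_intg dHub|exact: intg_weight].
  have FTle : FT <= M * Hub + 2 * M * d * Th.
    rewrite -lin; apply: le_Rint => //.
      apply: (dom_intg l0); apply: (domM (D := M * 3)) => //; first exact: dom_weight.
        exact: measurableT_comp.
      by move=> x; rewrite normr_id.
    move=> x; rewrite [leRHS](_ : _ = M * (huber d (u x) + 2 * d) * weight l x); last by ring.
    by rewrite ler_wpM2r ?weight_ge0.
  pose H x := hmean V G (W1 x) - hmean V G (W2 x).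
  have W1n x : `|W1 x| <= 1 by rewrite ger0_norm; case/andP: (W1b x).
  have W2n x : `|W2 x| <= 1 by rewrite ger0_norm; case/andP: (W2b x).
  have iX1 : intg (fun x => psi' x * V (W1 x) * W1 x).
    by apply: (dom_intg l0); exact: (domMr (D := 1)).
  have iX2 : intg (fun x => psi' x * V (W2 x) * W2 x).
    by apply: (dom_intg l0); exact: (domMr (D := 1)).
  have iX3 : intg (fun x => DG x * psi' x).
    by apply: (dom_intg l0); exact: (domM (D := M)).
  have XE : X1 - X2 - X3 = \int[leb R]_x (psi' x * H x).
    rewrite /X1 /X2 -RintegralB// /X3 -RintegralB//; last exact: intgB.
    by apply: eq_Rintegral => x _; rewrite /H /hmean /DG; ring.
  have Xle : X1 - X2 - X3 <= 4 * L * l * Hub + (2 * L * d / eps + 4 * L * l * d) * Th.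
    rewrite XE -lin; apply: le_Rint => //.
      apply: eq_intg (intgB (intgB iX1 iX2) iX3) => x.
      by rewrite /H /hmean /DG; ring.
    move=> x; have le0 : 0 <= l * eps by rewrite mulr_ge0// ltW.
    have := hmean_dissipation V_lip V_decr G_mean d0 le0 (weight_ge0 l x)
      (W1b x) (W2b x) (psith x).
    rewrite -/(u x) -/(H x) -/(s x) => hle.
    rewrite [leLHS](_ : _ = (s x * weight l x - psi x) * H x / eps); last first.
      by rewrite /psi' mulrAC.
    rewrite ler_pdivrMr//; apply: (le_trans hle).
    by rewrite le_eqVlt; apply/orP; left; apply/eqP; field; rewrite gt_eqF.
  have r1n x : `|r1 x| <= 1 by exact: density_norm.
  have r2n x : `|r2 x| <= 1 by exact: density_norm.
  have PE : \int[leb R]_x ((V (W1 x) * r1 x - V (W2 x) * r2 x) * ((phi x - psi x) / eps)) =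
      P1 - P2.
    rewrite /P1 /P2 -RintegralB//.
    - by apply: eq_Rintegral => x _; rewrite -/(psi' x); ring.
    - by apply: (dom_intg l0); exact: (domMr (D := 1)).
    - by apply: (dom_intg l0); exact: (domMr (D := 1)).
  rewrite PE -/Hub -/Th.
  have Th0 : 0 <= Th by apply: Rintegral_ge0 => x _; exact: weight_ge0.
  have b1 : 2 * l * FT <= 2 * l * (M * Hub + 2 * M * d * Th).
    by rewrite ler_wpM2l ?mulr_ge0.
  (* [FTle] and [Xle] produce [(4 * M + 4 * L) * l * d * Th], and [l <= 1] removes the factor [l].
     The constant [7] is [5] from the flux plus [2] from the defect of the smoothed sign. *)
  have b2 : 0 <= (1 - l) * (4 * M + 4 * L) * d * Th.
    have l2 : 0 <= 1 - l by lra.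
    have ML : 0 <= 4 * M + 4 * L by rewrite addr_ge0 ?mulr_ge0.
    by rewrite !mulr_ge0.
  lra.
have Wstep r x : density r -> `|Weps eps r (x + h n) - Weps eps r x| <= h n / eps.
  move=> dr; apply: (le_trans (Weps_lip _ _ e0 dr)).
  by rewrite addrAC subrr add0r gtr0_norm.
have mD1 : measurable_fun setT (D1 n).
  apply: measurable_funM; last exact: measurable_cst.
  by apply: measurable_funB; [exact: (mshift _ _ mW1)|exact: mW1].
have mD2 : measurable_fun setT (D2 n).
  apply: measurable_funM; last exact: measurable_cst.
  by apply: measurable_funB; [exact: (mshift _ _ mW2)|exact: mW2].
have D1b x : `|D1 n x| <= eps^-1.
  by rewrite normrM normfV (gtr0_norm (h_pos n)) ler_pdivrMr// mulrC; exact: Wstep.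
have D2b x : `|D2 n x| <= eps^-1.
  by rewrite normrM normfV (gtr0_norm (h_pos n)) ler_pdivrMr// mulrC; exact: Wstep.
have iA1 : intg (fun x => psi' x * V (W1 x) * D1 n x).
  by apply: (dom_intg l0); exact: domMr D1b.
have iA2 : intg (fun x => psi' x * V (W2 x) * D2 n x).
  by apply: (dom_intg l0); exact: domMr D2b.
have iF : intg (fun x => weight l x * (F (x + h n) - F x)).
  apply: (dom_intg l0); apply: (domMr (D := M * 3 + M * 3)); first exact: dom_weight.
    by apply: measurable_funB; [exact: (mshift _ _ mF)|exact: mF].
  by move=> x; rewrite (le_trans (ler_normB _ _))// lerD.
have iG : intg (fun x => psi x * (DG (x + h n) - DG x)).
  apply: (dom_intg l0); apply: (domMr (D := M + M)); first exact: dpsi.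
    by apply: measurable_funB; [exact: (mshift _ _ mDG)|exact: mDG].
  by move=> x; rewrite (le_trans (ler_normB _ _))// lerD.
have iTh := intg_weight l0.
pose q := (h n)^-1.
have q0 : 0 < q by rewrite invr_gt0.
(* By parts the difference falls on the weight, whose relative variation over a step [h n] is at
   most [2 * l * h n]: the flux costs a factor [l]. *)
have FTlow : - (2 * l * FT) <= q * \int[leb R]_x (weight l x * (F (x + h n) - F x)).
  rewrite (Rint_by_parts _ l0 (dom_weight l) mF Fb3) /q [leRHS]mulrC ler_pdivlMr//.
  rewrite mulNr lerNl; apply: (le_trans (ler_norm _)); rewrite normrN.
  have iFT : intg (fun x => `|F x| * weight l x).
    apply: (dom_intg l0); apply: (domM (D := M * 3)); first exact: dom_weight.
      exact: measurableT_comp.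
    by move=> x; rewrite normr_id.
  rewrite /FT mulrAC -RintegralZl//.
  apply: le_abs_Rint; [|exact: intgZ|].
    apply: measurable_funM; first exact: mF.
    by apply: measurable_funB; [exact: (mshift _ _ (measurable_weight l))|exact: measurable_weight].
  move=> x; rewrite normrM [leRHS]mulrCA ler_wpM2l//.
  exact: weight_quotient.
have BnE : Bn n = - (q * \int[leb R]_x (psi x * (DG (x + h n) - DG x))).
  rewrite (Rint_by_parts _ l0 dpsi mDG DGb) /Bn -mulNr -RintegralZl//.
    by apply: eq_Rintegral => x _; rewrite invrN mulrN mulNr mulrN; congr (- _);
      rewrite mulrCA mulrC -mulrA mulrCA.
  apply: (dom_intg l0); apply: (domM (D := M)); [|exact: mDG|exact: DGb].
  by apply: domB; [exact: (dom_shift (- h n) l0' dpsi)|exact: dpsi].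
have AnE : eps * An n = \int[leb R]_x (eps * (psi' x * V (W1 x) * D1 n x -
    psi' x * V (W2 x) * D2 n x)).
  by rewrite RintegralZl//; [rewrite RintegralB|exact: intgB].
apply: (@le_trans _ _ (q * \int[leb R]_x (weight l x * (F (x + h n) - F x)) -
  q * \int[leb R]_x (psi x * (DG (x + h n) - DG x)) - err n * Th)).
  by rewrite BnE; lra.
rewrite AnE -!RintegralZl// -!RintegralB//; try by repeat (apply: intgB || apply: intgZ).
apply: le_Rint; [by repeat (apply: intgB || apply: intgZ)..|].
move=> x; have psi2 : `|psi x| <= 2 * weight l x.
  by apply: (le_trans (psith x)); rewrite ler_wpM2r ?weight_ge0//; lra.
apply: (le_trans (flux_quotient V_bounded V_lip G_mean d0 d1 (h_pos n) e0
  (weight_ge0 l x) (Wstep r1 x dr1) (Wstep r2 x dr2) psi2)).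
rewrite le_eqVlt; apply/orP; left; apply/eqP.
rewrite -/W1 -/W2 -/(u x) -/(s x) -/(D1 n x) -/(D2 n x) /psi' -[s x * _]/(phi x).
by field; rewrite gt_eqF.
Qed.

End production.

(** * From the weak formulation to differentiability in time *)

Section time.
Context {R : realType}.
Implicit Types (x y z t T C : R) (f g m n : R -> R).

(** A C^1 function that vanishes exactly on a half-line, from which both the time profile and the
    spatial cutoff are built. *)
Definition pos_sq y : R := Num.max 0 y ^+ 2.

Lemma pos_sq_ge0 y : 0 <= pos_sq y. Proof. exact: sqr_ge0. Qed.

Lemma pos_sqE y : 0 <= y -> pos_sq y = y ^+ 2. Proof. by move=> y0; rewrite /pos_sq max_r. Qed.

Lemma pos_sq_le0 y : y <= 0 -> pos_sq y = 0. Proof. by move=> y0; rewrite /pos_sq max_l// expr0n. Qed.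

Lemma max0_lip x y : `|Num.max 0 x - Num.max 0 y| <= `|x - y|.
Proof.
have := ler_norm (x - y); have := ler_norm (- (x - y)); rewrite normrN ler_norml.
by have [x0|x0] := leP 0 x; have [y0|y0] := leP 0 y => h1 h2;
  apply/andP; split; lra.
Qed.

Lemma continuous_max0 : continuous (fun x : R => Num.max 0 x).
Proof. by apply: (@lipschitz_continuous _ _ 1) => a b; rewrite mul1r max0_lip. Qed.

Lemma is_derive_pos_sq y : is_derive y 1 pos_sq (2 * Num.max 0 y).
Proof.
have key h : `|pos_sq (h + y) - pos_sq y - h * (2 * Num.max 0 y)| <= h ^+ 2.
  have := sqr_ge0 h; rewrite /pos_sq !expr2 => hh.
  have [y0|y0] := leP 0 y; have [hy|hy] := leP 0 (h + y);
    rewrite ler_norml; apply/andP; split; nra.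
apply: (@is_derive_quadratic _ _ _ _ 1); near=> h; rewrite mul1r; exact: key.
Unshelve. all: by end_near. Qed.

Lemma continuous_pos_sq : continuous pos_sq.
Proof. exact: is_derive_continuous is_derive_pos_sq. Qed.

Definition primitive f T := \int[leb R]_(t in `[0, T]) f t.

Lemma continuous_itv_integrable f (a b : R) : continuous f ->
  (leb R).-integrable `[a, b] (EFin \o f).
Proof.
move=> cf; apply: continuous_compact_integrable; first exact: segment_compact.
exact: continuous_subspaceT.
Qed.

Lemma is_derive_primitive f T : continuous f -> 0 < T ->
  is_derive T 1 (primitive f) (f T).
Proof.
move=> cf T0; have T1 : T < T + 1 by rewrite ltrDl.
have := @continuous_FTC1_closed _ f 0 T (T + 1) T1.
move=> /(_ (continuous_itv_integrable _ _ cf) T0 (cf T)) [dF F'].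
by apply: DeriveDef; [exact: dF|rewrite -derive1E].
Qed.

Lemma is_derive_zero f T d : (forall t, 0 < t -> f t = 0) -> 0 < T ->
  is_derive T 1 f d -> d = 0.
Proof.
move=> f0 T0 fd.
have := is_derive_seq fd (@cvg_harmonic R) (fun k => lt0r_neq0 (proj1 (harmonic_bounds k))).
rewrite (_ : (fun k => _) = cst 0); last first.
  apply/funext => k; have [k0 _] := @harmonic_bounds R k.
  by rewrite !f0 ?subrr ?mul0r// addr_gt0.
by move=> h; rewrite -(cvg_lim (@Rhausdorff R) h) lim_cst.
Qed.

Lemma primitive_lin f g (a b : R) T : continuous f -> continuous g ->
  primitive (fun t => a * f t + b * g t) T = a * primitive f T + b * primitive g T.
Proof.
move=> cf cg; rewrite /primitive.
have cM (c : R) (k : R -> R) : continuous k -> continuous (fun t => c * k t).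
  by move=> ck t; apply: cvgM; [exact: cvg_cst|exact: ck].
rewrite RintegralD//; try by apply: continuous_itv_integrable; exact: cM.
by rewrite !RintegralZl//; exact: continuous_itv_integrable.
Qed.

(* Integrating twice in [T] turns the weak formulation against the time
   profile [pos_sq (T - t)] into an identity free of boundary layers. *)
Lemma weak_ode m n (m0 : R) : continuous m -> continuous n ->
  (forall T, 0 < T ->
     primitive (fun t => - 2 * (T - t) * m t + (T - t) ^+ 2 * n t) T + T ^+ 2 * m0 = 0) ->
  forall T, 0 < T -> m T = m0 + primitive n T.
Proof.
move=> cm cn h.
have cid (k : R -> R) : continuous k -> continuous (fun t => t * k t).
  by move=> ck t; apply: cvgM; [exact: cvg_id|exact: ck].
pose A1 := primitive m; pose A2 := primitive (fun t => t * m t).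
pose N0 := primitive n; pose N1 := primitive (fun t => t * n t).
pose N2 := primitive (fun t => t * (t * n t)).
have E1 T : 0 < T -> (- 2 * T) * A1 T + 2 * A2 T + T ^+ 2 * N0 T - 2 * T * N1 T +
    N2 T + T ^+ 2 * m0 = 0.
  move=> T0; rewrite -(h T T0); congr (_ + _).
  have cmm := cid _ cm; have cnn := cid _ cn; have cnnn := cid _ cnn.
  have cL (a b : R) (k k' : R -> R) : continuous k -> continuous k' ->
      continuous (fun t => a * k t + b * k' t).
    by move=> ck ck' t; apply: cvgD; apply: cvgM; by [exact: cvg_cst|exact: ck|exact: ck'].
  have -> : primitive (fun t => - 2 * (T - t) * m t + (T - t) ^+ 2 * n t) T =
      primitive (fun t => 1 * (- 2 * T * m t + 2 * (t * m t)) +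
        1 * (1 * (T ^+ 2 * n t + (- 2 * T) * (t * n t)) + 1 * (t * (t * n t)))) T.
    by congr primitive; apply/funext => t; ring.
  have c1 := cL (-2 * T) 2 _ _ cm cmm.
  have c2 := cL (T ^+ 2) (- 2 * T) _ _ cn cnn.
  have c3 := cL 1 1 _ _ c2 cnnn.
  by rewrite (primitive_lin _ _ _ c1 c3) (primitive_lin _ _ _ c2 cnnn)
    (primitive_lin _ _ _ cm cmm) (primitive_lin _ _ _ cn cnn) /A1 /A2 /N0 /N1 /N2; ring.
(* Expanding [(T - t) ^+ 2] in [E1] has freed the integrands from [T], so [E1] can be
   differentiated, and [E2] once more below; the terms in [n T] cancel both times. *)
have E2 T : 0 < T -> - 2 * A1 T + 2 * T * N0 T - 2 * N1 T + 2 * T * m0 = 0.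
  move=> T0.
  have d1 : is_derive T 1 A1 (m T) by exact: is_derive_primitive.
  have d2 : is_derive T 1 A2 (T * m T) by exact: is_derive_primitive (cid _ cm) T0.
  have d3 : is_derive T 1 N0 (n T) by exact: is_derive_primitive.
  have d4 : is_derive T 1 N1 (T * n T) by exact: is_derive_primitive (cid _ cn) T0.
  have d5 : is_derive T 1 N2 (T * (T * n T)).
    exact: is_derive_primitive (cid _ (cid _ cn)) T0.
  have d0 := is_derive_id T (1 : R).
  have dP := is_deriveD (is_deriveD (is_deriveB (is_deriveD (is_deriveD
    (is_deriveZ (- 2) (is_deriveM d0 d1)) (is_deriveZ 2 d2))
    (is_deriveM (is_deriveM d0 d0) d3)) (is_deriveZ 2 (is_deriveM d0 d4))) d5)
    (is_deriveZ m0 (is_deriveM d0 d0)).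
  rewrite -(is_derive_zero _ T0 dP); first by rewrite !fctE /GRing.scale/=; ring.
  move=> t t0; rewrite -[RHS](E1 t t0).
  change (- 2 * (t * A1 t) + 2 * A2 t + t * t * N0 t - 2 * (t * N1 t) + N2 t +
    m0 * (t * t) = - 2 * t * A1 t + 2 * A2 t + t ^+ 2 * N0 t - 2 * t * N1 t + N2 t +
    t ^+ 2 * m0).
  by ring.
move=> T T0.
have d1 : is_derive T 1 A1 (m T) by exact: is_derive_primitive.
have d3 : is_derive T 1 N0 (n T) by exact: is_derive_primitive.
have d4 : is_derive T 1 N1 (T * n T) by exact: is_derive_primitive (cid _ cn) T0.
have d0 := is_derive_id T (1 : R).
have dP := is_deriveD (is_deriveB (is_deriveD (is_deriveZ (- 2) d1)
  (is_deriveZ 2 (is_deriveM d0 d3))) (is_deriveZ 2 d4)) (is_deriveZ (2 * m0) d0).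
suff : 2 * (m0 + N0 T - m T) = 0 by rewrite /N0; lra.
rewrite -(is_derive_zero _ T0 dP); first by rewrite ?fctE /GRing.scale/=; ring.
move=> t t0; rewrite -[RHS](E2 t t0).
change (- 2 * A1 t + 2 * (t * N0 t) - 2 * N1 t + 2 * m0 * t =
  - 2 * A1 t + 2 * t * N0 t - 2 * N1 t + 2 * t * m0).
by ring.
Qed.

End time.

(** * Compactly supported time profiles *)

Section profile.
Context {R : realType}.
Implicit Types (t T x N : R) (psi : R -> R).

Lemma is_derive_pos_sq_comp (g : R -> R) t d : is_derive t 1 g d ->
  is_derive t 1 (fun s => pos_sq (g s)) (2 * Num.max 0 (g t) * d).
Proof. move=> gd; exact: (@is_derive1_comp _ pos_sq g t _ _ (is_derive_pos_sq (g t)) gd). Qed.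

(* A [C^1] profile with compact support, equal to [pos_sq (T - t)] for [0 <= t]. *)
Definition profile T t := pos_sq (T - t) * pos_sq (1 - pos_sq (- t)).

Definition profile' T t := pos_sq (T - t) * (2 * Num.max 0 (1 - pos_sq (- t)) * (2 * Num.max 0 (- t))) -
  pos_sq (1 - pos_sq (- t)) * (2 * Num.max 0 (T - t)).

Lemma is_derive_profile T t : is_derive t 1 (profile T) (profile' T t).
Proof.
have d0 := is_derive_id t (1 : R).
have d1 : is_derive t 1 (fun s => T - s) (- 1).
  by have := is_deriveB (is_derive_cst T t (1 : R)) d0; rewrite sub0r.
have d2 := is_derive_pos_sq_comp d1.
have d3 := is_derive_pos_sq_comp (is_deriveN d0).
have d4 := is_derive_pos_sq_comp (is_deriveB (is_derive_cst (1 : R) t (1 : R)) d3).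
apply: (is_derive_eq (is_deriveM d2 d4)).
by rewrite /profile' !fctE /GRing.scale/=; ring.
Qed.

Lemma profileE T t : 0 <= t <= T -> profile T t = (T - t) ^+ 2.
Proof.
move=> /andP[t0 tT]; have e : pos_sq (- t) = 0 by rewrite pos_sq_le0 ?oppr_le0.
by rewrite /profile e subr0 !pos_sqE ?subr_ge0// expr1n mulr1.
Qed.

Lemma profile'E T t : 0 <= t <= T -> profile' T t = - 2 * (T - t).
Proof.
move=> /andP[t0 tT]; have e : pos_sq (- t) = 0 by rewrite pos_sq_le0 ?oppr_le0.
rewrite /profile' e subr0 (pos_sqE ler01) expr1n mul1r.
rewrite (max_l (_ : - t <= 0)) ?oppr_le0// !mulr0 sub0r.
by rewrite max_r ?subr_ge0// mulNr.
Qed.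

Lemma profile_out T t : ~ (-1 <= t <= T) -> profile T t = 0.
Proof.
move=> /negP; rewrite negb_and -!ltNge => /orP[t1|tT]; rewrite /profile; last first.
  by rewrite pos_sq_le0 ?mul0r// subr_le0 ltW.
rewrite [X in _ * X]pos_sq_le0 ?mulr0// pos_sqE; last by lra.
by rewrite expr2; nra.
Qed.

Lemma profile'_out T t : T < t -> 0 <= T -> profile' T t = 0.
Proof.
move=> tT T0; rewrite /profile' pos_sq_le0; last by rewrite subr_le0 ltW.
by rewrite mul0r [Num.max 0 (T - t)]max_l ?mulr0 ?subr0// subr_le0 ltW.
Qed.

Lemma continuous_profile' T : continuous (profile' T).
Proof.
have cN : continuous (fun s : R => - s) by exact: opp_continuous.
have cB (c : R) (f : R -> R) : continuous f -> continuous (fun s => c - f s).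
  by move=> cf s; apply: cvgB; [exact: cvg_cst|exact: cf].
have cM (f g : R -> R) : continuous f -> continuous g -> continuous (fun s => f s * g s).
  by move=> cf cg s; apply: cvgM; [exact: cf|exact: cg].
have cpp (f : R -> R) : continuous f -> continuous (fun s => pos_sq (f s)).
  move=> cf s; apply: (@continuous_comp _ _ _ f pos_sq); [exact: cf|exact: continuous_pos_sq].
have cm (f : R -> R) : continuous f -> continuous (fun s => Num.max 0 (f s)).
  move=> cf s; apply: (@continuous_comp _ _ _ f (Num.max 0)); [exact: cf|exact: continuous_max0].
have cid : continuous (fun s : R => s) by move=> s; exact: cvg_id.
have cc (c : R) : continuous (fun _ : R => c) by move=> s; exact: cvg_cst.
have cT := cB T _ cid.
have c1 := cB 1 _ (cpp _ cN).
have c2 := cM _ _ (cpp _ cT) (cM _ _ (cM _ _ (cc 2) (cm _ c1)) (cM _ _ (cc 2) (cm _ cN))).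
have c3 := cM _ _ (cpp _ c1) (cM _ _ (cc 2) (cm _ cT)).
by move=> t; apply: cvgB; [exact: c2|exact: c3].
Qed.

Lemma continuous_fst_comp (f : R -> R) : continuous f ->
  continuous (fun p : R * R => f p.1).
Proof.
by move=> cf p; apply: (@continuous_comp _ _ _ fst f); [exact: cvg_fst|exact: cf].
Qed.

Lemma continuous_snd_comp (f : R -> R) : continuous f ->
  continuous (fun p : R * R => f p.2).
Proof.
by move=> cf p; apply: (@continuous_comp _ _ _ snd f); [exact: cvg_snd|exact: cf].
Qed.

Lemma dt_profile T psi t x :
  dt (fun t x => profile T t * psi x) t x = profile' T t * psi x.
Proof.
rewrite /dt derive1E; apply: derive_val; apply: (is_derive_eq
  (is_deriveM (is_derive_profile T t) (is_derive_cst (psi x) t (1 : R)))).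
by rewrite scaler0 add0r mulrC.
Qed.

Lemma dx_profile T psi (d : R) t x : is_derive x 1 psi d ->
  dx (fun t x => profile T t * psi x) t x = profile T t * d.
Proof.
move=> psid; rewrite /dx derive1E; apply: derive_val; exact: is_deriveZ (profile T t) psid.
Qed.

Lemma C1c2_profile T N psi psi' : (forall x, is_derive x 1 psi (psi' x)) ->
  continuous psi' -> (forall x, N < `|x| -> psi x = 0) ->
  C1c2 (fun t x => profile T t * psi x).
Proof.
move=> dpsi cpsi' psi0; split.
- move=> t x; split.
    by have [h _] := is_deriveM (is_derive_profile T t) (is_derive_cst (psi x) t (1 : R)).
  by have [h _] := is_deriveZ (profile T t) (dpsi x).
- rewrite (_ : (fun p => _) = (fun p : R * R => profile' T p.1 * psi p.2)); last first.
    by apply/funext => p; exact: dt_profile.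
  move=> p; apply: cvgM; first exact: (continuous_fst_comp (@continuous_profile' T)).
  exact: (continuous_snd_comp (is_derive_continuous dpsi)).
- rewrite (_ : (fun p => _) = (fun p : R * R => profile T p.1 * psi' p.2)); last first.
    by apply/funext => p; exact: dx_profile (dpsi _).
  move=> p; apply: cvgM; last exact: (continuous_snd_comp cpsi').
  exact: (continuous_fst_comp (is_derive_continuous (is_derive_profile T))).
- apply: (@subclosed_compact _ _ (`[-1, T]%classic `*` `[-N, N]%classic)).
  + exact: closed_closure.
  + by apply: compact_setX; exact: segment_compact.
  have cl : closed (`[-1, T]%classic `*` `[-N, N]%classic : set (R * R)).
    by apply: compact_closed; [exact: norm_hausdorff|apply: compact_setX; exact: segment_compact].
  rewrite [X in _ `<=` X](closure_id _).1//; apply: closure_subset => p /= pn0.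
  split; rewrite /= in_itv/=.
    apply: contrapT => h; move: pn0; rewrite profile_out ?mul0r ?eqxx//.
  rewrite -ler_norml leNgt; apply/negP => h; move: pn0; rewrite psi0// mulr0 eqxx//.
Qed.

End profile.

(* A [weak_solution] modified on null sets, and extended to [t < 0], so that its
   measurability, range and continuity hold everywhere. *)
Record regular_solution (R : realType) (V : R -> R) (eps : R) (r0 : R -> R)
    (r : R -> R -> R) : Prop := RegularSolution {
  rs_measurable : measurable_fun setT (fun p : R * R => r p.1 p.2) ;
  rs_density : forall t, density (r t) ;
  rs_density0 : density r0 ;
  rs_continuous : forall psi, intg psi ->
    continuous (fun t => \int[leb R]_x (r t x * psi x)) ;
  rs_weak : forall phi : R -> R -> R, C1c2 phi ->
    measurable_fun setT (fun p : R * R => dt phi p.1 p.2) ->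
    measurable_fun setT (fun p : R * R => dx phi p.1 p.2) ->
    \int[(leb R \x leb R)%E]_(p in [set p : R * R | 0 <= p.1])
       (r p.1 p.2 * dt phi p.1 p.2 +
        V (Weps eps (r p.1) p.2) * r p.1 p.2 * dx phi p.1 p.2) +
    \int[leb R]_x (r0 x * phi 0 x) = 0
}.

Lemma measurable_Weps2 (R : realType) (eps : R) (r : R -> R -> R) : 0 < eps ->
  measurable_fun setT (fun p : R * R => r p.1 p.2) -> (forall t, density (r t)) ->
  measurable_fun setT (fun p : R * R => Weps eps (r p.1) p.2).
Proof.
move=> eps0 mr dr.
pose f (q : (R * R) * R) := (K eps (q.2 - q.1.2) * r q.1.1 q.2)%:E.
have mf : measurable_fun setT f.
  apply/measurable_EFinP; apply: measurable_funM.
    apply: measurableT_comp; first exact: measurable_K.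
    apply: measurable_funB; first exact: measurable_snd.
    by apply: measurableT_comp; [exact: measurable_snd|exact: measurable_fst].
  apply: (@measurableT_comp _ _ _ _ _ _ (fun p : R * R => r p.1 p.2) _
    (fun q : (R * R) * R => (q.1.1, q.2))) => //.
  apply: measurable_fun_pair; last exact: measurable_snd.
  by apply: measurableT_comp; [exact: measurable_fst|exact: measurable_fst].
have f0 q : (0 <= f q)%E.
  by rewrite lee_fin mulr_ge0 ?K_ge0//; have [_ /(_ q.2)/andP[]] := dr q.1.1.
have := @measurable_fun_fubini_tonelli_F _ _ _ _ _ (leb R) f mf f0.
set g := fubini_F _ _ => mg.
apply/measurable_EFinP; rewrite (_ : EFin \o _ = g)//; apply/funext => p /=.
rewrite WepsK// fineK//; apply: integrable_fin_num => //.
exact: (intg_Kdensity p.2 eps0 (dr p.1)).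
Qed.

Lemma measurable_tensor (R : realType) (f g : R -> R) :
  measurable_fun setT f -> measurable_fun setT g ->
  measurable_fun setT (fun p : R * R => f p.1 * g p.2).
Proof.
move=> mf mg; apply: measurable_funM.
  by apply: measurableT_comp => //; exact: measurable_fst.
by apply: measurableT_comp => //; exact: measurable_snd.
Qed.

(** * Moments of a solution against compactly supported functions *)

Section evolution.
Context {R : realType}.
Implicit Types (t T x N : R) (psi g : R -> R).
Variables (V : R -> R) (M L eps : R) (r : R -> R -> R) (r0 : R -> R).
Hypothesis eps0 : 0 < eps.
Hypothesis V_bounded : forall w, `|V w| <= M.
Hypothesis V_lip : forall a b, `|V a - V b| <= L * `|a - b|.
Hypothesis sol : regular_solution V eps r0 r.

Let mr := rs_measurable sol.
Let dr := rs_density sol.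
Let dr0 := rs_density0 sol.
Let cr := rs_continuous sol.
Let weak := rs_weak sol.

Let W t x := Weps eps (r t) x.

Let M_ge0 : 0 <= M. Proof. exact: le_trans (normr_ge0 _) (V_bounded 0). Qed.

Let L_ge0 : 0 <= L.
Proof. by have := le_trans (normr_ge0 _) (V_lip 1 0); rewrite subr0 normr1 mulr1. Qed.

Let cV : continuous V. Proof. exact: lipschitz_continuous V_lip. Qed.

Let cW t : continuous (W t). Proof. exact: continuous_Weps. Qed.

Let rn t x : `|r t x| <= 1. Proof. exact: density_norm. Qed.

(** The kernel is itself an integrable test function, so weak-* continuity of the solution becomes
    pointwise continuity of its average. This is what lets the nonlinearity pass to the limit. *)
Lemma continuous_Weps_time x : continuous (fun t => W t x).
Proof.
rewrite (_ : (fun t => _) = (fun t => \int[leb R]_y (r t y * K eps (y - x)))).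
  by apply: cr; exact: intg_Kl.
by apply/funext => t; rewrite /W WepsK//; apply: eq_Rintegral => y _; rewrite mulrC.
Qed.

Let mVW t : measurable_fun setT (fun x => V (W t x)).
Proof.
by apply: measurableT_comp; apply: continuous_measurable_fun; [exact: cV|exact: cW].
Qed.

Let mrt t : measurable_fun setT (r t). Proof. by case: (dr t). Qed.

(** A weak limit times a strong one: with [V (W t x)] frozen inside the test function, weak-*
    continuity applies to [r], and the difference of the velocities tends to [0] by dominated
    convergence. *)
Lemma continuous_momentum g : intg g ->
  continuous (fun t => \int[leb R]_x (V (W t x) * r t x * g x)).
Proof.
move=> ig t; apply/(@cvg_nbhsP _ R^o) => s st.
have mg := intg_measurable ig.
have iVg : intg (fun x => V (W t x) * g x) by exact: intgM (mVW t) (fun x => V_bounded _).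
have c1 := @cr _ iVg t.
have c2 : \int[leb R]_x (r (s n) x * (V (W t x) * g x)) @[n --> \oo] -->
    \int[leb R]_x (r t x * (V (W t x) * g x)).
  exact: (cvg_comp _ _ st c1).
have c3 : \int[leb R]_x (`|V (W (s n) x) - V (W t x)| * `|g x|) @[n --> \oo] --> (0 : R).
  have -> : (0 : R) = \int[leb R]_x (cst 0 x : R).
    by rewrite Rintegral_cst// mul0r.
  apply: (@Rint_dct _ _ _ (fun x => (M + M) * `|g x|)).
  - move=> n; apply: measurable_funM; last exact: measurableT_comp.
    by apply: measurableT_comp => //; exact: measurable_funB.
  - exact: measurable_cst.
  - move=> x; rewrite -(mul0r `|g x|); apply: cvgM; last exact: cvg_cst.
    rewrite -(@normr0 _ R); apply: cvg_norm.
    rewrite -(subrr (V (W t x))); apply: cvgB; last exact: cvg_cst.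
    have c4 := cvg_comp _ _ st (@continuous_Weps_time x t).
    exact: (cvg_comp _ _ c4 (@cV (W t x))).
  - by apply: intgZ; exact: integrable_norm.
  - move=> n x; rewrite normrM !normr_id ler_wpM2r//.
    by rewrite (le_trans (ler_normB _ _))// lerD.
apply/cvgrPdist_le => e e0; near=> n.
have i1 : intg (fun x => V (W (s n) x) * r (s n) x * g x).
  apply: (intgM (C := M * 1) ig); first exact: measurable_funM.
  by move=> x; rewrite normrM ler_pM.
have i2 : intg (fun x => r (s n) x * (V (W t x) * g x)) by exact: intgM iVg (mrt _) (rn _).
have i3 : intg (fun x => `|V (W (s n) x) - V (W t x)| * `|g x|).
  apply: (intgM (C := M + M) (integrable_norm ig)).
    by apply: measurableT_comp => //; exact: measurable_funB.
  by move=> x; rewrite normr_id (le_trans (ler_normB _ _))// lerD.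
have b1 : `|\int[leb R]_x (r t x * (V (W t x) * g x)) -
    \int[leb R]_x (r (s n) x * (V (W t x) * g x))| <= e / 2.
  by near: n; move/cvgrPdist_le : c2; apply; rewrite divr_gt0.
have b2 : `|0 - \int[leb R]_x (`|V (W (s n) x) - V (W t x)| * `|g x|)| <= e / 2.
  by near: n; move/cvgrPdist_le : c3; apply; rewrite divr_gt0.
have b3 : `|\int[leb R]_x (r (s n) x * (V (W t x) * g x)) -
    \int[leb R]_x (V (W (s n) x) * r (s n) x * g x)| <=
    \int[leb R]_x (`|V (W (s n) x) - V (W t x)| * `|g x|).
  rewrite -RintegralB//; apply: le_abs_Rint => //.
    by apply: intg_measurable; exact: intgB.
  move=> x; rewrite (_ : _ - _ = - (r (s n) x * ((V (W (s n) x) - V (W t x)) * g x))); last by ring.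
  by rewrite normrN 2!normrM ler_piMl ?mulr_ge0.
have b4 := ler_norm (\int[leb R]_x (`|V (W (s n) x) - V (W t x)| * `|g x|)).
rewrite sub0r normrN in b2.
have -> : \int[leb R]_x (V (W t x) * r t x * g x) = \int[leb R]_x (r t x * (V (W t x) * g x)).
  by apply: eq_Rintegral => x _; ring.
rewrite -(subrKA (\int[leb R]_x (r (s n) x * (V (W t x) * g x)))).
apply: (le_trans (ler_normD _ _)); rewrite [leRHS]splitr.
by apply: lerD => //; exact: le_trans b3 (le_trans b4 b2).
Unshelve. all: by end_near. Qed.

Let measurable_section (f : R -> R -> R) x :
  measurable_fun setT (fun p : R * R => f p.1 p.2) -> measurable_fun setT (f^~ x).
Proof.
by move=> mf; exact: (measurable_fun_pair1 x mf).
Qed.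

Let measurable_VW : measurable_fun setT (fun p : R * R => V (W p.1 p.2)).
Proof. by apply: measurableT_comp (measurable_Weps2 eps0 mr dr); exact: continuous_measurable_fun cV. Qed.

(** The weak formulation is tested with [profile T t * psi x]. For [0 <= t] the profile is
    [(T - t) ^+ 2] up to [T] and [0] afterwards, so the integral lives on the strip of times in
    [[0, T]], where Fubini applies. *)
Lemma weak_separated N psi psi' T : (forall x, is_derive x 1 psi (psi' x)) ->
  continuous psi' -> (forall x, N < `|x| -> psi x = 0) -> intg psi -> intg psi' ->
  0 < T ->
  primitive (fun t => - 2 * (T - t) * \int[leb R]_x (r t x * psi x) +
    (T - t) ^+ 2 * \int[leb R]_x (V (W t x) * r t x * psi' x)) T +
  T ^+ 2 * \int[leb R]_x (r0 x * psi x) = 0.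
Proof.
move=> dpsi cpsi' psi0 ipsi ipsi' T0.
have mdt : measurable_fun setT
    (fun p : R * R => dt (fun t x => profile T t * psi x) p.1 p.2).
  rewrite (_ : (fun p => _) = (fun p : R * R => profile' T p.1 * psi p.2)); last first.
    by apply/funext => p; exact: dt_profile.
  apply: measurable_tensor; last exact: intg_measurable.
  exact: continuous_measurable_fun (@continuous_profile' R T).
have mdx : measurable_fun setT
    (fun p : R * R => dx (fun t x => profile T t * psi x) p.1 p.2).
  rewrite (_ : (fun p => _) = (fun p : R * R => profile T p.1 * psi' p.2)); last first.
    by apply/funext => p; exact: dx_profile (dpsi _).
  apply: measurable_tensor; last exact: intg_measurable.
  exact: continuous_measurable_fun (is_derive_continuous (is_derive_profile T)).
have := weak (C1c2_profile T dpsi cpsi' psi0) mdt mdx.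
have -> : \int[leb R]_x (r0 x * (profile T 0 * psi x)) = T ^+ 2 * \int[leb R]_x (r0 x * psi x).
  rewrite -RintegralZl//; last first.
    by case: (dr0) => m0 _; apply: (intgM ipsi m0) => x; exact: density_norm.
  by apply: eq_Rintegral => x _; rewrite profileE ?subr0 ?lexx ?ltW// mulrCA.
move=> <-; congr (_ + _).
pose D : set (R * R) := [set p | 0 <= p.1].
have mD : measurable D.
  rewrite (_ : D = fst @^-1` `[0, +oo[%classic); last first.
    by apply/seteqP; split => p /=; rewrite in_itv/= andbT.
  by rewrite -[X in measurable X]setTI; exact: measurable_fst.
pose ind t : R := \1_(`[0, T]%classic : set R) t.
have mind : measurable_fun setT ind by exact: measurable_indic.
pose F t x := ind t * (- 2 * (T - t) * (r t x * psi x) +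
   (T - t) ^+ 2 * (V (W t x) * r t x * psi' x)).
transitivity (\int[(leb R \x leb R)%E]_p F p.1 p.2); last first.
  symmetry; rewrite Rintegral_mkcond; apply: eq_Rintegral => -[t x] _ /=.
  rewrite patchE /=; case: ifPn; rewrite ?inE ?notin_setE /D/= => t0; last first.
    rewrite /F /ind indicE memNset ?mul0r//= in_itv/= => /andP[t0' _].
    by apply: t0.
  rewrite dt_profile (dx_profile _ _ (dpsi x)).
  have [tT|tT] := leP t T.
    have t0T : 0 <= t <= T by rewrite t0.
    rewrite profileE// profile'E// /F /ind indicE mem_set/= ?in_itv//= mul1r.
    by rewrite -/(W t x); ring.
  rewrite profile'_out// ?ltW// profile_out; last by move=> /andP[_]; rewrite leNgt tT.
  rewrite /F /ind indicE memNset ?mul0r ?mulr0 ?addr0//= in_itv/= => /andP[_].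
  by rewrite leNgt tT.
have mpsi := intg_measurable ipsi; have mpsi' := intg_measurable ipsi'.
pose a t x := r t x * psi x.
pose b t x := V (W t x) * r t x * psi' x.
have ia t : intg (a t) by exact: intgM ipsi (mrt t) (rn t).
have ib t : intg (b t).
  apply: (intgM (C := M * 1) ipsi'); first exact: measurable_funM.
  by move=> x; rewrite normrM ler_pM.
pose c := 2 * T * \int[leb R]_x `|psi x| + T ^+ 2 * (M * \int[leb R]_x `|psi' x|).
have iF t : intg (F t).
  by apply: intgZ; apply: intgD; apply: intgZ; [exact: ia|exact: ib].
have ind01 t : 0 <= ind t <= 1 by rewrite /ind indicE; case: (_ \in _); rewrite ?lexx ?ler01.
have ind0 t : 0 <= ind t by case/andP: (ind01 t).
have Fle t x : `|F t x| <= (2 * T * `|psi x| + T ^+ 2 * (M * `|psi' x|)) * ind t.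
  rewrite /F normrM (ger0_norm (ind0 t)) mulrC.
  have [tT|tT] := boolP (t \in `[0, T]%classic); last first.
    by rewrite /ind indicE (negbTE tT) !mulr0.
  rewrite ler_wpM2r//; move: tT; rewrite inE/= in_itv/= => /andP[t0 tT].
  have T't : 0 <= T - t by rewrite subr_ge0.
  have tT2 : T - t <= T by rewrite gerBl.
  apply: (le_trans (ler_normD _ _)); apply: lerD; rewrite normrM; apply: ler_pM => //.
  - by rewrite normrM normrN (ger0_norm T't) ger0_norm// ler_wpM2l.
  - by rewrite normrM ler_piMl.
  - by rewrite normrX ger0_norm// lerXn2r ?nnegrE// ltW.
  - rewrite !normrM ler_wpM2r// -[leRHS]mulr1 ler_pM//.
have ii : intg ind by exact: (integrable_indic_itv 0 T true false).
have ibd : intg (fun x => 2 * T * `|psi x| + T ^+ 2 * (M * `|psi' x|)).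
  by apply: intgD; apply: intgZ; [|apply: intgZ]; exact: integrable_norm.
have [|||||_ _ E _] := @Rint_fubini R F (fun t => c * ind t).
- have mf1 (f : R -> R) : measurable_fun setT f -> measurable_fun setT (fun p : R * R => f p.1).
    by move=> mf; apply: measurableT_comp => //; exact: measurable_fst.
  have mf2 (f : R -> R) : measurable_fun setT f -> measurable_fun setT (fun p : R * R => f p.2).
    by move=> mf; apply: measurableT_comp => //; exact: measurable_snd.
  have mT : measurable_fun setT (fun t => T - t) by exact: measurable_funB.
  apply: measurable_funM; first exact: mf1 mind.
  apply: measurable_funD; apply: measurable_funM.
  + by apply: measurable_funM => //; exact: mf1 mT.
  + by apply: measurable_funM => //; exact: mf2 mpsi.
  + by apply: measurable_funX; exact: mf1 mT.
  + apply: measurable_funM; last exact: mf2 mpsi'.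
    exact: measurable_funM.
- exact: iF.
- move=> x; apply: (@intg_le _ _ (fun t => (2 * T * `|psi x| + T ^+ 2 * (M * `|psi' x|)) * ind t)).
  + apply: measurable_funM => //; apply: measurable_funD; apply: measurable_funM.
    * by apply: measurable_funM => //; exact: measurable_funB.
    * apply: measurable_funM; last exact: measurable_cst.
      exact: measurable_section mr.
    * by apply: measurable_funX; exact: measurable_funB.
    * apply: measurable_funM; last exact: measurable_cst.
      apply: measurable_funM; last exact: measurable_section mr.
      exact: (@measurable_section (fun t x => V (W t x)) x measurable_VW).
  + exact: intgZ.
  + by move=> t; exact: Fle.
- exact: intgZ.
- move=> t; rewrite /c -(RintegralZl _ measurableT) ?(integrable_norm ipsi)//.
  rewrite -(RintegralZl _ measurableT) ?(integrable_norm ipsi')//.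
  rewrite -(RintegralZl _ measurableT); last by apply: intgZ; exact: integrable_norm.
  rewrite -RintegralD//; last 2 first.
  + by apply: intgZ; exact: integrable_norm.
  + by apply: intgZ; apply: intgZ; exact: integrable_norm.
  rewrite -RintegralZr//; apply: le_Rint => //; first exact: integrable_norm (iF t).
  by have := intgZ (ind t) ibd; apply: eq_intg => x; rewrite mulrC.
rewrite E /primitive Rintegral_mkcond; apply: eq_Rintegral => t _; symmetry.
rewrite patchE /F /ind indicE.
case: ifPn => tT /=; last first.
  by under eq_Rintegral do rewrite mul0r; rewrite Rintegral_cst// mul0r.
under eq_Rintegral do rewrite mul1r.
rewrite RintegralD//; last 2 first.
- by apply: intgZ; exact: ia.
- by apply: intgZ; exact: ib.
by rewrite !RintegralZl//; [exact: ia|exact: ib].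
Qed.

End evolution.

(** * Spatial cutoffs *)

Section cutoff.
Context {R : realType}.
Implicit Types (x : R) (psi : R -> R) (k : nat).

Definition cutoff k x : R := pos_sq (1 - (x / k.+1%:R) ^+ 2).

Definition cutoff' k x : R :=
  2 * Num.max 0 (1 - (x / k.+1%:R) ^+ 2) * (- (2 * x / k.+1%:R ^+ 2)).

Lemma is_derive_cutoff k x : is_derive x 1 (cutoff k) (cutoff' k x).
Proof.
have k0 : (k.+1%:R : R) != 0 by rewrite pnatr_eq0.
have d0 := is_derive_id x (1 : R).
have d1 : is_derive x 1 (fun y : R => y / k.+1%:R) (k.+1%:R^-1).
  have := is_deriveZ (k.+1%:R^-1 : R) d0.
  rewrite /GRing.scale/= mulr1; congr is_derive; apply/funext => y.
  exact: mulrC.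
have d2 : is_derive x 1 (fun y : R => 1 - (y / k.+1%:R) ^+ 2) (- (2 * x / k.+1%:R ^+ 2)).
  have := is_deriveB (is_derive_cst (1 : R) x (1 : R)) (is_deriveM d1 d1).
  move=> h; apply: (is_derive_eq h); rewrite /GRing.scale/=.
  by field.
exact: is_derive_pos_sq_comp d2.
Qed.

Lemma cutoff_out k x : k.+1%:R < `|x| -> 1 - (x / k.+1%:R) ^+ 2 <= 0.
Proof.
move=> kx; have k0 : 0 < (k.+1%:R : R) by rewrite ltr0n.
rewrite subr_le0 -[leRHS]ger0_norm ?sqr_ge0// normrX exprn_ege1//.
by rewrite normrM normfV (gtr0_norm k0) ler_pdivlMr// mul1r ltW.
Qed.

Lemma cutoff_bound k x : 0 <= cutoff k x <= 1.
Proof.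
rewrite pos_sq_ge0/= /cutoff /pos_sq -[leRHS](expr1n _ 2) lerXn2r ?nnegrE//; last first.
  by rewrite ge_max ler01/= gerBl sqr_ge0.
by rewrite le_max lexx.
Qed.

Lemma cutoff'_bound k x : `|cutoff' k x| <= 4 / k.+1%:R.
Proof.
have k0 : 0 < (k.+1%:R : R) by rewrite ltr0n.
have [xk|xk] := leP `|x| k.+1%:R; last first.
  rewrite /cutoff' max_l ?cutoff_out// mulr0 mul0r normr0 divr_ge0//.
rewrite /cutoff' normrM.
have a1 : `|2 * Num.max 0 (1 - (x / k.+1%:R) ^+ 2)| <= 2.
  rewrite ger0_norm; last by rewrite mulr_ge0// le_max lexx.
  by rewrite -[leRHS]mulr1 ler_wpM2l// ge_max ler01/= gerBl sqr_ge0.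
have a2 : `|- (2 * x / k.+1%:R ^+ 2)| <= 2 / k.+1%:R.
  rewrite normrN !normrM normfV (ger0_norm (_ : 0 <= 2))// (ger0_norm (sqr_ge0 _)).
  rewrite ler_pdivrMr ?exprn_gt0// expr2 mulrA divfK ?gt_eqF//.
  by rewrite ler_wpM2l.
apply: (le_trans (ler_pM _ _ a1 a2)) => //.
by rewrite mulrA -natrM.
Qed.

Lemma cvg_cutoff x : cutoff k x @[k --> \oo] --> (1 : R).
Proof.
rewrite [X in _ --> X](_ : _ = pos_sq (1 - (x * 0) ^+ 2)); last first.
  by rewrite mulr0 expr0n subr0 pos_sqE// expr1n.
apply: (@continuous_cvg _ _ _ _ _ (fun k => 1 - (x / k.+1%:R) ^+ 2)).
  exact: continuous_pos_sq.
apply: cvgB; first exact: cvg_cst.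
rewrite expr2; under eq_fun do rewrite expr2.
by apply: cvgM; (apply: cvgM; [exact: cvg_cst|exact: cvg_harmonic]).
Qed.

Lemma cvg_cutoff' x : cutoff' k x @[k --> \oo] --> (0 : R).
Proof.
apply/cvgrPdist_le => e e0.
have := @cvg_harmonic R; move/cvgrPdist_le => /(_ (e / 4)); rewrite divr_gt0// => /(_ isT).
apply: filterS => k /=; rewrite !sub0r !normrN => h.
apply: (le_trans (cutoff'_bound k x)); rewrite mulrC -ler_pdivlMr//.
by apply: le_trans h; rewrite ler_norm.
Qed.

Lemma continuous_cutoff' k : continuous (cutoff' k).
Proof.
have cx : continuous (fun x : R => x / k.+1%:R).
  by move=> x; apply: cvgM; [exact: cvg_id|exact: cvg_cst].
move=> x; apply: cvgM.
  apply: cvgM; first exact: cvg_cst.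
  apply: (@continuous_comp _ _ _ (fun x : R => 1 - (x / k.+1%:R) ^+ 2) (Num.max 0)).
    apply: cvgB; first exact: cvg_cst.
    by rewrite expr2; under eq_fun do rewrite expr2; apply: cvgM; exact: cx.
  exact: continuous_max0.
apply: cvgN; apply: cvgM; last exact: cvg_cst.
by apply: cvgM; [exact: cvg_cst|exact: cvg_id].
Qed.

End cutoff.

(** * Moments against integrable functions *)

Section momentum.
Context {R : realType}.
Implicit Types (t T x N : R) (psi g : R -> R).
Variables (V : R -> R) (M L eps : R) (r : R -> R -> R) (r0 : R -> R).
Hypothesis eps0 : 0 < eps.
Hypothesis V_bounded : forall w, `|V w| <= M.
Hypothesis V_lip : forall a b, `|V a - V b| <= L * `|a - b|.
Hypothesis sol : regular_solution V eps r0 r.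

Let M_ge0 : 0 <= M. Proof. exact: le_trans (normr_ge0 _) (V_bounded 0). Qed.

Let m psi t := \int[leb R]_x (r t x * psi x).
Let n psi' t := \int[leb R]_x (V (Weps eps (r t) x) * r t x * psi' x).

Let rn t x : `|r t x| <= 1. Proof. exact: density_norm (rs_density sol t). Qed.

Let mrt t : measurable_fun setT (r t). Proof. by case: (rs_density sol t). Qed.

Let mVr t : measurable_fun setT (fun x => V (Weps eps (r t) x) * r t x).
Proof.
apply: measurable_funM => //; apply: measurableT_comp; apply: continuous_measurable_fun.
  exact: lipschitz_continuous V_lip.
exact: continuous_Weps (rs_density sol t).
Qed.

Let Vrn t x : `|V (Weps eps (r t) x) * r t x| <= M.
Proof. by rewrite normrM -[leRHS]mulr1 ler_pM. Qed.

(** The adjoint averages to be used as tests decay without having compact support. Cutoffs with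
    derivative [O(1 / k)] reduce to the compact case, and dominated convergence is applied in space
    and then in time. *)
Lemma weak_integrable psi psi' T : (forall x, is_derive x 1 psi (psi' x)) ->
  continuous psi' -> intg psi -> intg psi' -> 0 < T ->
  primitive (fun t => - 2 * (T - t) * m psi t + (T - t) ^+ 2 * n psi' t) T +
  T ^+ 2 * \int[leb R]_x (r0 x * psi x) = 0.
Proof.
move=> dpsi cpsi' ip ip' T0.
have [mr0 _] := rs_density0 sol.
have r0n x : `|r0 x| <= 1 by exact: density_norm (rs_density0 sol).
have cpsi := is_derive_continuous dpsi.
have mp := continuous_measurable_fun cpsi; have mp' := continuous_measurable_fun cpsi'.
have mc k := continuous_measurable_fun (is_derive_continuous (@is_derive_cutoff R k)).
have mc' k := continuous_measurable_fun (@continuous_cutoff' R k).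
have cn k x : `|cutoff k x| <= 1 :> R by have /andP[c0 c1] := cutoff_bound k x; rewrite ger0_norm.
have cn' k x : `|cutoff' k x| <= 4 :> R.
  apply: (le_trans (cutoff'_bound k x)); rewrite ler_piMr// invf_le1 ?ltr0n//.
  by rewrite ler1n.
pose p k x := psi x * cutoff k x.
pose p' k x := psi x * cutoff' k x + cutoff k x * psi' x.
have dp k x : is_derive x 1 (p k) (p' k x).
  by apply: (is_derive_eq (is_deriveM (dpsi x) (is_derive_cutoff k x))).
have cp' k : continuous (p' k).
  move=> x; apply: cvgD; apply: cvgM.
  - exact: cpsi.
  - exact: continuous_cutoff'.
  - exact: (is_derive_continuous (@is_derive_cutoff R k)).
  - exact: cpsi'.
have ipk k : intg (p k).
  by apply: eq_intg (intgM ip (mc k) (cn k)) => x; rewrite mulrC.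
have ipk' k : intg (p' k).
  apply: intgD; last exact: intgM ip' (mc k) (cn k).
  by apply: eq_intg (intgM ip (mc' k) (cn' k)) => x; rewrite mulrC.
have pk0 k x : k.+1%:R < `|x| -> p k x = 0.
  by move=> kx; rewrite /p /cutoff pos_sq_le0 ?mulr0// cutoff_out.
have E k := weak_separated eps0 V_bounded V_lip sol (dp k) (cp' k) (@pk0 k) (ipk k) (ipk' k) T0.
pose J k := primitive (fun t => - 2 * (T - t) * m (p k) t + (T - t) ^+ 2 * n (p' k) t) T.
have pn k x : `|p k x| <= `|psi x| by rewrite normrM -[leRHS]mulr1 ler_wpM2l.
have pn' k x : `|p' k x| <= 4 * `|psi x| + `|psi' x|.
  apply: (le_trans (ler_normD _ _)); apply: lerD; rewrite normrM.
    by rewrite mulrC ler_wpM2r.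
  by rewrite ler_piMl.
have limp x : p k x @[k --> \oo] --> psi x.
  by rewrite -[X in _ --> X]mulr1; apply: cvgM; [exact: cvg_cst|exact: cvg_cutoff].
have limp' x : p' k x @[k --> \oo] --> psi' x.
  rewrite [X in _ --> X](_ : _ = psi x * 0 + 1 * psi' x); last by rewrite mulr0 add0r mul1r.
  apply: cvgD; first by apply: cvgM; [exact: cvg_cst|exact: cvg_cutoff'].
  by apply: cvgM; [exact: cvg_cutoff|exact: cvg_cst].
have limA (f : R -> R) : measurable_fun setT f -> (forall x, `|f x| <= 1) ->
    \int[leb R]_x (f x * p k x) @[k --> \oo] --> \int[leb R]_x (f x * psi x).
  move=> mf f1; apply: (@Rint_dct _ _ _ (fun x => `|psi x|)).
  - by move=> k; apply: measurable_funM => //; exact: intg_measurable.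
  - exact: measurable_funM.
  - by move=> x; apply: cvgM; [exact: cvg_cst|exact: limp].
  - exact: integrable_norm.
  - move=> k x; rewrite normrM -[leRHS]mul1r; exact: ler_pM.
have ibd : intg (fun x => M * (4 * `|psi x| + `|psi' x|)).
  by apply: intgZ; apply: intgD; [apply: intgZ|]; exact: integrable_norm.
have limn t : n (p' k) t @[k --> \oo] --> n psi' t.
  apply: (@Rint_dct _ _ _ (fun x => M * (4 * `|psi x| + `|psi' x|))) => //.
  - by move=> k; apply: measurable_funM => //; exact: intg_measurable.
  - exact: measurable_funM.
  - by move=> x; apply: cvgM; [exact: cvg_cst|exact: limp'].
  - by move=> k x; rewrite normrM; exact: ler_pM.
pose A := \int[leb R]_x `|psi x|.
pose B := \int[leb R]_x (M * (4 * `|psi x| + `|psi' x|)).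
have mA k t : `|m (p k) t| <= A.
  apply: le_abs_Rint; [|exact: integrable_norm|].
    by apply: measurable_funM => //; exact: intg_measurable.
  by move=> x; rewrite normrM -[leRHS]mul1r; exact: ler_pM.
have nB k t : `|n (p' k) t| <= B.
  apply: le_abs_Rint => //.
    by apply: measurable_funM => //; exact: intg_measurable.
  by move=> x; rewrite normrM; exact: ler_pM.
have chp (q q' : R -> R) : intg q -> intg q' ->
    continuous (fun t => - 2 * (T - t) * m q t + (T - t) ^+ 2 * n q' t).
  move=> iq iq' t.
  have cT : (fun t => T - t) @ t --> T - t by apply: cvgB; [exact: cvg_cst|exact: cvg_id].
  apply: cvgD; apply: cvgM.
  - by apply: cvgM; [exact: cvg_cst|exact: cT].
  - exact: (@rs_continuous _ _ _ _ _ sol _ iq t).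
  - by rewrite expr2; under eq_fun do rewrite expr2; apply: cvgM; exact: cT.
  - exact: (@continuous_momentum _ _ _ _ _ _ _ eps0 V_bounded V_lip sol _ iq' t).
have mhp (q q' : R -> R) : intg q -> intg q' -> measurable_fun setT
    ((fun t => - 2 * (T - t) * m q t + (T - t) ^+ 2 * n q' t) \_ `[0, T]%classic).
  move=> iq iq'; apply/measurable_restrict => //; apply: measurable_funTS.
  by apply: continuous_measurable_fun; exact: chp.
have limJ : J k @[k --> \oo] -->
    primitive (fun t => - 2 * (T - t) * m psi t + (T - t) ^+ 2 * n psi' t) T.
  rewrite /J /primitive Rintegral_mkcond; under eq_fun do rewrite Rintegral_mkcond.
  apply: (@Rint_dct _ _ _ (fun t => (2 * T * A + T ^+ 2 * B) * \1_(`[0, T]%classic : set R) t)).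
  - by move=> k; exact: mhp.
  - exact: mhp.
  - move=> t; rewrite patchE; under eq_fun do rewrite patchE.
    case: ifP => _; last exact: cvg_cst.
    apply: cvgD; (apply: cvgM; first exact: cvg_cst); last exact: limn.
    by apply: limA.
  - by apply: intgZ; exact: (integrable_indic_itv 0 T true false).
  - move=> k t; rewrite patchE indicE; case: ifPn => tT; last by rewrite normr0 mulr0.
    rewrite mulr1; move: tT; rewrite inE/= in_itv/= => /andP[t0 tT].
    have T't : 0 <= T - t by rewrite subr_ge0.
    have tT2 : T - t <= T by rewrite gerBl.
    apply: (le_trans (ler_normD _ _)); apply: lerD; rewrite normrM; apply: ler_pM => //.
      by rewrite normrM normrN (ger0_norm T't) ger0_norm// ler_wpM2l.
    by rewrite normrX ger0_norm// lerXn2r ?nnegrE// ltW.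
have limE : J k + T ^+ 2 * \int[leb R]_x (r0 x * p k x) @[k --> \oo] -->
   primitive (fun t => - 2 * (T - t) * m psi t + (T - t) ^+ 2 * n psi' t) T +
   T ^+ 2 * \int[leb R]_x (r0 x * psi x).
  by apply: cvgD => //; apply: cvgM; [exact: cvg_cst|exact: limA].
rewrite -(cvg_lim (@Rhausdorff R) limE).
rewrite (_ : (fun k => _) = cst 0) ?lim_cst//.
by apply/funext => k; exact: E.
Qed.

Section test_function.
Variables (psi psi' : R -> R).
Hypothesis dpsi : forall x, is_derive x 1 psi (psi' x).
Hypothesis cpsi' : continuous psi'.
Hypothesis ipsi : intg psi.
Hypothesis ipsi' : intg psi'.

Let cm : continuous (m psi). Proof. exact: (rs_continuous sol ipsi). Qed.

Let cn : continuous (n psi').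
Proof. exact: (continuous_momentum eps0 V_bounded V_lip sol ipsi'). Qed.

Lemma momentum_integral T : 0 < T ->
  m psi T = \int[leb R]_x (r0 x * psi x) + primitive (n psi') T.
Proof.
move=> T0; apply: (weak_ode cm cn) T0 => S S0.
exact: weak_integrable.
Qed.

Lemma is_derive_momentum T : 0 < T -> is_derive T 1 (m psi) (n psi' T).
Proof.
move=> T0; pose c := \int[leb R]_x (r0 x * psi x).
have h : is_derive T 1 (fun t => c + primitive (n psi') t) (n psi' T).
  have := is_deriveD (is_derive_cst c T (1 : R)) (is_derive_primitive cn T0).
  by rewrite add0r.
apply: near_eq_is_derive h; near=> t.
by rewrite momentum_integral//; near: t; exact: lt_nbhsr.
Unshelve. all: by end_near. Qed.

Lemma momentum_norm T : `|n psi' T| <= M * \int[leb R]_x `|psi' x|.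
Proof.
rewrite -RintegralZl//; last exact: integrable_norm.
apply: le_abs_Rint; [|by apply: intgZ; exact: integrable_norm|].
  by apply: measurable_funM => //; exact: intg_measurable.
by move=> x; rewrite normrM ler_wpM2r.
Qed.

Lemma momentum_lipschitz s t : 0 <= s -> s <= t ->
  `|m psi t - m psi s| <= M * \int[leb R]_x `|psi' x| * (t - s).
Proof.
move=> s0 st.
have [||c cst E] := @MVT_segment R (m psi) (n psi') s t st; last first.
- by rewrite E normrM (ger0_norm (_ : 0 <= t - s)) ?subr_ge0// ler_wpM2r ?subr_ge0// momentum_norm.
- by apply: continuous_subspaceT; exact: cm.
- by move=> x; rewrite in_itv/= => /andP[sx _]; apply: is_derive_momentum; exact: le_lt_trans sx.
Qed.

(** [r 0] and [r0] are tied only by the weak formulation, which gives the moments at positive times;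
    letting the time tend to [0] identifies the two. *)
Lemma momentum0 : m psi 0 = \int[leb R]_x (r0 x * psi x).
Proof.
set c := RHS.
have l1 : m psi (harmonic k) @[k --> \oo] --> m psi 0.
  exact: (cvg_comp _ _ (@cvg_harmonic R) (@cm 0)).
have l2 : m psi (harmonic k) @[k --> \oo] --> c.
  have l3 : primitive (n psi') (harmonic k) @[k --> \oo] --> (0 : R).
    apply: (cvg_comp _ _ (@cvg_harmonic R)).
    apply: (@parameterized_integral_cvg_left R 0 1 (n psi') ltr01).
    exact: continuous_itv_integrable.
  rewrite -[X in _ --> X]addr0; under eq_fun => k.
    rewrite momentum_integral; last by case: (@harmonic_bounds R k).
    over.
  by apply: cvgD; [exact: cvg_cst|exact: l3].
by rewrite -(cvg_lim (@Rhausdorff R) l1) (cvg_lim (@Rhausdorff R) l2).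
Qed.

End test_function.

End momentum.

(** * Time increments of the averages and their initial value *)

Section increments.
Context {R : realType}.
Implicit Types (s t T x y l d : R) (phi psi g : R -> R).

(** [Weps eps] fixes the constant [1], so its adjoint preserves integrals; it also preserves
    positivity, and is applied to [|phi|]. *)
Lemma Wadj_L1 eps l phi : 0 < eps -> 0 < l -> l * eps <= 2^-1 ->
  continuous phi -> dom l phi ->
  \int[leb R]_x `|Wadj eps phi x| <= \int[leb R]_x `|phi x|.
Proof.
move=> e0 l0 le cphi dphi; have [mphi [C phiC]] := dphi.
have d1 : density (cst 1 : R -> R) by split => // x; rewrite ler01 lexx.
have dnphi : dom l (fun x => `|phi x|).
  by split; [exact: measurableT_comp|exists C => x; rewrite normr_id].
have cnphi : continuous (fun x => `|phi x|) by move=> x; apply: cvg_norm; exact: cphi.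
have W1 x : Weps eps (cst 1) x = 1.
  by rewrite WepsK//; under eq_Rintegral do rewrite mulr1; exact: Rint_Kl.
have := Weps_adjoint e0 l0 le d1 dnphi.
under eq_Rintegral do rewrite W1 mul1r.
under [X in _ = X -> _]eq_Rintegral do rewrite mul1r.
move=> ->; apply: le_Rint.
- exact: integrable_norm (dom_intg l0 (dom_Wadj e0 l0 le cphi dphi)).
- exact: dom_intg l0 (dom_Wadj e0 l0 le cnphi dnphi).
move=> y; apply: le_abs_Rint.
- by apply: measurable_funM => //; exact: measurable_Kr.
- apply: (intgM (C := eps^-1) (dom_intg l0 dnphi)); first exact: measurable_Kr.
  by move=> x; rewrite ger0_norm ?K_ge0 ?K_le.
- by move=> x; rewrite normrM (ger0_norm (K_ge0 _ e0)).
Qed.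

Lemma Wadj_derivative_L1 eps l phi : 0 < eps -> 0 < l -> l * eps <= 2^-1 ->
  continuous phi -> dom l phi ->
  \int[leb R]_x `|(phi x - Wadj eps phi x) / eps| <= 2 / eps * \int[leb R]_x `|phi x|.
Proof.
move=> e0 l0 le cphi dphi; have dK := dom_Wadj e0 l0 le cphi dphi.
have i1 := integrable_norm (dom_intg l0 dphi).
have i2 := integrable_norm (dom_intg l0 dK).
apply: (@le_trans _ _ (\int[leb R]_x (eps^-1 * (`|phi x| + `|Wadj eps phi x|)))).
  apply: le_Rint.
  - apply: integrable_norm => //; apply: eq_intg (intgZ eps^-1 (intgB (dom_intg l0 dphi) (dom_intg l0 dK))).
    by move=> x; rewrite mulrC.
  - by apply: intgZ; exact: intgD.
  - move=> x; rewrite normrM normfV (gtr0_norm e0) mulrC ler_wpM2l ?invr_ge0 ?(ltW e0)//.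
    exact: ler_normB.
rewrite RintegralZl//; last exact: intgD.
rewrite RintegralD// (mulrC 2) -mulrA ler_wpM2l ?invr_ge0 ?(ltW e0)//.
by have := Wadj_L1 e0 l0 le cphi dphi; lra.
Qed.

(* AM-GM: [|g| <= k + g ^+ 2 / k]. *)
Lemma weighted_L1_L2 l (k : R) g : 0 < l -> 0 < k -> measurable_fun setT g ->
  (forall x, `|g x| <= 1) ->
  \int[leb R]_x (weight l x * `|g x|) <=
  k * \int[leb R]_x weight l x + k^-1 * \int[leb R]_x (weight l x * g x ^+ 2).
Proof.
move=> l0 k0 mg g1.
have i1 := intg_weight l0.
have i2 : intg (fun x => weight l x * g x ^+ 2).
  apply: (dom_intg l0); apply: (domMr (D := 1)); first exact: dom_weight.
    exact: measurable_funX.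
  by move=> x; rewrite normrX exprn_ile1.
rewrite -!RintegralZl// -RintegralD//; try by apply: intgZ.
apply: le_Rint; last 2 first.
- by apply: intgD; exact: intgZ.
- move=> x; rewrite mulrCA [k * _]mulrC -mulrDr ler_wpM2l ?weight_ge0//.
  rewrite -(ler_pM2r k0) mulrDl mulrAC mulVf ?gt_eqF// mul1r.
  have := sqr_ge0 (`|g x| - k); rewrite sqrrB real_normK ?num_real//.
  have := mulr_ge0 (normr_ge0 (g x)) (ltW k0); lra.
apply: (dom_intg l0); apply: (domMr (D := 1)); first exact: dom_weight.
  exact: measurableT_comp.
by move=> x; rewrite normr_id.
Qed.

Variables (V : R -> R) (M L eps l : R) (r : R -> R -> R) (r0 : R -> R).
Hypothesis eps0 : 0 < eps.
Hypothesis l0 : 0 < l.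
Hypothesis le : l * eps <= 2^-1.
Hypothesis V_bounded : forall w, `|V w| <= M.
Hypothesis V_lip : forall a b, `|V a - V b| <= L * `|a - b|.
Hypothesis sol : regular_solution V eps r0 r.

Let M_ge0 : 0 <= M. Proof. exact: le_trans (normr_ge0 _) (V_bounded 0). Qed.

Let W t x := Weps eps (r t) x.

Let cW t : continuous (W t). Proof. exact: continuous_Weps (rs_density sol t). Qed.

Lemma Weps_diff_norm q1 q2 x : density q1 -> density q2 ->
  `|Weps eps q1 x - Weps eps q2 x| <= 1.
Proof.
move=> dq1 dq2; have := Weps_ge0 x eps0 dq1; have := Weps_le1 x eps0 dq1.
have := Weps_ge0 x eps0 dq2; have := Weps_le1 x eps0 dq2.
by move=> ? ? ? ?; rewrite ler_norml; apply/andP; split; lra.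
Qed.

Lemma Weps_intg q phi : density q -> dom l phi -> intg (fun x => Weps eps q x * phi x).
Proof.
move=> dq dphi; apply: (intgM (C := 1) (dom_intg l0 dphi)).
  by apply: continuous_measurable_fun; exact: continuous_Weps.
by move=> x; rewrite ger0_norm ?Weps_ge0 ?Weps_le1.
Qed.

Lemma Weps_increment s t phi : 0 <= s -> s <= t -> continuous phi -> dom l phi ->
  \int[leb R]_x ((W t x - W s x) * phi x) <=
  2 * M / eps * (t - s) * \int[leb R]_x `|phi x|.
Proof.
move=> s0 st cphi dphi; pose psi := Wadj eps phi.
pose psi' x := (phi x - psi x) / eps.
have dpsi x : is_derive x 1 psi (psi' x) by exact: is_derive_Wadj l0 cphi dphi.
have dK := dom_Wadj eps0 l0 le cphi dphi.
have cpsi' : continuous psi'.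
  move=> x; apply: cvgM; last exact: cvg_cst.
  by apply: cvgB; [exact: cphi|exact: (is_derive_continuous dpsi)].
have ipsi' : intg psi'.
  apply: eq_intg (intgZ eps^-1 (intgB (dom_intg l0 dphi) (dom_intg l0 dK))) => x.
  exact: mulrC.
have iW q : intg (fun x => W q x * phi x) by exact: Weps_intg (rs_density sol q) dphi.
under eq_Rintegral do rewrite mulrBl.
rewrite RintegralB//; [|exact: iW..].
rewrite !(Weps_adjoint eps0 l0 le (rs_density sol _) dphi).
apply: (le_trans (ler_norm _)).
apply: (le_trans (momentum_lipschitz eps0 V_bounded V_lip sol dpsi cpsi' (dom_intg l0 dK) ipsi' s0 st)).
rewrite [leRHS](_ : _ = M * (2 / eps * \int[leb R]_x `|phi x|) * (t - s)); last by ring.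
by rewrite ler_wpM2r ?subr_ge0// ler_wpM2l//; exact: (Wadj_derivative_L1 eps0 l0 le cphi dphi).
Qed.

Lemma Weps_increment_L2 s t : 0 <= s -> 0 <= t ->
  \int[leb R]_x (weight l x * (W t x - W s x) ^+ 2) <=
  (2 * M / eps) ^+ 2 * (t - s) ^+ 2 * \int[leb R]_x weight l x.
Proof.
wlog st : s t / s <= t => [hwlog|] s0 t0.
  have [|/ltW ts] := leP s t; first by move/hwlog; exact.
  have := hwlog _ _ ts t0 s0; rewrite -(sqrrN (s - t)) opprB.
  by under eq_Rintegral do rewrite -sqrrN opprB.
(* [Weps_increment] is tested with the weighted increment itself. *)
pose phi x := (W t x - W s x) * weight l x.
have mWW : measurable_fun setT (fun x => W t x - W s x).
  by apply: measurable_funB; apply: continuous_measurable_fun; exact: cW.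
have W1 x : `|W t x - W s x| <= 1.
  by apply: Weps_diff_norm; exact: (rs_density sol).
have dphi : dom l phi by apply: (domM (D := 1)) => //; exact: dom_weight.
have cphi : continuous phi.
  move=> x; apply: cvgM; last exact: continuous_weight.
  by apply: cvgB; exact: cW.
have := Weps_increment s0 st cphi dphi.
set a := 2 * M / eps * (t - s).
have a0 : 0 <= a by rewrite /a !mulr_ge0 ?invr_ge0 ?subr_ge0// ltW.
rewrite (_ : (2 * M / eps) ^+ 2 * (t - s) ^+ 2 = a ^+ 2); last by rewrite /a; ring.
have i2 : intg (fun x => weight l x * (W t x - W s x) ^+ 2).
  apply: (dom_intg l0); apply: (domMr (D := 1)); first exact: dom_weight.
    exact: measurable_funX.
  by move=> x; rewrite normrX exprn_ile1.
have -> : \int[leb R]_x ((W t x - W s x) * phi x) = \int[leb R]_x (weight l x * (W t x - W s x) ^+ 2).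
  by apply: eq_Rintegral => x _; rewrite /phi; ring.
set X := \int[_]_x _; move=> h.
(* Young's inequality [a * y <= (a ^+ 2 + y ^+ 2) / 2], which lets half of the finite quantity [X]
   be absorbed. *)
have h2 : a * \int[leb R]_x `|phi x| <= 2^-1 * a ^+ 2 * \int[leb R]_x weight l x + 2^-1 * X.
  rewrite -!RintegralZl//; [|exact: intg_weight|exact: integrable_norm (dom_intg l0 dphi)].
  rewrite -RintegralD//; [|by apply: intgZ; exact: intg_weight|exact: intgZ].
  apply: le_Rint.
  - by apply: intgZ; exact: integrable_norm (dom_intg l0 dphi).
  - by apply: intgD; apply: intgZ => //; exact: intg_weight.
  move=> x; rewrite /phi normrM (ger0_norm (weight_ge0 _ _)).
  rewrite [leRHS](_ : _ = (2^-1 * a ^+ 2 + 2^-1 * (W t x - W s x) ^+ 2) * weight l x); last by ring.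
  rewrite mulrA ler_wpM2r ?weight_ge0//.
  have := sqr_ge0 (a - `|W t x - W s x|); rewrite sqrrB real_normK ?num_real//; lra.
by lra.
Qed.

(** [momentum0], tested through the adjoint with the weighted difference itself, kills its weighted
    square integral. [weighted_L1_L2] with arbitrarily small [k] then kills the weighted L^1
    norm. *)
Lemma Weps_initial : \int[leb R]_x (weight l x * `|W 0 x - Weps eps r0 x|) <= 0.
Proof.
have dr0 := rs_density0 sol; have d0 := rs_density sol 0.
pose D x := W 0 x - Weps eps r0 x.
have cD : continuous D.
  by move=> x; apply: cvgB; [exact: cW|exact: continuous_Weps].
have mD := continuous_measurable_fun cD.
have D1 x : `|D x| <= 1 by exact: Weps_diff_norm.
pose phi x := D x * weight l x.
have dphi : dom l phi by apply: (domM (D := 1)) => //; exact: dom_weight.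
have cphi : continuous phi by move=> x; apply: cvgM; [exact: cD|exact: continuous_weight].
pose psi := Wadj eps phi; pose psi' x := (phi x - psi x) / eps.
have dpsi x : is_derive x 1 psi (psi' x) by exact: is_derive_Wadj l0 cphi dphi.
have dK := dom_Wadj eps0 l0 le cphi dphi.
have cpsi' : continuous psi'.
  move=> x; apply: cvgM; last exact: cvg_cst.
  by apply: cvgB; [exact: cphi|exact: (is_derive_continuous dpsi)].
have ipsi' : intg psi'.
  apply: eq_intg (intgZ eps^-1 (intgB (dom_intg l0 dphi) (dom_intg l0 dK))) => x.
  exact: mulrC.
have E := momentum0 eps0 V_bounded V_lip sol dpsi cpsi' (dom_intg l0 dK) ipsi'.
rewrite -!(Weps_adjoint eps0 l0 le _ dphi)// in E.
have Z : \int[leb R]_x (weight l x * D x ^+ 2) = 0.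
  transitivity (\int[leb R]_x (W 0 x * phi x) - \int[leb R]_x (Weps eps r0 x * phi x)).
    rewrite -RintegralB//; [|exact: (Weps_intg d0 dphi)|exact: (Weps_intg dr0 dphi)].
    by apply: eq_Rintegral => x _; rewrite /phi /D; ring.
  by rewrite /W E subrr.
apply/ler_addgt0Pl => e e0; rewrite addr0.
pose Th := \int[leb R]_x weight l x.
have Th0 : 0 <= Th by apply: Rintegral_ge0 => x _; exact: weight_ge0.
have k0 : 0 < e / (Th + 1) by rewrite divr_gt0// ltr_wpDl.
have := weighted_L1_L2 l0 k0 mD D1; rewrite Z mulr0 addr0 => /le_trans; apply.
by rewrite -/Th mulrAC ler_pdivrMr ?ltr_wpDl// mulrDr mulr1 lerDl ltW.
Qed.

End increments.

(** * Weighted contraction *)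

Section contraction.
Context {R : realType}.
Implicit Types (s t T x y l d : R) (phi psi g : R -> R).

(** The function [f s * expR (- (a * s)) - b * s] does not increase. The differential inequality is
    needed at positive times only; continuity takes care of [0]. *)
Lemma gronwall (f df : R -> R) (a b : R) t : 0 <= a -> 0 <= b -> 0 <= t ->
  continuous f -> (forall s, 0 < s -> is_derive s 1 f (df s)) ->
  (forall s, 0 < s -> df s <= a * f s + b) ->
  f t <= expR (a * t) * (f 0 + b * t).
Proof.
move=> a0 b0 t0 cf dfs le.
pose e s := expR (- (a * s)).
have de s : is_derive s 1 e (e s * - a).
  have h : is_derive s 1 (fun s : R => - (a * s)) (- a).
    have := is_deriveN (is_deriveZ a (is_derive_id s (1 : R))).
    by rewrite /GRing.scale/= mulr1.
  exact: (@is_derive1_comp _ expR _ s _ _ (is_derive_expR _) h).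
pose g s := f s * e s - b * s.
have dg s : 0 < s -> is_derive s 1 g (f s * (e s * - a) + e s * df s - b).
  move=> s0; have := is_deriveB (is_deriveM (dfs s s0) (de s)) (is_deriveZ b (is_derive_id s (1 : R))).
  by move=> h; apply: (is_derive_eq h); rewrite /GRing.scale/= mulr1.
have cg : continuous g.
  move=> s; apply: cvgB; last by apply: cvgM; [exact: cvg_cst|exact: cvg_id].
  by apply: cvgM; [exact: cf|exact: (is_derive_continuous de)].
have gle : g t <= g 0.
  move: t0; rewrite le_eqVlt => /orP[/eqP<-//|t0].
  have cgw : {within `[0, t], continuous g} by exact: continuous_subspaceT.
  have dgw s : s \in `]0, t[ -> is_derive s 1 g (f s * (e s * - a) + e s * df s - b).
    by rewrite in_itv/= => /andP[s0 _]; exact: dg.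
  have [c] := MVT t0 dgw cgw; rewrite in_itv/= => /andP[c0 _] E.
  rewrite -subr_le0 E subr0 pmulr_lle0// subr_le0.
  rewrite [leLHS](_ : _ = e c * (df c - a * f c)); last by ring.
  have e1 : e c <= 1 by rewrite -expR0 ler_expR oppr_le0 mulr_ge0// ltW.
  apply: (@le_trans _ _ (e c * b)); last by rewrite ler_piMl.
  by rewrite ler_wpM2l ?expR_ge0// lerBlDl le.
move: gle; rewrite /g /e mulr0 oppr0 expR0 mulr1 mulr0 subr0 expRN => gle.
have E0 := expR_gt0 (a * t).
have : f t / expR (a * t) <= f 0 + b * t by lra.
by rewrite ler_pdivrMr// mulrC.
Qed.

Variables (V G : R -> R) (M L eps l : R).
Variables (r1 r2 : R -> R -> R) (q1 q2 : R -> R).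
Hypothesis eps0 : 0 < eps.
Hypothesis l0 : 0 < l.
Hypothesis le : l * eps <= 2^-1.
Hypothesis l1 : l <= 2^-1.
Hypothesis V_bounded : forall w, `|V w| <= M.
Hypothesis V_lip : forall a b, `|V a - V b| <= L * `|a - b|.
Hypothesis V_decr : forall a b, a <= b -> V b <= V a.
Hypothesis G_mean : forall a b, a <= b ->
  exists2 c, a <= c <= b & G b - G a = V c * (b - a).
Hypothesis sol1 : regular_solution V eps q1 r1.
Hypothesis sol2 : regular_solution V eps q2 r2.

Let M_ge0 : 0 <= M. Proof. exact: le_trans (normr_ge0 _) (V_bounded 0). Qed.

Let L_ge0 : 0 <= L.
Proof. by have := le_trans (normr_ge0 _) (V_lip 1 0); rewrite subr0 normr1 mulr1. Qed.

Let W1 t x := Weps eps (r1 t) x.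
Let W2 t x := Weps eps (r2 t) x.
Let u t x := W1 t x - W2 t x.

Let cu t : continuous (u t).
Proof.
move=> x; apply: cvgB.
  exact: (@continuous_Weps _ _ _ eps0 (rs_density sol1 t)).
exact: (@continuous_Weps _ _ _ eps0 (rs_density sol2 t)).
Qed.

Let mu t : measurable_fun setT (u t). Proof. exact: continuous_measurable_fun (@cu t). Qed.

Let u_le1 t x : `|u t x| <= 1.
Proof. exact: Weps_diff_norm eps0 _ _ _ (rs_density sol1 t) (rs_density sol2 t). Qed.

Let E d t := \int[leb R]_x (huber d (u t x) * weight l x).

Let huber_le1 d t x : 0 < d -> `|huber d (u t x)| <= 1.
Proof.
move=> d0; have /andP[_ h] := huber_bounds (u t x) d0.
by rewrite ger0_norm ?huber_ge0//; exact: le_trans h (u_le1 t x).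
Qed.

Let dom_huber d t : 0 < d -> dom l (fun x => huber d (u t x) * weight l x).
Proof.
move=> d0; apply: (domM (D := 1)); first exact: dom_weight.
  by apply: measurable_huber => //; exact: ltW.
by move=> x; exact: huber_le1.
Qed.

Lemma continuous_huber d : 0 < d -> continuous (huber d).
Proof.
move=> d0 x; apply: cvgM; last exact: cvg_cst.
have cc : clamp d z @[z --> x] --> clamp d x by apply: continuous_clamp; exact: ltW.
apply: cvgB; first by apply: cvgM; [exact: cc|exact: cvg_id].
apply: cvgM; last exact: cvg_cst.
by rewrite expr2; under eq_fun do rewrite expr2; exact: cvgM.
Qed.

Let continuous_E d : 0 < d -> continuous (E d).
Proof.
move=> d0 t; apply/(@cvg_nbhsP _ R^o) => s st.
apply: (@Rint_dct _ _ _ (fun x => weight l x)).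
- by move=> n; exact: (proj1 (dom_huber _ d0)).
- exact: (proj1 (dom_huber _ d0)).
- move=> x; apply: cvgM; last exact: cvg_cst.
  have cus : u (s n) x @[n --> \oo] --> u t x.
    apply: cvgB.
      exact: (cvg_comp _ _ st (@continuous_Weps_time _ _ _ _ _ eps0 sol1 x t)).
    exact: (cvg_comp _ _ st (@continuous_Weps_time _ _ _ _ _ eps0 sol2 x t)).
  exact: (cvg_comp _ _ cus (@continuous_huber d d0 (u t x))).
- exact: intg_weight.
- move=> n x; rewrite normrM (ger0_norm (weight_ge0 _ _)) ler_piMl ?weight_ge0//.
  exact: huber_le1.
Qed.

Let Th := \int[leb R]_x weight l x.

(* [E d] is differentiable, although [W1] and [W2] need not be in time: the momentum
   of [phi] is, and by [huber_taylor] and [Weps_increment_L2] the remainder is quadratic. *)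
Lemma entropy_evolution d t : 0 < d -> d <= 1 -> 0 < t ->
  exists2 D, is_derive t 1 (E d) D &
  D <= (2 * M + 4 * L) * l * E d t + (4 * M + 4 * L + 7 * L / eps) * d * Th.
Proof.
move=> d0 d1 t0.
pose s x := clamp d (u t x) / d.
pose phi x := s x * weight l x.
pose psi := Wadj eps phi; pose psi' x := (phi x - psi x) / eps.
have d0' := ltW d0.
have s1 x : `|s x| <= 1.
  by rewrite normrM normfV (ger0_norm d0') ler_pdivrMr// mul1r clamp_norm_le.
have ms : measurable_fun setT s by apply: measurable_funM => //; exact: measurable_clamp.
have dphi : dom l phi by apply: (domM (D := 1)) => //; exact: dom_weight.
have cphi : continuous phi.
  move=> x; apply: cvgM; last exact: continuous_weight.
  apply: cvgM; last exact: cvg_cst.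
  exact: (cvg_comp _ _ (@cu t x) (@continuous_clamp _ _ d0' (u t x))).
have dK := dom_Wadj eps0 l0 le cphi dphi.
have dpsi x : is_derive x 1 psi (psi' x) by exact: is_derive_Wadj l0 cphi dphi.
have cpsi' : continuous psi'.
  move=> x; apply: cvgM; last exact: cvg_cst.
  by apply: cvgB; [exact: cphi|exact: (is_derive_continuous dpsi)].
have dpsi'dom : dom l psi'.
  by apply: eq_dom (domZ eps^-1 (domB dphi dK)) => x; exact: mulrC.
have ipsi := dom_intg l0 dK; have ipsi' := dom_intg l0 dpsi'dom.
have D1 := is_derive_momentum eps0 V_bounded V_lip sol1 dpsi cpsi' ipsi ipsi' t0.
have D2 := is_derive_momentum eps0 V_bounded V_lip sol2 dpsi cpsi' ipsi ipsi' t0.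
(* The test function stays frozen at time [t], so [A] is linear in the solutions and differentiable;
   [E d - A] is then a second-order remainder around [t], of derivative [0] there. *)
pose A q := \int[leb R]_x (r1 q x * psi x) - \int[leb R]_x (r2 q x * psi x).
have DA := is_deriveB D1 D2.
have AE q : A q = \int[leb R]_x (u q x * phi x).
  rewrite /A -(Weps_adjoint eps0 l0 le (rs_density sol1 q) dphi).
  rewrite -(Weps_adjoint eps0 l0 le (rs_density sol2 q) dphi) -RintegralB//.
  - by apply: eq_Rintegral => x _; rewrite mulrBl.
  - exact: (Weps_intg eps0 l0 (rs_density sol1 q) dphi).
  - exact: (Weps_intg eps0 l0 (rs_density sol2 q) dphi).
(* A factor [2] from [(x + y) ^+ 2 <= 2 * (x ^+ 2 + y ^+ 2)], another for the two solutions, and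
   [d^-1] from [huber_taylor]. *)
pose C := 4 * (2 * M / eps) ^+ 2 * Th / d.
have DR : is_derive t 1 (fun q => E d q - A q) 0.
  have tn : \forall h \near (0 : R), `|h| <= t by exact: nbhs0_le.
  apply: (@is_derive_quadratic _ _ _ _ C); near=> h.
  have ht : 0 <= h + t.
    have : `|h| <= t by near: h; exact: tn.
    by rewrite ler_norml => /andP[]; lra.
  rewrite mulr0 subr0; pose q := h + t; rewrite -/q.
  have iA p : intg (fun x => u p x * phi x).
    apply: (dom_intg l0); apply: (domM (D := 1)); first exact: dphi.
      exact: mu.
    exact: u_le1.
  have iE p := dom_intg l0 (dom_huber p d0).
  have EA p : E d p - A p = \int[leb R]_x (huber d (u p x) * weight l x - u p x * phi x).
    by rewrite AE /E -RintegralB; [|exact: measurableT|exact: iE|exact: iA].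
  have iEA p : intg (fun x => huber d (u p x) * weight l x - u p x * phi x).
    by apply: intgB; [exact: iE|exact: iA].
  rewrite (_ : E d q - A q - (E d t - A t) = \int[leb R]_x
      ((huber d (u q x) - huber d (u t x) - s x * (u q x - u t x)) * weight l x)); last first.
    apply: (etrans (congr2 (fun a b : R => a - b) (EA q) (EA t))).
    apply: (etrans (esym (RintegralB measurableT (iEA q) (iEA t)))).
    by apply: eq_Rintegral => x _; rewrite /phi; ring.
  pose B (r : R -> R -> R) x := weight l x * (Weps eps (r q) x - Weps eps (r t) x) ^+ 2.
  have iB r v0 : regular_solution V eps v0 r -> intg (B r).
    move=> sol; apply: (dom_intg l0); apply: (domMr (D := 1)); first exact: dom_weight.
      apply: measurable_funX; apply: measurable_funB; apply: continuous_measurable_fun.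
        exact: continuous_Weps (rs_density sol q).
      exact: continuous_Weps (rs_density sol t).
    move=> x; rewrite normrX exprn_ile1//.
    exact: Weps_diff_norm (rs_density sol q) (rs_density sol t).
  have iB1 := iB _ _ sol1; have iB2 := iB _ _ sol2.
  apply: (@le_trans _ _ (\int[leb R]_x (2 / d * (B r1 x + B r2 x)))).
    apply: le_abs_Rint.
    - apply: measurable_funM; last exact: measurable_weight.
      apply: measurable_funB.
        by apply: measurable_funB; apply: measurable_huber => //; exact: mu.
      by apply: measurable_funM; [exact: ms|apply: measurable_funB; exact: mu].
    - by apply: intgZ; exact: intgD.
    move=> x; have /andP[h1 h2] := huber_taylor (u t x) (u q x) d0.
    rewrite ger0_norm; last by rewrite mulr_ge0 ?weight_ge0.
    apply: (le_trans (ler_wpM2r (weight_ge0 l x) h2)).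
    rewrite /B [leRHS](_ : _ = 2 * ((Weps eps (r1 q) x - Weps eps (r1 t) x) ^+ 2 +
      (Weps eps (r2 q) x - Weps eps (r2 t) x) ^+ 2) / d * weight l x); last by ring.
    rewrite ler_wpM2r ?weight_ge0// ler_pM2r ?invr_gt0// /u /W1 /W2.
    set x1 := Weps eps (r1 q) x; set x2 := Weps eps (r2 q) x.
    set y1 := Weps eps (r1 t) x; set y2 := Weps eps (r2 t) x.
    rewrite -subr_ge0 (_ : _ - _ = ((x1 - y1) + (x2 - y2)) ^+ 2); last by ring.
    exact: sqr_ge0.
  rewrite RintegralZl//; last exact: intgD.
  rewrite RintegralD//.
  have I1 := Weps_increment_L2 eps0 l0 le V_bounded V_lip sol1 (ltW t0) ht.
  have I2 := Weps_increment_L2 eps0 l0 le V_bounded V_lip sol2 (ltW t0) ht.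
  have qt : q - t = h by rewrite /q addrK.
  rewrite -/q qt -/Th in I1 I2.
  rewrite /C [leRHS](_ : _ = 2 / d * ((2 * M / eps) ^+ 2 * h ^+ 2 * Th +
    (2 * M / eps) ^+ 2 * h ^+ 2 * Th)); last by ring.
  by apply: ler_wpM2l; [rewrite divr_ge0|exact: lerD I1 I2].
exists (\int[leb R]_x (V (W1 t x) * r1 t x * psi' x) -
        \int[leb R]_x (V (W2 t x) * r2 t x * psi' x)).
  have := is_deriveD DR DA; rewrite add0r; congr is_derive.
  by apply/funext => q; rewrite /= fctE subrK.
have Vr1 x : `|V (W1 t x) * r1 t x| <= M.
  by rewrite normrM -[leRHS]mulr1 ler_pM// density_norm//; exact: (rs_density sol1 t).
have Vr2 x : `|V (W2 t x) * r2 t x| <= M.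
  by rewrite normrM -[leRHS]mulr1 ler_pM// density_norm//; exact: (rs_density sol2 t).
have := entropy_production V_bounded V_lip V_decr G_mean eps0 l0 le l1 d0 d1
  (rs_density sol1 t) (rs_density sol2 t).
apply: le_trans; rewrite -RintegralB//; last 2 first.
- apply: (intgM (C := M) ipsi') => [|x]; last exact: Vr1.
  apply: measurable_funM; last by case: (rs_density sol1 t).
  apply: measurableT_comp; apply: continuous_measurable_fun; first exact: lipschitz_continuous V_lip.
  exact: continuous_Weps (rs_density sol1 t).
- apply: (intgM (C := M) ipsi') => [|x]; last exact: Vr2.
  apply: measurable_funM; last by case: (rs_density sol2 t).
  apply: measurableT_comp; apply: continuous_measurable_fun; first exact: lipschitz_continuous V_lip.
  exact: continuous_Weps (rs_density sol2 t).
rewrite le_eqVlt; apply/orP; left; apply/eqP; apply: eq_Rintegral => x _.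
by rewrite -mulrBl.
Unshelve. all: by end_near. Qed.

Lemma weighted_contraction t : 0 <= t ->
  \int[leb R]_x (`|Weps eps (r1 t) x - Weps eps (r2 t) x| * weight l x) <=
  expR ((2 * M + 4 * L) * l * t) *
  \int[leb R]_x (`|Weps eps q1 x - Weps eps q2 x| * weight l x).
Proof.
move=> t0; set X := leLHS; set Y := \int[leb R]_x _.
have Th0 : 0 <= Th by apply: Rintegral_ge0 => x _; exact: weight_ge0.
pose a := (2 * M + 4 * L) * l.
pose c := 4 * M + 4 * L + 7 * L / eps.
have a0 : 0 <= a by rewrite mulr_ge0 ?(ltW l0)// addr_ge0 ?mulr_ge0.
have c0 : 0 <= c.
  by rewrite /c !addr_ge0 ?mulr_ge0// ?invr_ge0 ?(ltW eps0)// mulr_ge0.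
have iu p : intg (fun x => `|u p x| * weight l x).
  apply: (dom_intg l0); apply: (domM (D := 1)); first exact: dom_weight.
    by apply: measurableT_comp => //; exact: mu.
  by move=> x; rewrite normr_id.
have dq1 := rs_density0 sol1; have dq2 := rs_density0 sol2.
pose v x := Weps eps q1 x - Weps eps q2 x.
have v1 x : `|v x| <= 1 by exact: Weps_diff_norm.
have mv : measurable_fun setT v.
  by apply: measurable_funB; apply: continuous_measurable_fun; exact: continuous_Weps.
have iv : intg (fun x => `|v x| * weight l x).
  apply: (dom_intg l0); apply: (domM (D := 1)); first exact: dom_weight.
    by apply: measurableT_comp.
  by move=> x; rewrite normr_id.
have init : \int[leb R]_x (`|u 0 x| * weight l x) <= Y.
  have i1 := Weps_initial eps0 l0 le V_bounded V_lip sol1.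
  have i2 := Weps_initial eps0 l0 le V_bounded V_lip sol2.
  have iD r v0 : regular_solution V eps v0 r ->
      intg (fun x => weight l x * `|Weps eps (r 0) x - Weps eps v0 x|).
    move=> sol; apply: (dom_intg l0); apply: (domMr (D := 1)); first exact: dom_weight.
      apply: measurableT_comp => //; apply: measurable_funB; apply: continuous_measurable_fun.
        exact: continuous_Weps (rs_density sol 0).
      exact: continuous_Weps (rs_density0 sol).
    move=> x; rewrite normr_id.
    exact: Weps_diff_norm (rs_density sol 0) (rs_density0 sol).
  have iD1 := iD _ _ sol1; have iD2 := iD _ _ sol2.
  apply: (@le_trans _ _ (Y + (\int[leb R]_x (weight l x * `|W1 0 x - Weps eps q1 x|) +
      \int[leb R]_x (weight l x * `|W2 0 x - Weps eps q2 x|)))); last first.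
    by rewrite gerDl -[leRHS]addr0; exact: lerD i1 i2.
  rewrite -RintegralD// /Y -RintegralD//; last exact: intgD.
  apply: le_Rint => //; first by apply: intgD => //; exact: intgD.
  move=> x; rewrite -mulrDr mulrC (mulrC _ (weight l x)) -mulrDr ler_wpM2l ?weight_ge0//.
  rewrite (_ : u 0 x = v x + ((W1 0 x - Weps eps q1 x) - (W2 0 x - Weps eps q2 x))); last first.
    by rewrite /u /v; ring.
  by apply: (le_trans (ler_normD _ _)); rewrite lerD2l ler_normB.
have step d : 0 < d -> d <= 1 -> X <= expR (a * t) * Y + d * (expR (a * t) * c * Th * t + Th).
  move=> d0 d1.
  have [D dD D_le] : exists2 D : R -> R, forall s, 0 < s -> is_derive s 1 (E d) (D s) &
      forall s, 0 < s -> D s <= a * E d s + c * d * Th.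
    (* Derivatives are known to exist time by time; choice assembles them into a function, with the
       irrelevant value [0] at nonpositive times. *)
    have h s : {D | 0 < s -> is_derive s 1 (E d) D /\ D <= a * E d s + c * d * Th}.
      apply: cid; have [s0|s0] := ltP 0 s; last by exists 0.
      by have [D D1 D2] := entropy_evolution d0 d1 s0; exists D.
    exists (fun s => sval (h s)) => s s0; by have [] := svalP (h s) s0.
  have b0 : 0 <= c * d * Th by rewrite !mulr_ge0// ltW.
  have G0 := gronwall a0 b0 t0 (continuous_E d0) dD D_le.
  have E0 : E d 0 <= Y.
    apply: le_trans init; apply: le_Rint => //; first exact: dom_intg l0 (dom_huber 0 d0).
    by move=> x; rewrite ler_wpM2r ?weight_ge0//; case/andP: (huber_bounds (u 0 x) d0).
  have Xle : X <= E d t + d * Th.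
    rewrite -RintegralZl ?intg_weight// -RintegralD//; last 2 first.
    - exact: dom_intg l0 (dom_huber t d0).
    - by apply: intgZ; exact: intg_weight.
    apply: le_Rint; first exact: iu.
      by apply: intgD; [exact: dom_intg l0 (dom_huber t d0)|apply: intgZ; exact: intg_weight].
    move=> x; rewrite -mulrDl ler_wpM2r ?weight_ge0// -lerBlDr.
    by case/andP: (huber_bounds (u t x) d0).
  have e0 := expR_gt0 (a * t).
  have : E d t <= expR (a * t) * (Y + c * d * Th * t).
    by apply: (le_trans G0); rewrite ler_pM2l// lerD2r.
  rewrite mulrDr => h.
  rewrite [leRHS](_ : _ = expR (a * t) * Y + expR (a * t) * (c * d * Th * t) + d * Th); last by ring.
  by apply: (le_trans Xle); rewrite lerD2r.
set Z := expR (a * t) * c * Th * t + Th in step.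
have Z0 : 0 <= Z by rewrite addr_ge0 ?mulr_ge0 ?expR_ge0.
apply/ler_addgt0Pl => e e0.
(* With [l] fixed, [Z] does not depend on [d], so the smoothing error [d * Z] can be made smaller
   than [e]. *)
pose d := Num.min 1 (e / (Z + 1)).
have Z1 : 0 < Z + 1 by rewrite ltr_wpDl.
have d0 : 0 < d by rewrite lt_min ltr01 divr_gt0.
have d1 : d <= 1 by rewrite ge_min lexx.
have de : d <= e / (Z + 1) by rewrite ge_min lexx orbT.
apply: (le_trans (step d d0 d1)); rewrite addrC lerD2r.
apply: (le_trans (ler_wpM2r Z0 de)); rewrite mulrAC ler_pdivrMr//.
by rewrite ler_wpM2l ?(ltW e0)// lerDl.
Qed.

End contraction.

(** * Reduction to a velocity and solutions without exceptional sets *)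

Section velocity.
Context {R : realType}.
Implicit Types (a b w x : R).

(** The projection onto [[0, 1]], used twice: on the values of densities, to do away with null sets,
    and on the argument of [V], to extend it to a bounded Lipschitz monotone function on the
    line. *)
Definition unit_clamp w : R := Num.max 0 (Num.min 1 w).

Lemma unit_clamp01 w : 0 <= unit_clamp w <= 1.
Proof. by rewrite /unit_clamp le_max lexx/= ge_max ler01 ge_min lexx. Qed.

Lemma unit_clamp_id w : 0 <= w <= 1 -> unit_clamp w = w.
Proof. by move=> /andP[w0 w1]; rewrite /unit_clamp min_r// max_r. Qed.

Lemma unit_clamp_le0 w : w <= 0 -> unit_clamp w = 0.
Proof. by move=> w0; rewrite /unit_clamp max_l// ge_min w0 orbT. Qed.

Lemma unit_clamp_lip a b : `|unit_clamp a - unit_clamp b| <= `|a - b|.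
Proof.
have := ler_norm (a - b); have := ler_norm (- (a - b)); rewrite normrN ler_norml /unit_clamp.
by have [a1|a1] := leP 1 a; have [b1|b1] := leP 1 b => h1 h2;
  repeat (match goal with |- context [Num.max 0 ?z] =>
    let h := fresh in have [h|h] := leP 0 z end);
  apply/andP; split; lra.
Qed.

Lemma continuous_unit_clamp : continuous unit_clamp.
Proof. by apply: (@lipschitz_continuous _ _ 1) => a b; rewrite mul1r unit_clamp_lip. Qed.

Lemma unit_clamp_mono a b : a <= b -> unit_clamp a <= unit_clamp b.
Proof.
move=> ab; rewrite /unit_clamp ge_max !le_max lexx/=.
by rewrite le_min !ge_min lexx ab !orbT.
Qed.

Lemma lipschitz_bound (V : R -> R) : [lipschitz V x | x in `[0, 1]] ->
  exists L, forall a b, 0 <= a <= 1 -> 0 <= b <= 1 -> `|V a - V b| <= L * `|a - b|.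
Proof.
move=> hV.
have [L [_ hL]] := hV.
(* The Lipschitz bound is given for all constants beyond a threshold [L]; [L + 1] is strictly
   beyond. *)
exists (L + 1) => a b ha hb.
have := hL (L + 1); rewrite ltrDl ltr01 => /(_ isT) /(_ (a, b)) /=; apply.
by split; rewrite /= in_itv.
Qed.

Variables (f : R -> R) (L : R).
Hypothesis f_lip : forall a b, `|f a - f b| <= L * `|a - b|.

Let L_ge0 : 0 <= L.
Proof. by have := le_trans (normr_ge0 _) (f_lip 1 0); rewrite subr0 normr1 mulr1. Qed.

Let cf : continuous f. Proof. exact: lipschitz_continuous f_lip. Qed.

(* [f] is constant on the negative half-line, whence a primitive on the whole line. *)
Hypothesis f_left : forall w, w <= 0 -> f w = f 0.

Lemma exists_primitive : exists G : R -> R, forall w, is_derive w 1 G (f w).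
Proof.
pose g w := f w - f 0.
have cg : continuous g by move=> w; apply: cvgB; [exact: cf|exact: cvg_cst].
have mg : measurable_fun setT g by exact: continuous_measurable_fun.
have ig b : (leb R).-integrable `]-oo, b] (EFin \o g).
  apply/integrable_mkcond => //; rewrite restrict_EFin.
  apply: (@intg_le _ _ (fun x => L * `|b| * \1_(`[0, `|b|]%classic : set R) x)).
  - apply/measurable_restrict => //; exact: measurable_funS mg.
  - by apply: intgZ; exact: (integrable_indic_itv 0 `|b| true false).
  - move=> x; rewrite patchE; case: ifPn => [|_]; last first.
      by rewrite normr0 !mulr_ge0// indicE.
    rewrite inE/= in_itv/= => xb; have [x0|x0] := leP x 0.
      by rewrite /g f_left// subrr normr0 !mulr_ge0// indicE.
    have xb' : x <= `|b| by exact: le_trans (ler_norm b).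
    rewrite indicE mem_set/=; last by rewrite in_itv/= (ltW x0).
    rewrite mulr1; apply: (le_trans (f_lip x 0)).
    by rewrite subr0 ler_wpM2l// gtr0_norm.
exists (fun w => f 0 * w + \int[leb R]_(t in `]-oo, w]) g t) => w.
have ww1 : w < w + 1 by rewrite ltrDl.
have := @continuous_FTC1 _ g -oo%O w (w + 1) ww1 (ig _).
move=> /= ftc; have {ftc} [||dG G'] := ftc; [by rewrite ltNyr|exact: cg|].
have d1 : is_derive w 1 (fun w => \int[leb R]_(t in `]-oo, w]) g t) (g w).
  by apply: DeriveDef; [exact: dG|rewrite -derive1E].
have d2 := is_deriveD (is_deriveZ (f 0) (is_derive_id w (1 : R))) d1.
by apply: (is_derive_eq d2); rewrite /GRing.scale/= mulr1 /g addrCA subrr addr0.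
Qed.

Lemma Rint_FTC2 (F g : R -> R) a b : a < b -> (forall x, is_derive x 1 F (g x)) ->
  continuous g -> \int[leb R]_(x in `]a, b[) g x = F b - F a.
Proof.
move=> ab dF cg; have cF := is_derive_continuous dF.
have ig := continuous_itv_integrable a b cg.
rewrite Rintegral_itv_bndo_bndc; last first.
  by apply: integrableS ig => //; apply: subset_itv; rewrite bnd_simp.
rewrite Rintegral_itv_obnd_cbnd; last first.
  by apply: integrableS ig => //; apply: subset_itv; rewrite bnd_simp.
rewrite /Rintegral (@continuous_FTC2 _ g F)//.
- exact: continuous_subspaceT.
- split.
  + by move=> x _; have [h _] := dF x.
  + by apply: cvg_at_right_filter; exact: cF.
  + by apply: cvg_at_left_filter; exact: cF.
- by move=> x _; rewrite derive1E; have [_ h] := dF x.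
Qed.

(* Integrate the difference quotients of [f] over [a, b]: they converge to
   [f b - f a], while their positive parts tend to [0] almost everywhere. *)
Lemma ae_nonincreasing a b : a < b ->
  {ae leb R, forall x, a < x < b -> exists2 d : R, is_derive x 1 f d & d <= 0} ->
  f b <= f a.
Proof.
move=> ab aef; have [G dG] := exists_primitive.
have cG := is_derive_continuous dG.
pose D n x := (f (x + harmonic n) - f x) / harmonic n.
have cD n : continuous (D n).
  move=> x; apply: cvgM; last exact: cvg_cst.
  apply: cvgB; last exact: cf.
  apply: (@continuous_comp _ _ _ (fun x => x + harmonic n) f); last exact: cf.
  by apply: cvgD; [exact: cvg_id|exact: cvg_cst].
have DL n x : `|D n x| <= L.
  have [h0 _] := @harmonic_bounds R n.
  rewrite normrM normfV (gtr0_norm h0) ler_pdivrMr//; apply: (le_trans (f_lip _ _)).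
  by rewrite addrAC subrr add0r gtr0_norm.
pose I := `]a, b[%classic : set R.
pose P n := (fun x => Num.max 0 (D n x)) \_ I.
have cm := @continuous_max0 R.
have cP n : continuous (fun x => Num.max 0 (D n x)).
  by move=> x; apply: (@continuous_comp _ _ _ (D n) (Num.max 0)); [exact: cD|exact: cm].
have mI : measurable I by exact: measurable_itv.
have limP : \int[leb R]_x P n x @[n --> \oo] --> \int[leb R]_x (cst 0 x : R).
  apply: (@Rint_dct_ae _ _ _ (fun x => L * \1_I x)).
  - move=> n; apply/measurable_restrict => //; apply: measurable_funTS.
    exact: continuous_measurable_fun.
  - exact: measurable_cst.
  - move: aef; apply: filterS; first exact: (ae_filter_ringOfSetsType (leb R)).
    move=> x hx; have [xI|xI] := boolP (x \in I); last first.
      by under eq_fun do rewrite /P patchE (negbTE xI); exact: cvg_cst.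
    under eq_fun do rewrite /P patchE xI.
    move: xI => /set_mem; rewrite /I /= in_itv/= => /hx [d dfx d0].
    have hn n : harmonic n != 0 :> R by rewrite gt_eqF//; case: (@harmonic_bounds R n).
    have lim := is_derive_seq dfx (@cvg_harmonic R) hn.
    have := cvg_comp _ _ lim (@cm d).
    by rewrite (max_l d0).
  - by apply: intgZ; exact: (integrable_indic_itv a b false true).
  - move=> n x; rewrite /P patchE indicE; case: (_ \in _); rewrite ?normr0 ?mulr0 ?mulr1//.
    have [d0|d0] := leP 0 (D n x); first exact: DL.
    by rewrite normr0.
(* The quotient of [f] has the quotient of [G] as a primitive. The integral thus becomes a
   difference of quotients of [G] at the endpoints, which converge to [f b] and [f a] everywhere. *)
have DE n : \int[leb R]_(x in I) D n x =
    (G (b + harmonic n) - G b) / harmonic n - (G (a + harmonic n) - G a) / harmonic n.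
  pose F x := (G (x + harmonic n) - G x) / harmonic n.
  have dF x : is_derive x 1 F (D n x).
    have d1 : is_derive x 1 (fun x => G (x + harmonic n)) (f (x + harmonic n)).
      have dh := is_deriveD (is_derive_id x (1 : R)) (is_derive_cst (harmonic n : R) x (1 : R)).
      apply: (is_derive_eq (@is_derive1_comp _ G _ x _ _ (dG _) dh)).
      by rewrite addr0 mulr1.
    have d2 := is_deriveZ (harmonic n : R)^-1 (is_deriveB d1 (dG x)).
    rewrite (_ : F = (harmonic n : R)^-1 *: ((fun x => G (x + harmonic n)) - G)); last first.
      by apply/funext => y; rewrite /F mulrC.
    by apply: (is_derive_eq d2); rewrite /GRing.scale/= mulrC.
  by rewrite (Rint_FTC2 ab dF (cD n)) /F mulrBl.
have limD : \int[leb R]_(x in I) D n x @[n --> \oo] --> f b - f a.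
  under eq_fun do rewrite DE.
  have hn n : harmonic n != 0 :> R by rewrite gt_eqF//; case: (@harmonic_bounds R n).
  by apply: cvgB; apply: is_derive_seq (dG _) (@cvg_harmonic R) hn.
rewrite -subr_le0 -[leRHS](_ : \int[leb R]_x (cst 0 x : R) = 0); last first.
  by rewrite Rintegral_cst// mul0r.
apply: (ler_cvg_to limD limP); apply: nearW => n.
rewrite [leRHS](_ : _ = \int[leb R]_(x in I) Num.max 0 (D n x)); last first.
  by rewrite [RHS]Rintegral_mkcond.
apply: le_Rintegral => //.
- apply: integrableS (continuous_itv_integrable a b (cD n)) => //.
  by apply: subset_itv; rewrite bnd_simp.
- apply: integrableS (continuous_itv_integrable a b (cP n)) => //.
  by apply: subset_itv; rewrite bnd_simp.
by move=> x _; rewrite le_max lexx orbT.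
Qed.

End velocity.

Lemma ae_eq_Rint d (T : measurableType d) (R : realType) (mu : {measure set T -> \bar R})
    (D : set T) (f g : T -> R) :
  measurable D -> measurable_fun D f -> measurable_fun D g ->
  {ae mu, forall x, D x -> f x = g x} ->
  \int[mu]_(x in D) f x = \int[mu]_(x in D) g x.
Proof.
move=> mD mf mg fg; rewrite /Rintegral; congr fine; apply: ae_eq_integral => //.
- exact/measurable_EFinP.
- exact/measurable_EFinP.
- move: fg; apply: filterS.
  by move=> x + Dx => /(_ Dx) ->.
Qed.

Lemma continuous_max0_comp (R : realType) (f : R -> R) :
  {within `[0, +oo[, continuous f} -> continuous (fun t : R => f (Num.max 0 t)).
Proof.
move=> /subspace_continuousP cf t.
have t0 : `[0, +oo[%classic (Num.max 0 t) by rewrite /= in_itv/= andbT le_max lexx.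
apply: (cvg_comp _ _ _ (cf _ t0)).
move=> A; rewrite /within/= => nA.
have : \forall s \near t, `[0, +oo[%classic (Num.max 0 s : R) -> A (Num.max 0 s).
  exact: (@continuous_max0 R t _ nA).
apply: filterS => s; apply.
by rewrite /= in_itv/= andbT le_max lexx.
Qed.

(** * Removal of the exceptional null sets *)

Section regularization.
Context {R : realType}.
Variables (V : R -> R) (eps : R) (rho0 : R -> R) (rho : R -> R -> R).
Hypothesis eps0 : 0 < eps.
Hypothesis cV : continuous (fun w => V (unit_clamp w)).
Hypothesis mrho0 : measurable_fun setT rho0.
Hypothesis rho0_01 : \forall x \ae leb R, 0 <= rho0 x <= 1.
Hypothesis sol : weak_solution V eps rho0 rho.

Let Vc w := V (unit_clamp w).
Let r t x := unit_clamp (rho (Num.max 0 t) x).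
Let r0 x := unit_clamp (rho0 x).

Let D : set (R * R) := [set p : R * R | 0 <= p.1].

Let mD : measurable D.
Proof.
rewrite (_ : D = fst @^-1` `[0, +oo[%classic); last first.
  by apply/seteqP; split => p /=; rewrite in_itv/= andbT.
by rewrite -[X in measurable X]setTI; exact: measurable_fst.
Qed.

Let mrho : measurable_fun D (fun p : R * R => rho p.1 p.2) := ws_measurable sol.

Let mclamp : measurable_fun setT (@unit_clamp R).
Proof. by apply: continuous_measurable_fun; exact: continuous_unit_clamp. Qed.

Let mr : measurable_fun setT (fun p : R * R => r p.1 p.2).
Proof.
apply: measurableT_comp => //.
apply: (@measurable_comp _ _ _ _ _ _ D (fun p : R * R => rho p.1 p.2) setT
  (fun p : R * R => (Num.max 0 p.1, p.2))) => //.
  by move=> _ [p _ <-]; rewrite /D/= le_max lexx.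
apply: measurable_fun_pair; last exact: measurable_snd.
apply: measurableT_comp; last exact: measurable_fst.
by apply: continuous_measurable_fun; exact: continuous_max0.
Qed.

Let dr t : density (r t).
Proof.
split; last by move=> x; exact: unit_clamp01.
exact: (measurable_fun_pair2 t mr).
Qed.

Let dr0 : density r0.
Proof. by split; [exact: measurableT_comp|move=> x; exact: unit_clamp01]. Qed.

Let mrhot t : 0 <= t -> measurable_fun setT (rho t).
Proof.
move=> t0; apply: (@measurable_comp _ _ _ _ _ _ D (fun p : R * R => rho p.1 p.2) setT
  (pair t)) => //.
by move=> _ [x _ <-]; rewrite /D/=.
Qed.

Let rho_r t : 0 <= t -> {ae leb R, forall x, rho t x = r t x}.
Proof.
move=> t0; have := ws_range sol t0.
apply: filterS; first exact: (ae_filter_ringOfSetsType (leb R)).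
by move=> x h; rewrite /r max_r// unit_clamp_id.
Qed.

Let rho0_r0 : {ae leb R, forall x, rho0 x = r0 x}.
Proof.
move: rho0_01; apply: filterS; first exact: (ae_filter_ringOfSetsType (leb R)).
by move=> x h; rewrite /r0 unit_clamp_id.
Qed.

Let Weps_ae (f g : R -> R) x : measurable_fun setT f -> measurable_fun setT g ->
  {ae leb R, forall x, f x = g x} -> Weps eps f x = Weps eps g x.
Proof.
move=> mf mg fg; rewrite /Weps; congr (_ * _).
have me : measurable_fun setT (fun y : R => expR ((x - y) / eps)).
  apply: measurableT_comp; first exact: measurable_expR.
  by apply: measurable_funM => //; exact: measurable_funB.
apply: ae_eq_Rint => //.
- by apply: measurable_funTS; exact: measurable_funM.
- by apply: measurable_funTS; exact: measurable_funM.
- move: fg; apply: filterS; first exact: (ae_filter_ringOfSetsType (leb R)).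
  by move=> y -> _.
Qed.

Lemma Weps_regular t x : 0 <= t -> Weps eps (rho t) x = Weps eps (r t) x.
Proof.
by move=> t0; apply: Weps_ae; [exact: mrhot|case: (dr t)|exact: rho_r].
Qed.

Lemma Weps_regular0 x : Weps eps rho0 x = Weps eps r0 x.
Proof. by apply: Weps_ae; [exact: mrho0|case: dr0|exact: rho0_r0]. Qed.

(** The exceptional set of the range condition depends on [t]. The union of these sets is null in
    the plane because it is measurable there and all its sections at times [0 <= t] are null. *)
Let rho_r2 : {ae (leb R \x leb R)%E, forall p : R * R, D p -> rho p.1 p.2 = r p.1 p.2}.
Proof.
pose h (p : R * R) := rho p.1 p.2 - r p.1 p.2.
have mh : measurable_fun D h.
  by apply: measurable_funB => //; exact: measurable_funTS.
pose N := D `&` h @^-1` [set~ 0].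
have mN : measurable N by apply: mh => //; exact: measurableC.
exists N; split => //.
- rewrite /product_measure1 integral0_eq// => t _ /=.
  have [t0|t0] := leP 0 t; last first.
    rewrite (_ : xsection N t = set0) ?measure0//; apply/seteqP; split => x //.
    by rewrite /xsection/= inE => -[]; rewrite /D/= leNgt t0.
  apply: measure_negligible; first exact: measurable_xsection.
  have [B [mB B0 sB]] := rho_r t0; exists B; split => //.
  move=> x; rewrite /xsection/= inE => -[_ hx]; apply: sB => /= e.
  by apply: hx; rewrite /h/= e subrr.
- move=> p /= /not_implyP[Dp hp]; split => //= /eqP; rewrite subr_eq0 => /eqP.
  exact: hp.
Qed.

(** Truncation alters the densities on null sets only, which neither [Weps] nor the integrals see,
    and [Vc] agrees with [V] on the averages because these lie in [[0, 1]]. *)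
Lemma regularization : regular_solution Vc eps r0 r.
Proof.
split => //.
- move=> psi ipsi; have mpsi := intg_measurable ipsi.
  have psiL : psi \in Lfun (leb R) 1%E by apply/Lfun1_integrable.
  rewrite (_ : (fun t => _) = fun t => \int[leb R]_x (rho (Num.max 0 t) x * psi x)).
    exact: continuous_max0_comp (ws_continuous sol psiL).
  apply/funext => t; apply/esym.
  have t0 : 0 <= Num.max 0 t by rewrite le_max lexx.
  apply: ae_eq_Rint => //.
  + by apply: measurable_funM => //; exact: mrhot.
  + by apply: measurable_funM => //; case: (dr t).
  + move: (rho_r t0); apply: filterS; first exact: (ae_filter_ringOfSetsType (leb R)).
    by move=> x -> _; rewrite /r (max_r t0).
- move=> phi phi1 mdt mdx; rewrite -[RHS](ws_weak sol phi1).
  have [dphi _ _ _] := phi1.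
  have mphi0 : measurable_fun setT (phi 0).
    apply: continuous_measurable_fun => x; apply: differentiable_continuous.
    by apply/derivable1_diffP; case: (dphi 0 x).
  congr (_ + _); last first.
    apply: ae_eq_Rint => //.
    + by apply: measurable_funM => //; case: dr0.
    + exact: measurable_funM.
    + move: rho0_r0; apply: filterS; first exact: (ae_filter_ringOfSetsType (leb R)).
      by move=> x -> _.
  have mVW : measurable_fun setT (fun p : R * R => Vc (Weps eps (r p.1) p.2)).
    apply: measurableT_comp; first exact: (continuous_measurable_fun cV).
    exact: measurable_Weps2.
  have VE (p : R * R) : D p -> V (Weps eps (rho p.1) p.2) = Vc (Weps eps (r p.1) p.2).
    by move=> Dp; rewrite Weps_regular// /Vc unit_clamp_id// Weps_ge0// Weps_le1.
  apply: ae_eq_Rint => //.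
  + apply: measurable_funTS; apply: measurable_funD; apply: measurable_funM => //.
    exact: measurable_funM.
  + apply: (eq_measurable_fun (fun p : R * R => rho p.1 p.2 * dt phi p.1 p.2 +
      Vc (Weps eps (r p.1) p.2) * rho p.1 p.2 * dx phi p.1 p.2)).
      by move=> p /set_mem Dp; rewrite VE.
    apply: measurable_funD; apply: measurable_funM => //; try exact: measurable_funTS.
    by apply: measurable_funM => //; exact: measurable_funTS.
  + move: rho_r2; apply: filterS; first exact: (ae_filter_ringOfSetsType (leb R \x leb R)%E).
    by move=> p h Dp; rewrite VE// (h Dp).
Qed.

End regularization.

(** * Removal of the weight and monotonicity of the extended velocity *)

Section conclusion.
Context {R : realType}.
Implicit Types (V u v : R -> R) (eps l : R).

Lemma cvg_harmonic_comp (f : R -> R) c : {for 0, continuous f} ->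
  f (c * harmonic n) @[n --> \oo] --> f 0.
Proof.
move=> cf; apply: continuous_cvg => //; rewrite -[X in _ --> X](mulr0 c).
by apply: cvgM; [exact: cvg_cst|exact: cvg_harmonic].
Qed.

(** Monotone convergence in the extended reals: the limit may be infinite, so integrability of the
    difference of the averages at time [t] need not be known beforehand. *)
Lemma integral_weight_cvg u c : 0 <= c -> measurable_fun setT u ->
  (\int[leb R]_x (`|u x| * weight (c * harmonic n) x)%:E @[n --> \oo] -->
   \int[leb R]_x `|u x|%:E)%E.
Proof.
move=> c0 mu; pose g n x := (`|u x| * weight (c * harmonic n) x)%:E.
have g_lim x : g n x @[n --> \oo] --> `|u x|%:E.
  apply: cvg_EFin; first by apply: nearW.
  rewrite -[X in _ --> X]mulr1 -(@expR0 R) -oppr0 -(mul0r `|x|).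
  apply: (@cvg_harmonic_comp (fun l => `|u x| * expR (- (l * `|x|))) c).
  apply: cvgM; first exact: cvg_cst.
  apply: continuous_cvg; first exact: continuous_expR.
  by apply: cvgN; apply: cvgM; [exact: cvg_id|exact: cvg_cst].
rewrite (_ : (\int[leb R]_x `|u x|%:E)%E = (\int[leb R]_x limn (g^~ x))%E); last first.
  by apply: eq_integral => x _; apply/esym/cvg_lim.
apply: (@cvg_monotone_convergence _ _ _ (leb R) _ measurableT g).
- move=> n; apply/measurable_EFinP; apply: measurable_funM; last exact: measurable_weight.
  exact: measurableT_comp.
- by move=> n x _; rewrite lee_fin mulr_ge0// weight_ge0.
- move=> x _ m n mn; rewrite lee_fin ler_wpM2l// ler_expR lerN2 ler_wpM2r//.
  by rewrite ler_wpM2l// /harmonic lef_pV2 ?posrE ?ltr0n// ler_nat ltnS.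
Qed.

(** A point strictly between two values of [unit_clamp] lies in []0, 1[], where the truncated
    velocity coincides with [V] nearby and inherits its derivative. The endpoints, where
    [unit_clamp] has a kink, never occur. *)
Lemma clamped_nonincreasing V L :
  (forall a b, 0 <= a <= 1 -> 0 <= b <= 1 -> `|V a - V b| <= L * `|a - b|) ->
  {ae leb R, forall x : R, x \in `[0, 1] -> derivable V x 1 /\ derive1 V x <= 0} ->
  forall a b, a <= b -> V (unit_clamp b) <= V (unit_clamp a).
Proof.
move=> hL V' a b ab; pose f w := V (unit_clamp w).
have L0 : 0 <= L.
  have := hL 1 0; rewrite !lexx ler01 subr0 normr1 mulr1 => /(_ isT isT).
  exact: le_trans.
have f_lip x y : `|f x - f y| <= L * `|x - y|.
  apply: (le_trans (hL _ _ (unit_clamp01 x) (unit_clamp01 y))).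
  by rewrite ler_wpM2l// unit_clamp_lip.
have f_left w : w <= 0 -> f w = f 0.
  by move=> w0; rewrite /f !unit_clamp_le0.
have -> : V (unit_clamp a) = f (unit_clamp a) by rewrite /f [in RHS]unit_clamp_id ?unit_clamp01.
have -> : V (unit_clamp b) = f (unit_clamp b) by rewrite /f [in RHS]unit_clamp_id ?unit_clamp01.
have := unit_clamp_mono ab; rewrite le_eqVlt => /orP[/eqP->//|ab'].
apply: (ae_nonincreasing f_lip f_left ab').
move: V'; apply: filterS; first exact: (ae_filter_ringOfSetsType (leb R)).
move=> x hx /andP[ax xb].
have /andP[a0 _] := unit_clamp01 a; have /andP[_ b1] := unit_clamp01 b.
have x0 : 0 < x by exact: le_lt_trans ax.
have x1 : x < 1 by exact: lt_le_trans b1.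
have [|dV V'0] := hx; first by rewrite in_itv/= !ltW.
exists (derive1 V x); last exact: V'0.
have dVx : is_derive x 1 V (derive1 V x) by apply: DeriveDef => //; rewrite derive1E.
apply: near_eq_is_derive dVx.
have x01 : x \in `]0, 1[ by rewrite in_itv/= x0.
apply: filterS (near_in_itvoo x01) => y; rewrite in_itv/= => /andP[y0 y1].
by rewrite /f unit_clamp_id// !ltW.
Qed.

End conclusion.

Theorem theorem4p7 (R : realType) (V : R -> R) (eps : R)
  (rho0 rho0' : R -> R) (rho rho' : R -> R -> R)
  (V_lip : [lipschitz V x | x in `[0, 1]])
  (V_prime_le0 : {ae leb R, forall x : R, x \in `[0, 1] ->
     derivable V x 1 /\ derive1 V x <= 0})
  (eps_gt0 : 0 < eps)
  (rho0_Loo : rho0 \in Lfun (leb R) +oo%E)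
  (rho0'_Loo : rho0' \in Lfun (leb R) +oo%E)
  (rho0_01 : \forall x \ae leb R, 0 <= rho0 x <= 1)
  (rho0'_01 : \forall x \ae leb R, 0 <= rho0' x <= 1)
  (rho0_TV : (TV rho0 < +oo)%E)
  (rho0'_TV : (TV rho0' < +oo)%E)
  (rho0_L1 : (rho0 \- rho0') \in Lfun (leb R) 1%E)
  (rho_sol : weak_solution V eps rho0 rho)
  (rho'_sol : weak_solution V eps rho0' rho') :
  forall t : R, 0 < t ->
  ('N[leb R]_1 [EFin \o (Weps eps (rho t) \- Weps eps (rho' t))%R]
   <= 'N[leb R]_1 [EFin \o (Weps eps rho0 \- Weps eps rho0')%R])%E.
Proof.
move=> t t0.
have [L hL] := lipschitz_bound V_lip.
have L0 : 0 <= L.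
  have := hL 1 0; rewrite !lexx ler01 subr0 normr1 mulr1 => /(_ isT isT).
  exact: le_trans.
pose Vc w := V (unit_clamp w).
have Vc_lip a b : `|Vc a - Vc b| <= L * `|a - b|.
  apply: (le_trans (hL _ _ (unit_clamp01 a) (unit_clamp01 b))).
  by rewrite ler_wpM2l// unit_clamp_lip.
have Vc_bounded w : `|Vc w| <= `|V 0| + L.
  have /andP[w0 w1] := unit_clamp01 w.
  have := hL _ 0 (unit_clamp01 w); rewrite lexx ler01 subr0 (ger0_norm w0) => /(_ isT) h.
  rewrite -[Vc w](subrK (V 0)) addrC; apply: (le_trans (ler_normD _ _)); rewrite lerD2l.
  by apply: (le_trans h); rewrite -[leRHS]mulr1 ler_wpM2l.
have Vc_decr : forall a b, a <= b -> Vc b <= Vc a by exact: clamped_nonincreasing hL V_prime_le0.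
have [G dG] : exists G : R -> R, forall w : R, is_derive w 1 G (Vc w).
  apply: (exists_primitive Vc_lip) => w w0.
  by rewrite /Vc !unit_clamp_le0.
have G_mean a b : a <= b -> exists2 c, a <= c <= b & G b - G a = Vc c * (b - a).
  by move=> ab; have := mean_value ab dG.
have cVc : continuous Vc := lipschitz_continuous Vc_lip.
have mrho0 : measurable_fun setT rho0.
  by move: rho0_Loo; rewrite inE => /andP[/[!inE]/= mf _].
have mrho0' : measurable_fun setT rho0'.
  by move: rho0'_Loo; rewrite inE => /andP[/[!inE]/= mf _].
have sol1 := regularization eps_gt0 cVc mrho0 rho0_01 rho_sol.
have sol2 := regularization eps_gt0 cVc mrho0' rho0'_01 rho'_sol.
set r0 := fun x => unit_clamp (rho0 x) in sol1.
set r0' := fun x => unit_clamp (rho0' x) in sol2.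
set r := fun s x => unit_clamp (rho (Num.max 0 s) x) in sol1.
set r' := fun s x => unit_clamp (rho' (Num.max 0 s) x) in sol2.
pose u x := Weps eps (r t) x - Weps eps (r' t) x.
pose v x := Weps eps r0 x - Weps eps r0' x.
have mu : measurable_fun setT u.
  apply: measurable_funB; apply: continuous_measurable_fun; apply: continuous_Weps => //.
    exact: rs_density sol1 t.
  exact: rs_density sol2 t.
have mv : measurable_fun setT v.
  apply: measurable_funB; apply: continuous_measurable_fun; apply: continuous_Weps => //.
    exact: rs_density0 sol1.
  exact: rs_density0 sol2.
rewrite !Lnorm1 (_ : (\int[leb R]_x _)%E = \int[leb R]_x `|u x|%:E)%E; last first.
  apply: eq_integral => x _ /=; rewrite /u.
  by rewrite (Weps_regular rho_sol _ (ltW t0)) (Weps_regular rho'_sol _ (ltW t0)).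
rewrite [leRHS](_ : _ = \int[leb R]_x `|v x|%:E)%E; last first.
  apply: eq_integral => x _ /=; rewrite /v.
  by rewrite (Weps_regular0 eps mrho0 rho0_01) (Weps_regular0 eps mrho0' rho0'_01).
have [voo|] := eqVneq (\int[leb R]_x `|v x|%:E)%E +oo%E; first by rewrite voo leey.
rewrite -ltey => vfin.
have iv : intg (fun x => `|v x|).
  apply/integrableP; split; first by apply/measurable_EFinP; exact: measurableT_comp.
  by under eq_integral do rewrite /= normr_id.
have intE : (\int[leb R]_x `|v x|%:E = (\int[leb R]_x `|v x|)%:E)%E.
  by rewrite /Rintegral fineK//; exact: integrable_fin_num.
(* As [harmonic n <= 1], every [l = c * harmonic n] satisfies both smallness conditions, [l <= 2^-1]
   and [l * eps <= 2^-1]. *)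
pose c := Num.min 2^-1 (2 * eps)^-1.
have c0 : 0 < c by rewrite lt_min !invr_gt0 mulr_gt0// ltr0n.
pose C := (2 * (`|V 0| + L) + 4 * L).
set X := \int[leb R]_x `|v x| in intE *.
have lim : (expR (C * (c * harmonic n) * t) * X)%:E @[n --> \oo] --> X%:E.
  apply: cvg_EFin; first by apply: nearW.
  rewrite -[X in _ --> X]mul1r -(@expR0 R) -(mul0r t) -(mulr0 C).
  apply: (@cvg_harmonic_comp R (fun l => expR (C * l * t) * X) c).
  apply: cvgM; last exact: cvg_cst.
  apply: continuous_cvg; first exact: continuous_expR.
  by apply: cvgM; [apply: cvgM; [exact: cvg_cst|exact: cvg_id]|exact: cvg_cst].
(* The two sides are compared for each [l = c * harmonic n]. As [n] grows, the weight on the left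
   increases to [1] and the Gronwall factor on the right tends to [1]. *)
rewrite intE; apply: (lee_cvg_to (integral_weight_cvg (ltW c0) mu) lim).
apply: nearW => n; set l := c * harmonic n.
have [h0 h1] := @harmonic_bounds R n.
have l0 : 0 < l by rewrite mulr_gt0.
have lc : l <= c by rewrite -[leRHS]mulr1 ler_wpM2l// ltW.
have l1 : l <= 2^-1 by apply: (le_trans lc); rewrite ge_min lexx.
have le : l * eps <= 2^-1.
  rewrite -ler_pdivlMr// -invfM; apply: (le_trans lc).
  by rewrite ge_min lexx orbT.
have ith (w : R -> R) : measurable_fun setT w -> (forall x, `|w x| <= 1) ->
    intg (fun x => `|w x| * weight l x).
  move=> mw w1; apply: (dom_intg l0); apply: (domM (D := 1)); first exact: dom_weight.
    exact: measurableT_comp.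
  by move=> x; rewrite normr_id.
have iu : intg (fun x => `|u x| * weight l x).
  by apply: ith => // x; exact: Weps_diff_norm (rs_density sol1 t) (rs_density sol2 t).
have ivl : intg (fun x => `|v x| * weight l x).
  by apply: ith => // x; exact: Weps_diff_norm (rs_density0 sol1) (rs_density0 sol2).
rewrite -[leLHS]fineK; last exact: integrable_fin_num.
rewrite lee_fin.
apply: (le_trans (weighted_contraction eps_gt0 l0 le l1 Vc_bounded Vc_lip Vc_decr G_mean
  sol1 sol2 (ltW t0))).
rewrite ler_pM2l ?expR_gt0//; apply: le_Rint => // x.
by rewrite -[leRHS]mulr1 ler_wpM2l// weight_le1// ltW.
Qed.
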